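(* Suppose that the following holds: for every pair of integers $r \ge 1$, $d \ge 1$ and every $\varepsilon > 0$ one has $J_{r,d}(X) \ll_{r,d,\varepsilon} X^{\varepsilon}\left(X^r + X^{2r - d(d+1)/2}\right)$ for all $X \ge 1$. Let $d \ge 1$ be an integer, $D = \frac{d(d+1)}{2}$, let $q$ be a prime, $\chi$ a non-principal multiplicative character modulo $q$, and $f$ a real-valued polynomial of degree $d$. Then for every integer $r > D$ and every real $H < q^{\frac{1}{2} + \frac{1}{4(r-D)}}$, and every $\varepsilon > 0$, \[ \sum_{N<n \le N+H} e(f(n))\chi(n) \ll_{r,\varepsilon} H^{1-\frac{1}{r}} q^{\frac{r+1-D}{4r(r-D)} + \varepsilon}, \] uniformly in $N$ (the implied constant depends only on $r$ and $\varepsilon$).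
   Context: $e(t) = e^{2\pi i t}$. For integers $r,d \ge 1$ and real $X$, $J_{r,d}(X)$ denotes the number of integer solutions $(x_1,\ldots,x_{2r})$ with $1 \le x_i \le X$ of the system $x_1^m + \cdots + x_r^m = x_{r+1}^m + \cdots + x_{2r}^m$ for all $1 \le m \le d$. The sum runs over integers $n \in (N, N+H]$.
   Formalization: The bound is asserted for integer N with any real H, or for real N with H ≥ 1; for non-integral N and 0 < H < 1 the sum may be a single term of modulus 1 while the bound tends to 0 as H → 0, so the claim fails there. *)

(* Defs.v *)
From HB Require Import structures.
From mathcomp Require Import all_boot all_order all_algebra.
From mathcomp Require Import complex.
From mathcomp Require Import all_classical all_reals all_analysis.

Set Implicit Arguments.
Unset Strict Implicit.
Unset Printing Implicit Defensive.

Import Order.TTheory GRing.Theory Num.Theory.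

Local Open Scope ring_scope.
Local Open Scope complex_scope.

Definition e (R : realType) (t : R) : R[i] :=
  cos (2 * pi * t) +i* sin (2 * pi * t).

(* The quotient is exact. *)
Definition triangular (d : nat) : nat := (d * d.+1) %/ 2.

(* Integers 1 <= x_i <= X are the nonzero elements of 'I_(Num.truncn X).+1;
   the index m : 'I_d stands for the exponent m.+1 in {1, ..., d}. *)
Definition J (R : realType) (r d : nat) (X : R) : nat :=
  #|[pred x : {ffun 'I_(r + r) -> 'I_(Num.truncn X).+1} |
      [forall i, (0 < x i)%N] &&
      [forall m : 'I_d,
        (\sum_(i < r) x (lshift r i) ^ m.+1 ==
         \sum_(i < r) x (rshift r i) ^ m.+1)%N]]|.

(* `^ is real exponentiation: 2r - d(d+1)/2 may be negative. *)
Definition vinogradov_mean_value_bound (R : realType) : Prop :=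
  forall (r d : nat) (eps : R), (1 <= r)%N -> (1 <= d)%N -> 0 < eps ->
  exists C : R, 0 < C /\
    forall X : R, 1 <= X ->
      (J r d X)%:R <=
        C * X `^ eps *
        (X `^ r%:R + X `^ (2 * r%:R - (triangular d)%:R)).

(* Multiplicative characters modulo q, extended by zero to all integers. *)
Record mult_character (R : realType) (q : nat) := MultCharacter {
  character_fun :> int -> R[i];
  character_periodic : forall n : int,
    character_fun (n + q%:Z) = character_fun n;
  character_one : character_fun 1 = 1;
  character_mul : forall m n : int,
    character_fun (m * n) = character_fun m * character_fun n;
  character_eq0 : forall n : int,
    (character_fun n == 0) = ~~ coprimez n q
}.

Definition nonprincipal (R : realType) (q : nat) (chi : mult_character R q) :
    Prop :=
  ~ (forall n : int, chi n = (coprimez n q)%:R).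

(* The range of summation is a finite set, so the finitely supported sum is
   the ordinary one. *)
Definition mixed_character_sum (R : realType) (q : nat)
    (chi : mult_character R q) (f : {poly R}) (N H : R) : R[i] :=
  \sum_(n \in [set n : int | N < n%:~R <= N + H]%classic)
    e f.[n%:~R] * chi n.

(* Main.v *)
(** Burgess's method. Given p in [P, 2P), each n satisfies N + n = p m - a q for
    exactly one 0 <= a < p and some m, and then chi(N + n) = chi(p) chi(m). The
    sum thus splits into sums over short intervals of m, of length about H / P,
    whose phases are again polynomials of degree at most d. Hoelder's
    inequality and a count of the coincidences between the short intervals
    reduce the problem to a 2r-th moment over F_q of the sums
    \sum_h e(g(h)) chi(x + h), maximised over g.

    The maximum over g is handled by completion: every subsum is at most a
    logarithm times the largest one whose phase is \sum_j b_j h^(j+1) / (r L^(j+1))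
    with integers b_j. Summing the 2r-th powers over the whole grid of b's keeps
    exactly the solutions of the Vinogradov system, since power sums of
    solutions differ by less than r L^(j+1). The remaining sums over x of
    products of 2r characters are at most 2r sqrt q by Weil, unless every h_i
    is repeated, which happens for O(L^r) tuples only.

    Weil's bound is proved by Stepanov's method. Over F_(q^(2t)) an auxiliary
    polynomial vanishing to order q^t bounds the number of points in each
    fibre of the norm of \prod_i (c_i - th), whence the power sums of the
    inverse roots of the L-function at even exponents 2t are O(q^t), which
    forces every inverse root to have modulus at most sqrt q. *)
Require Import Defs.
From HB Require Import structures.
From mathcomp Require Import all_boot all_order all_algebra all_field.
From mathcomp Require Import complex.
From mathcomp Require Import all_classical all_reals all_analysis.
From mathcomp Require Import zify ring lra.

Set Implicit Arguments.
Unset Strict Implicit.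
Unset Printing Implicit Defensive.

Import Order.TTheory GRing.Theory Num.Theory.

Local Open Scope ring_scope.
Local Open Scope complex_scope.

(** * Stepanov's method *)

(** The intervals of m and the phases on them vary with p and a, so Hoelder's inequality can only be
    applied after both have been replaced by a maximum that depends on a point of F_q alone.
    Averaged over the grid, the moment is of size q L^r + q^(1/2) (L^r + L^(2r-D)) up to q^eps, with
    D = d(d+1)/2. The terms balance at L^(r-D) = q^(1/2), which dictates intervals of length about
    q^(1/(2(r-D))). The upper limit on H then amounts to H^2 < q L: the roughly P^2 L = H^2 / L base
    points do not outnumber F_q by more than a constant, so coincidences stay few. Stepanov's
    polynomial needs a field whose order is a square, hence the even exponents. Its bound on fibres
    is one-sided, and becomes two-sided because the fibres partition the field. *)

Lemma nderivnM (A : comNzRingType) n (p q : {poly A}) :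
  (p * q)^`N(n) = \sum_(i < n.+1) p^`N(i) * q^`N(n - i).
Proof.
elim/poly_ind: p n => [|p c IHp] n.
  rewrite mul0r linear0 big1 // => i _; by rewrite linear0 mul0r.
have -> : (p * 'X + c%:P) * q = (p * q) * 'X + c *: q.
  by rewrite mulrDl mul_polyC mulrAC.
case: n => [|n].
  by rewrite big_ord_recl big_ord0 !nderivn0 addr0 mulrDl mul_polyC mulrAC.
rewrite nderivnD nderivnZ -[_ * 'X]addr0 nderivnMXaddC !IHp.
rewrite [in RHS]big_ord_recl [\sum_(i < n.+2) _]big_ord_recl !nderivn0 !subn0.
have -> : \sum_(i < n.+1) (p * 'X + c%:P)^`N(lift ord0 i) * q^`N(n.+1 - lift ord0 i) =
    \sum_(i < n.+1) p^`N(i) * q^`N(n - i) +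
    (\sum_(i < n.+1) p^`N(i.+1) * q^`N(n - i)) * 'X.
  rewrite mulr_suml -big_split /=; apply: eq_bigr => i _.
  by rewrite /bump leq0n add1n nderivnMXaddC subSS mulrDl; congr (_ + _); rewrite mulrAC.
have -> : \sum_(i < n.+1) p^`N(lift ord0 i) * q^`N(n.+1 - lift ord0 i) =
    \sum_(i < n.+1) p^`N(i.+1) * q^`N(n - i).
  apply: eq_bigr => i _. by rewrite lift0 subSS.
by rewrite -mul_polyC; ring.
Qed.

Lemma size_nderivn_leq (A : nzRingType) n (p : {poly A}) :
  (size p^`N(n) <= size p - n)%N.
Proof. exact: size_poly. Qed.

(** By the Leibniz rule each order of differentiation removes at most one factor F. Dividing by the
    remaining power of F keeps degrees small in Stepanov's method. *)
Lemma dvdp_nderivn_expM (K : fieldType) (F k : {poly K}) N n :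
  F ^+ (N - n) %| (F ^+ N * k)^`N(n).
Proof.
elim: N n k => [|N IH] n k; first by rewrite sub0n dvd1p.
rewrite exprS -mulrA nderivnM.
elim/big_rec: _ => [|[i /= lti] q _ dvq]; first exact: dvdp0.
rewrite dvdp_add // => {dvq}.
case: i lti => [|i] lti.
  rewrite nderivn0 subn0.
  have [le|lt] := leqP n N; first by rewrite subSn // exprS dvdp_mul.
  by rewrite (eqP (_ : N.+1 - n == 0)%N) ?dvd1p // subn_eq0.
apply/dvdp_mull/(dvdp_trans _ (IH _ _))/dvdp_exp2l; lia.
Qed.

Lemma poly_taylor (A : comNzRingType) (p : {poly A}) (x : A) :
  p = \sum_(i < size p) p^`N(i).[x] *: ('X - x%:P) ^+ i.
Proof.
rewrite -{1}(comp_polyXr p) /comp_poly.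
have {1}-> : 'X = x%:P + ('X - x%:P) :> {poly A} by rewrite addrC subrK.
rewrite nderiv_taylor; last exact: mulrC.
rewrite size_map_polyC; apply: eq_bigr => i _.
by rewrite nderivn_map horner_map /= mul_polyC.
Qed.

(** Hasse derivatives detect multiplicity in every characteristic; iterated ordinary derivatives
    carry a factor n! that vanishes from n = p on, while the orders needed below go up to a power of
    p. *)
Lemma dvdp_expXsubC_nderivn (K : fieldType) (p : {poly K}) x M :
  (forall n, (n < M)%N -> p^`N(n).[x] = 0) -> ('X - x%:P) ^+ M %| p.
Proof.
move=> H; rewrite (poly_taylor p x).
elim/big_rec: _ => [|i q _ dvq]; first exact: dvdp0.
rewrite dvdp_add // -mul_polyC.
case: (ltnP i M) => [/H->|le]; first by rewrite mul0r dvdp0.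
by rewrite dvdp_mull // dvdp_exp2l.
Qed.

Lemma dvdp_prod_XsubC_mup (K : fieldType) (s : seq K) (p : {poly K}) :
  p != 0 ->
  (forall x, (count_mem x s <= mup x p)%N) <-> \prod_(x <- s) ('X - x%:P) %| p.
Proof.
move=> p0; split; last first.
  case/dvdpP=> r rE x; move: (p0); rewrite rE mulf_eq0 => /norP[r0 s0].
  by rewrite mupM // mu_prod_XsubC leq_addl.
elim: s p p0 => [|y s IH] p p0 H; first by rewrite big_nil dvd1p.
have: 'X - y%:P %| p by rewrite XsubC_dvd // (leq_trans _ (H y)) //= eqxx.
case/dvdpP => r rE; move: (p0); rewrite rE mulf_eq0 => /norP[r0 s0].
rewrite big_cons mulrC dvdp_mul2r //; apply: IH => // x.
have := H x; rewrite rE mupM //= -['X - y%:P]expr1 mup_XsubCX.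
by rewrite addnC; case: eqP => _; rewrite ?leq_add2r ?addn0.
Qed.

Lemma size_mup_leq (K : fieldType) (s : seq K) (p : {poly K}) M :
  p != 0 -> uniq s -> (forall x, x \in s -> M <= mup x p)%N ->
  (M * size s < size p)%N.
Proof.
move=> p0 us H.
pose t := flatten [seq nseq M x | x <- s].
have st : size t = (M * size s)%N.
  rewrite /t; elim: (s) => [|x s' IH] /=; first by rewrite muln0.
  by rewrite size_cat size_nseq IH mulnS.
have : \prod_(x <- t) ('X - x%:P) %| p.
  apply/dvdp_prod_XsubC_mup => // x.
  have -> : count_mem x t = (count_mem x s * M)%N.
    rewrite /t; elim: (s) => //= y s' IH.
    by rewrite count_cat IH count_nseq mulnDl.
  rewrite count_uniq_mem //; case: (boolP (x \in s)) => [/H|//].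
  by rewrite mul1n.
by move/dvdp_leq => /(_ p0); rewrite size_prod_XsubC st.
Qed.

Lemma linear_system (K : fieldType) (I J : finType) (t : I -> J -> K) :
  (#|J| < #|I|)%N ->
  exists u : I -> K, (exists i, u i != 0) /\ forall j, \sum_i u i * t i j = 0.
Proof.
move=> lt; pose A := \matrix_(i < #|I|, j < #|J|) t (enum_val i) (enum_val j).
have /rowV0Pn[v vker v0] : kermx A != 0.
  rewrite kermx_eq0 /row_free; apply/eqP => E.
  by have := rank_leq_col A; rewrite E leqNgt lt.
exists (fun i => v 0 (enum_rank i)); split.
  have [i vi] : exists i, v 0 i != 0.
    apply/existsP; apply: contraNT v0 => /existsPn H; apply/eqP/rowP => i.
    by rewrite mxE; apply/eqP; rewrite -[_ == _]negbK.
  by exists (enum_val i); rewrite enum_valK.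
move=> j; have /matrixP/(_ 0 (enum_rank j)) := sub_kermxP vker.
rewrite !mxE => E; rewrite -[RHS]E.
rewrite (reindex_onto (@enum_rank I) enum_val) => [|i _]; last exact: enum_valK.
apply: eq_big => [i|i _]; first by rewrite enum_rankK eqxx.
by rewrite !mxE !enum_rankK.
Qed.

(** From i C(lQ, i) = lQ C(lQ - 1, i - 1), a binomial prime to p would force Q to divide i. So for 0
    < i < Q all of them vanish in K, and X^(lQ) behaves as a constant under Hasse derivatives of
    order below Q. *)
Lemma nderivn_mulXn_ppow (K : fieldType) (p e Q l n : nat) (f : {poly K}) :
  p \in [pchar K] -> Q = (p ^ e)%N -> (n < Q)%N ->
  ('X^(l * Q) * f)^`N(n) = 'X^(l * Q) * f^`N(n).
Proof.
move=> pK QE nQ; rewrite nderivnM big_ord_recl nderivn0 subn0 big1 ?addr0 // => i _.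
rewrite nderivnXn /= /bump leq0n add1n.
have pp := pcharf_prime pK.
suff /dvdnP[c ->] : (p %| 'C(l * Q, i.+1))%N.
  have pKX : p \in [pchar {poly K}] by rewrite pchar_poly.
  by rewrite -mulr_natr natrM (pcharf0 pKX) mulr0 mulr0 mul0r.
apply/negPn/negP => ndv.
have : (Q %| i.+1 * 'C(l * Q, i.+1))%N by rewrite -mul_bin_diag -mulnA dvdn_mull ?dvdn_mulr.
rewrite Gauss_dvdl; last first.
  have Q1 : (1 < Q)%N by have := ltn_ord i; lia.
  have e0 : (0 < e)%N by move: Q1; rewrite QE; case: (e).
  by move: ndv; rewrite QE coprime_pexpl ?prime_coprime.
by move/dvdn_leq => /(_ isT); have := ltn_ord i; lia.
Qed.

Section Stepanov.
Variables (K : fieldType) (p e P Q m kap u : nat) (F1 : {poly K}) (a : K).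
Hypotheses (pK : p \in [pchar K]) (QE : Q = (p ^ e)%N) (QP : Q = (P * P)%N).
Hypotheses (Qm : Q = (m * kap).+1) (Pm : P = (m * u).+1).
Hypothesis F1_0 : F1`_0 != 0.
Let D := size F1.
Hypothesis PD : (D + 5 <= P)%N.
Let F := 'X * F1.

Let F1n0 : F1 != 0. Proof. by apply: contraNneq F1_0 => ->; rewrite coef0. Qed.
Let Fn0 : F != 0. Proof. by rewrite mulf_neq0 // polyX_eq0. Qed.
Let sF : size F = D.+1. Proof. by rewrite /F mulrC size_mulX. Qed.

(* The i-th term vanishes at 0 to order P + (i.1.1 * kap + i.2) + i.1.2 * Q, and
   i.1.1 * kap + i.2 < m * kap < Q: these orders are pairwise distinct. *)
Lemma stepanov_indep (L : nat) (v : 'I_m * 'I_L * 'I_kap -> K) :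
  (exists i, v i != 0) ->
  \sum_i v i *: (F ^+ (P + i.1.1 * kap) * ('X^(i.2) * 'X^(i.1.2 * Q))) != 0.
Proof.
move=> [i0 vi0].
pose w (i : 'I_m * 'I_L * 'I_kap) := (i.1.1 * kap + i.2 + i.1.2 * Q)%N.
have w_inj : injective w.
  move=> [[j l] c] [[j' l'] c']; rewrite /w /= => E.
  have lt (j1 : 'I_m) (c1 : 'I_kap) : (j1 * kap + c1 < Q)%N.
    have := ltn_ord j1; have := ltn_ord c1; rewrite Qm; nia.
  have E1 : l = l' :> nat.
    have dv (j1 : 'I_m) (c1 : 'I_kap) l1 : ((j1 * kap + c1 + l1 * Q) %/ Q = l1)%N.
      by rewrite addnC divnMDl ?(divn_small (lt _ _)) ?addn0 // Qm.
    by rewrite -(dv j c l) E dv.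
  have E2 : (j * kap + c = j' * kap + c')%N by move: E; rewrite E1; lia.
  have kap0 : (0 < kap)%N by apply: leq_trans (ltn_ord c).
  have E3 : j = j' :> nat.
    by have := congr1 (divn^~ kap) E2; rewrite !divnMDl // !divn_small ?addn0.
  have E4 : c = c' :> nat by move: E2; rewrite E3; lia.
  by congr (_, _, _); apply: val_inj.
case: (@arg_minnP _ i0 (fun i => v i != 0) w vi0) => i1 vi1 minw.
pose G := \sum_i v i *: ('X^(w i) * F1 ^+ (i.1.1 * kap)).
have -> : \sum_i v i *: (F ^+ (P + i.1.1 * kap) * ('X^(i.2) * 'X^(i.1.2 * Q))) =
    F ^+ P * G.
  rewrite mulr_sumr; apply: eq_bigr => i _; rewrite -scalerAr; congr (_ *: _).
  by rewrite exprD -!mulrA; congr (_ * _); rewrite exprMn /w !exprD; ring.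
rewrite mulf_neq0 ?expf_neq0 //.
suff : G`_(w i1) != 0 by apply: contraNneq => ->; rewrite coef0.
rewrite coef_sum (bigD1 i1) //= big1 ?addr0 => [|i ne].
  by rewrite coefZ coefXnM ltnn subnn mulf_neq0 // -horner_coef0 horner_exp expf_neq0 // horner_coef0.
rewrite coefZ coefXnM.
have [->|vi] := eqVneq (v i) 0; first by rewrite mul0r.
rewrite ltn_neqAle minw // andbT.
by rewrite (inj_eq w_inj) eq_sym ne mulr0.
Qed.

(** At points of [s], the relations x^Q = x and F(x)^kap = a turn the n-th Hasse derivative of the
    auxiliary polynomial into F^(P - n) times a polynomial of size at most B, which is what makes
    the method efficient. Requiring these polynomials to vanish for all n < P is P B linear
    conditions on m L kap coefficients; comparing P times the size of [s] with the degree then gives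
    the bound. *)
Lemma stepanov (s : seq K) :
  uniq s -> (forall x, x \in s -> x ^+ Q = x /\ F.[x] ^+ kap = a) ->
  (size s <= kap + (3 * D + 4) * P)%N.
Proof.
move=> us Hs.
(* Since kap = u (P + 1), the P B conditions number about (u + D) Q and the unknowns about L Q.
   Taking L = u + D + 3 leaves 3 Q for the lower-order terms, which [PD] makes sufficient. *)
pose L := (u + D + 3)%N; pose B := (kap + P * D + L)%N.
pose I := ('I_m * 'I_L * 'I_kap)%type; pose J := ('I_P * 'I_B)%type.
pose N (i : I) := (P + i.1.1 * kap)%N.
pose W n (i : I) := (F ^+ N i * 'X^(i.2))^`N(n) %/ F ^+ (N i - n).
have WE n i : (F ^+ N i * 'X^(i.2))^`N(n) = W n i * F ^+ (N i - n).
  by rewrite divpK // dvdp_nderivn_expM.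
pose Rn n (i : I) := a ^+ i.1.1 *: (W n i * 'X^(i.1.2)).
have sW n (i : I) : (n < P)%N -> (size (W n i) <= kap + P * D)%N.
  move=> nP; rewrite size_divp ?expf_neq0 // size_exp sF /=.
  have := size_nderivn_leq n (F ^+ N i * 'X^(i.2)).
  rewrite size_mulXn ?expf_neq0 // -[size (polyseq (F ^+ _))]prednK ?size_exp ?sF /=; last first.
    by rewrite lt0n size_poly_eq0 expf_neq0.
  have Nn : (n <= N i)%N by rewrite /N; lia.
  have := ltn_ord i.2; move: (i.2 : nat) => c ltc; rewrite mulnBr.
  have : (n * D <= P * D)%N by rewrite leq_mul // ltnW.
  rewrite [(D * n)%N]mulnC [(D * N i)%N]mulnC.
  have := leq_mul Nn (leqnn D).
  move: (size _) (N i * D)%N (n * D)%N (P * D)%N => a1 a2 a3 a4; clear - ltc; lia.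
have sR n (i : I) : (n < P)%N -> (size (Rn n i) <= B)%N.
  move=> nP; apply: leq_trans (size_scale_leq _ _) _.
  have [->|W0] := eqVneq (W n i) 0; first by rewrite mul0r size_poly0.
  rewrite size_mulXn // /B addnC leq_add ?sW //.
  exact/ltnW/ltn_ord.
have kapE : kap = (u * P.+1)%N.
  have m0 : (0 < m)%N by rewrite lt0n; apply: contraL PD => /eqP E; rewrite Pm E; lia.
  apply/eqP; rewrite -(eqn_pmul2l m0) mulnA -eqSS -Qm QP {1 2}Pm; apply/eqP.
  by rewrite Pm; ring.
have uP : (u.+1 <= P)%N.
  have m0 : (0 < m)%N by rewrite lt0n; apply: contraL PD => /eqP E; rewrite Pm E; lia.
  by rewrite Pm ltnS leq_pmull.
have uPP : (P * u + P <= P * P)%N by rewrite -mulnSr leq_mul2l uP orbT.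
have DPP : (P * D + 5 * P <= P * P)%N by rewrite [(5 * _)%N]mulnC -mulnDr leq_mul2l PD orbT.
have IJ : (#|{: J}| < #|{: I}|)%N.
  rewrite !card_prod !card_ord /B /L; clear - Qm QP PD kapE uP uPP DPP.
  rewrite -(ltn_add2r (u + D + 3)).
  have -> : (m * (u + D + 3) * kap + (u + D + 3) = P * P * (u + D + 3))%N.
    by rewrite -QP Qm; ring.
  by rewrite kapE; lia.
have [v [v0 vR]] := linear_system (fun (i : I) (j : J) => (Rn j.1 i)`_j.2) IJ.
pose h := \sum_i v i *: (F ^+ (P + i.1.1 * kap) * ('X^(i.2) * 'X^(i.1.2 * Q))).
have h0 : h != 0 by apply: stepanov_indep.
have P0 : (0 < P)%N by rewrite Pm.
have RE n : (n < P)%N -> \sum_i v i *: Rn n i = 0.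
  move=> nP; apply/polyP => b; rewrite coef0 coef_sum.
  have [bB|Bb] := ltnP b B.
    have := vR (Ordinal nP, Ordinal bB); rewrite /= => E; rewrite -[RHS]E.
    by apply: eq_bigr => i _; rewrite coefZ.
  apply: big1 => i _; rewrite coefZ nth_default ?mulr0 //.
  exact: leq_trans (sR _ _ nP) Bb.
have hD n x : (n < P)%N -> x \in s -> h^`N(n).[x] = 0.
  move=> nP /Hs [xQ]; rewrite {1}/F hornerM hornerX => Fx; rewrite linear_sum horner_sum /=.
  transitivity (F.[x] ^+ (P - n) * (\sum_i v i *: Rn n i).[x]); last first.
    by rewrite RE // horner0 mulr0.
  rewrite horner_sum mulr_sumr; apply: eq_bigr => i _.
  rewrite linearZ /= mulrA [_ * 'X^(_ * Q)]mulrC (nderivn_mulXn_ppow _ _ pK QE); last first.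
    by rewrite QP; nia.
  rewrite WE !hornerE.
  (* The offset P in [N] leaves a factor F^(P - n) outside the powers of F^kap for every n < P, so
     F^kap = a can be substituted. *)
  have -> : (N i - n = i.1.1 * kap + (P - n))%N by rewrite /N; lia.
  have -> : x ^+ (i.1.2 * Q) = x ^+ i.1.2 by rewrite mulnC exprM xQ.
  rewrite exprD [(_ * kap)%N]mulnC !exprM Fx /=; ring.
have := size_mup_leq (M := P) h0 us.
have /[swap]/[apply] : forall x, x \in s -> (P <= mup x h)%N.
  move=> x xs; rewrite mup_geq //; apply: dvdp_expXsubC_nderivn => n nP; exact: hD.
have sh : (size h <= (P + m * kap) * D + kap + L * Q - Q)%N.
  apply: (leq_trans (size_sum _ _ _)); apply/bigmax_leqP => i _.
  apply: leq_trans (size_scale_leq _ _) _.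
  rewrite mulrA size_mulXn ?mulf_neq0 ?expf_neq0 ?polyX_eq0 // size_mulXn ?expf_neq0 //.
  rewrite -[size (polyseq (F ^+ _))]prednK ?size_exp ?sF /=; last first.
    by rewrite lt0n size_poly_eq0 expf_neq0.
  have := ltn_ord i.2; have := ltn_ord i.1.2; have := ltn_ord i.1.1.
  move: (i.1.1 : nat) (i.1.2 : nat) (i.2 : nat) => j l c jm lL ck.
  have : (j * kap * D <= m * kap * D)%N by rewrite !leq_mul2r (ltnW jm) !orbT.
  have : (l * Q + Q <= L * Q)%N by rewrite addnC -mulSn leq_mul2r lL orbT.
  clear - ck; lia.
move=> H; have := leq_trans H sh; rewrite -[(size s <= _)%N](leq_pmul2l P0) /L.
move: (size s) => S; clear - Qm QP PD kapE P0 uP uPP DPP.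
have -> : (m * kap = Q - 1)%N by lia.
have : ((P + (Q - 1)) * D <= (P + P * P) * D)%N by rewrite leq_mul2r QP; lia.
rewrite kapE QP; have := leq_mul (leqnn P) P0; lia.
Qed.
End Stepanov.

(** * Newton's identities and power sums *)

(** Logarithmic differentiation: -X a' / a is the generating series of the power sums. Cutting it at
    degree n and multiplying by a leaves an error divisible by X^(n+1), so polynomials suffice. *)
Lemma newton_prod_1subZX (A : comNzRingType) (s : seq A) n :
  exists r : {poly A}, let a := \prod_(w <- s) (1 - w *: 'X) in
  'X * a^`() + (\sum_(w <- s) \sum_(1 <= i < n.+1) w ^+ i *: 'X^i) * a = 'X^(n.+1) * r.
Proof.
elim: s => [|w s [r IH]] /=.
  by exists 0; rewrite !big_nil -polyC1 derivC !mulr0 mul0r addr0.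
set a := \prod_(w <- s) _ in IH; set E := \sum_(w <- s) _ in IH.
exists (r * (1 - w *: 'X) - w ^+ n.+1 *: a).
rewrite !big_cons -/a -/E derivM derivB derivZ derivX -polyC1 derivC sub0r.
set Ew := \sum_(1 <= i < n.+1) _.
have EwE : Ew * (1 - w *: 'X) = w *: 'X - w ^+ n.+1 *: 'X^(n.+1).
  rewrite /Ew; elim: (n) => [|k IHk].
    by rewrite big_geq // mul0r !expr1 subrr.
  rewrite big_nat_recr //= mulrDl IHk mulrBr mulr1 -scalerAl -scalerAr -exprSr.
  by rewrite scalerA -exprSr addrA subrK.
have -> : 'X * (- (w *: 1%:P) * a + (1%:P - w *: 'X) * a^`()) =
   (1 - w *: 'X) * ('X * a^`()) - w *: 'X * a.
  rewrite -!mul_polyC; ring.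
have -> : (Ew + E) * ((1 - w *: 'X) * a) = Ew * (1 - w *: 'X) * a + (1 - w *: 'X) * (E * a) by ring.
rewrite EwE; move: IH => /(canRL (addrK _)) ->.
by rewrite -!mul_polyC; ring.
Qed.

Lemma newton_identity (A : comNzRingType) (s : seq A) n :
  let a := \prod_(w <- s) (1 - w *: 'X) in
  a`_n *+ n = - \sum_(1 <= i < n.+1) (\sum_(w <- s) w ^+ i) * a`_(n - i).
Proof.
move=> a; have [r /= /(congr1 (fun p : {poly A} => p`_n))] := newton_prod_1subZX s n.
rewrite -/a coefD coefXnM ltnSn coefXM coef_deriv => /eqP.
rewrite addr_eq0 => /eqP E.
have -> : a`_n *+ n = (if n == 0%N then 0 else a`_n.-1.+1 *+ n.-1.+1).
  by case: (n).
rewrite E exchange_big mulr_suml coef_sum; congr (- _).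
apply: eq_big_nat => i /andP[i1 iln].
by rewrite -scaler_suml -scalerAl coefZ coefXnM ltnNge -ltnS iln.
Qed.

Lemma factor_1subZX (C : closedFieldType) (p : {poly C}) :
  p`_0 = 1 -> exists s, size s = (size p).-1 /\ p = \prod_(w <- s) (1 - w *: 'X).
Proof.
move=> p0; have [r rE] := closed_field_poly_normal p.
have pn0 : p != 0 by apply: contra_eq_neq p0 => ->; rewrite coef0 eq_sym oner_eq0.
have lp : lead_coef p != 0 by rewrite lead_coef_eq0.
have r0 : 0 \notin r.
  apply/negP => r0; move: p0; rewrite -horner_coef0 rE hornerZ horner_prod.
  by rewrite (big_rem _ r0) /= hornerXsubC subrr mul0r mulr0 => /esym/eqP; rewrite oner_eq0.
exists [seq x^-1 | x <- r]; split.
  by rewrite size_map rE size_scale // size_prod_XsubC.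
rewrite big_map.
have E : forall s, 0 \notin s ->
    \prod_(z <- s) ('X - z%:P) = (\prod_(z <- s) - z) *: \prod_(z <- s) (1 - z^-1 *: 'X : {poly C}).
  elim=> [|z s IH]; first by rewrite !big_nil scale1r.
  rewrite inE negb_or eq_sym => /andP[z0 s0]; rewrite !big_cons IH //.
  have {1}-> : 'X - z%:P = - z *: (1 - z^-1 *: 'X).
    by rewrite scalerBr scalerA mulNr mulfV // scaleN1r -alg_polyC scaleNr opprK addrC.
  by rewrite -scalerAl -scalerAr scalerA.
rewrite [in LHS]rE (E _ r0) scalerA; set c := _ * _.
suff -> : c = 1 by rewrite scale1r.
move: p0; rewrite -horner_coef0 rE hornerZ (E _ r0) hornerZ mulrA -/c horner_prod big1 ?mulr1 //.
by move=> z _; rewrite !hornerE /= ?mulr0 subr0.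
Qed.

Section PowerSums.
Variable C : numFieldType.
Hypothesis archi : forall x : C, 0 <= x -> exists n : nat, x < n%:R.

Lemma pow_unbounded (x y : C) t0 : 1 < x -> exists2 t, (t0 <= t)%N & ~ (x ^+ t <= y).
Proof.
move=> x1.
have bern t : 1 + (x - 1) *+ t <= x ^+ t.
  elim: t => [|t IH]; first by rewrite mulr0n addr0 expr0.
  rewrite exprS; apply: le_trans (_ : x * (1 + (x - 1) *+ t) <= _); last first.
    by rewrite ler_pM2l // (lt_trans ltr01).
  rewrite -subr_ge0.
  have -> : x * (1 + (x - 1) *+ t) - (1 + (x - 1) *+ t.+1) = (x - 1) ^+ 2 *+ t.
    by rewrite expr2 -mulrnAr mulrS; move: (_ *+ t) => v; ring.
  by rewrite mulrn_wge0 // exprn_ge0 // subr_ge0 ltW.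
have x10 : 0 < x - 1 by rewrite subr_gt0.
have [y0|y0] := boolP (0 <= y); last first.
  exists t0 => // xy; move/negP: y0; apply; apply: le_trans xy.
  by rewrite exprn_ge0 // (le_trans ler01) // ltW.
have [n nE] := archi (divr_ge0 y0 (ltW x10)).
exists (n + t0)%N; first exact: leq_addl.
move=> /(le_trans (bern _)) H.
have : y < y; last by rewrite ltxx.
apply: lt_le_trans H; rewrite ltr_pdivrMr // in nE; apply: lt_le_trans nE _.
rewrite mulrnDr mulr_natl addrCA lerDl addr_ge0 // mulrn_wge0 // ltW //.
Qed.

(* Combining shifts of the power sums with the coefficients of
   \prod_(w != z) ('X - w) leaves a nonzero multiple of z ^+ t. *)
Lemma power_sums_bound (s : seq C) (rho B : C) t0 :
  0 < rho -> (forall t, (t0 <= t)%N -> `|\sum_(z <- s) z ^+ t| <= B * rho ^+ t) ->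
  forall z, z \in s -> `|z| <= rho.
Proof.
move=> rho0 H z zs.
have [//|lt] := real_leP (normr_real z) (gtr0_real rho0).
pose Q := \prod_(y <- undup s | y != z) ('X - y%:P).
have Qz : Q.[z] != 0.
  rewrite horner_prod prodf_seq_neq0; apply/allP => y _; apply/implyP => yz.
  by rewrite hornerXsubC subr_eq0 eq_sym.
have Q0 y : y \in s -> y != z -> Q.[y] = 0.
  move=> ys yz; rewrite horner_prod -big_filter (big_rem y) /=; last first.
    by rewrite mem_filter yz mem_undup.
  by rewrite hornerXsubC subrr mul0r.
have E t : \sum_(i < size Q) Q`_i * \sum_(y <- s) y ^+ (t + i) =
    (count_mem z s)%:R * (z ^+ t * Q.[z]).
  under eq_bigr do rewrite mulr_sumr.
  rewrite exchange_big /=.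
  under eq_bigr => y _.
    under eq_bigr do rewrite exprD mulrCA.
    rewrite -mulr_sumr -horner_coef; over.
  rewrite (bigID (pred1 z)) /= [X in _ + X]big1_seq => [|y /andP[yz ys]]; last first.
    by rewrite Q0 // mulr0.
  rewrite addr0 (eq_bigr (fun=> z ^+ t * Q.[z])) => [|y /eqP-> //].
  by rewrite big_const_seq iter_addr_0 mulr_natl.
pose B' := \sum_(i < size Q) `|Q`_i| * (B * rho ^+ i).
have zr1 : 1 < `|z| / rho by rewrite ltr_pdivlMr // mul1r.
have [t t0t] := pow_unbounded (B' / `|Q.[z]|) t0 zr1.
case; rewrite expr_div_n ler_pdivrMr ?exprn_gt0 // mulrAC ler_pdivlMr ?normr_gt0 //.
rewrite -normrX -normrM.
have c1 : 1 <= (count_mem z s)%:R :> C by rewrite ler1n -has_count has_pred1.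
apply: le_trans (_ : (count_mem z s)%:R * `|z ^+ t * Q.[z]| <= _).
  by rewrite ler_peMl.
rewrite -[X in X * _]normr_nat -normrM -E /B' mulr_suml.
apply: le_trans (ler_norm_sum _ _ _) _; apply: ler_sum => i _.
rewrite normrM -mulrA ler_wpM2l // -mulrA -exprD [(i + t)%N]addnC.
by apply: H; rewrite (leq_trans t0t) ?leq_addr.
Qed.
End PowerSums.

(** * Frobenius orbits over a finite field *)

Section Closure.
Variables (F : finFieldType) (Om : closedFieldType) (io : {rmorphism F -> Om}).
Local Notation q := #|F|.
Hypothesis qF : q \in [pchar F].

Let q_prime : prime q. Proof. exact: pcharf_prime qF. Qed.
Let q_gt1 : (1 < q)%N. Proof. exact: prime_gt1. Qed.
Let qOm : q \in [pchar Om]. Proof. by rewrite (fmorph_pchar io). Qed.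

Lemma closure_fixedP (x : Om) : x ^+ q = x -> exists a, x = io a.
Proof.
move=> xq; have := congr1 (map_poly io) (finField_genPoly F).
rewrite rmorphB /= map_polyXn map_polyX rmorph_prod /= => /(congr1 (horner^~ x)).
rewrite !hornerE xq subrr horner_prod => /esym/eqP/prodf_eq0[a _].
rewrite rmorphB /= map_polyX map_polyC hornerXsubC subr_eq0 => /eqP ->.
by exists a.
Qed.

Lemma closure_fixed (a : F) i : io a ^+ (q ^ i) = io a.
Proof.
elim: i => [|i IH]; first by rewrite expn0 expr1.
by rewrite expnS mulnC exprM IH -rmorphXn /= expf_card.
Qed.

Lemma frobenius_inj i : injective (fun x : Om => x ^+ (q ^ i)).
Proof.
elim: i => [|i IH] x y; first by rewrite expn0 !expr1.
rewrite expnS !exprM => /IH.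
rewrite -[x ^+ _](pFrobenius_autE qOm) -[y ^+ _](pFrobenius_autE qOm).
exact: fmorph_inj.
Qed.

(** For i > 0 this is the field with q^i elements inside [Om]; listing it as zeros avoids
    constructing the finite extensions. *)
Definition fixed_points i : seq Om :=
  sval (closed_field_poly_normal ('X^(q ^ i) - 'X : {poly Om})).

Lemma fixed_pointsP i : (0 < i)%N ->
  [/\ uniq (fixed_points i), size (fixed_points i) = (q ^ i)%N &
      forall x, (x \in fixed_points i) = (x ^+ (q ^ i) == x)].
Proof.
rewrite /fixed_points; case: closed_field_poly_normal => s /= sE i0.
have qi : (1 < q ^ i)%N by rewrite -(exp1n i) ltn_exp2r.
have sz : size ('X^(q ^ i) - 'X : {poly Om}) = (q ^ i).+1.
  by rewrite size_polyDl ?size_polyXn // size_polyN size_polyX.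
have lc : lead_coef ('X^(q ^ i) - 'X : {poly Om}) = 1.
  by rewrite lead_coefDl ?lead_coefXn // size_polyN size_polyX size_polyXn.
rewrite lc scale1r in sE; split.
- rewrite -separable_prod_XsubC -sE unlock derivB derivXn derivX.
  have pX : q \in [pchar {poly Om}] by rewrite pchar_poly.
  have -> : 'X^((q ^ i).-1) *+ (q ^ i) - 1 = - 1 :> {poly Om}.
    rewrite -mulr_natr -(prednK i0) expnS natrM (pcharf0 pX) mul0r mulr0; exact: sub0r.
  have <- : (-1 : Om) *: 1 = -1 :> {poly Om} by rewrite scaleN1r.
  by rewrite coprimepZr ?coprimep1 // oppr_eq0 oner_eq0.
- by apply/eq_add_S; rewrite -sz sE size_prod_XsubC.
by move=> x; rewrite -root_prod_XsubC -sE rootE !hornerE subr_eq0.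
Qed.

(* For th in the extension of degree i, the characteristic polynomial of th over F. *)
Definition frob_prod i (th : Om) : {poly Om} := \prod_(l < i) ('X - (th ^+ (q ^ l))%:P).

Lemma size_frob_prod i th : size (frob_prod i th) = i.+1.
Proof. by rewrite size_prod_XsubC /index_enum -enumT -cardE card_ord. Qed.

Lemma monic_frob_prod i th : frob_prod i th \is monic.
Proof. exact: monic_prod_XsubC. Qed.

Definition orbit_seq i (th : Om) := [seq th ^+ (q ^ l) | l <- iota 0 i].

Lemma frob_prodE i th : frob_prod i th = \prod_(x <- orbit_seq i th) ('X - x%:P).
Proof. by rewrite big_map /frob_prod -(big_mkord xpredT (fun l => 'X - (th ^+ (q ^ l))%:P)) /index_iota subn0. Qed.

(** The default 0 is harmless: [descendK] only meets coefficients fixed by Frobenius, which do come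
    from F. *)
Definition io_inv (x : Om) : F := odflt 0 [pick a | io a == x].
Definition descend (g : {poly Om}) : {poly F} := \poly_(j < size g) io_inv g`_j.

Lemma descendK (g : {poly Om}) :
  (forall j, g`_j ^+ q = g`_j) -> map_poly io (descend g) = g.
Proof.
move=> H; apply/polyP => j; rewrite coef_map coef_poly.
case: ltnP => jg; last by rewrite /= rmorph0 nth_default.
have [a ->] := closure_fixedP (H j); rewrite /io_inv.
by case: pickP => [b /= /eqP /= -> //|/(_ a)]; rewrite eqxx.
Qed.

(** Frobenius shifts the factors cyclically, the last one returning to the first by the hypothesis
    on th. *)
Lemma frob_prod_fixed i th j : th ^+ (q ^ i) = th ->
  (frob_prod i th)`_j ^+ q = (frob_prod i th)`_j.
Proof.
move=> thi; rewrite -(pFrobenius_autE qOm) -coef_map /=.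
suff -> : map_poly (pFrobenius_aut qOm) (frob_prod i th) = frob_prod i th by [].
rewrite /frob_prod rmorph_prod /=.
under eq_bigr do rewrite rmorphB /= map_polyX map_polyC /= pFrobenius_autE -exprM -expnSr.
case: i thi => [|i] thi; first by rewrite !big_ord0.
by rewrite big_ord_recr /= thi [RHS]big_ord_recl expn0 expr1 mulrC.
Qed.

Lemma frob_prod_descend i th : th ^+ (q ^ i) = th ->
  map_poly io (descend (frob_prod i th)) = frob_prod i th.
Proof. by move=> thi; apply: descendK => j; apply: frob_prod_fixed. Qed.

Section Roots.
Variables (g : {poly F}) (rs : seq Om).
Hypothesis gE : map_poly io g = \prod_(x <- rs) ('X - x%:P).

Lemma count_frob th l : count_mem (th ^+ (q ^ l)) rs = count_mem th rs.
Proof.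
have E : perm_eq [seq x ^+ q | x <- rs] rs.
  apply/prod_XsubC_eq; rewrite big_map -gE.
  have := congr1 (map_poly (pFrobenius_aut qOm)) gE.
  rewrite rmorph_prod /= => H.
  transitivity (map_poly (pFrobenius_aut qOm) (map_poly io g)).
    rewrite H; apply: eq_bigr => x _.
    by rewrite rmorphB /= map_polyX map_polyC /= pFrobenius_autE.
  apply/polyP => j; rewrite !coef_map /= pFrobenius_autE.
  by have := closure_fixed g`_j 1; rewrite expn1.
elim: l => [|l IH]; first by rewrite expn0 expr1.
rewrite -IH expnSr exprM; set y := th ^+ (q ^ l).
rewrite -(permP E) count_map; apply: eq_count => x /=.
apply/eqP/eqP => [|-> //].
by have := @frobenius_inj 1 x y; rewrite expn1.
Qed.

Lemma frob_period th : th \in rs ->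
  exists2 d, (0 < d)%N & th ^+ (q ^ d) = th.
Proof.
move=> thr; pose t := orbit_seq (size rs).+1 th.
have : ~~ uniq t.
  apply/negP => /uniq_leq_size -/(_ rs) H.
  have /H : {subset t <= rs}.
    move=> x /mapP[l _ ->]; rewrite -has_pred1 has_count count_frob -has_count.
    by rewrite has_pred1.
  by rewrite size_map size_iota ltnn.
move/(uniqPn 0) => [i [j [ij]]]; rewrite size_map size_iota => js.
rewrite !(nth_map 0%N) ?size_iota ?(ltn_trans ij) // !nth_iota ?(ltn_trans ij) // !add0n => E.
exists (j - i)%N; first by rewrite subn_gt0.
apply: (@frobenius_inj i); rewrite /= E -exprM -expnD subnK //; exact: ltnW.
Qed.

(** If th has degree d over F, then for d | i the polynomial [frob_prod i th] is the (i / d)-th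
    power of its minimal polynomial, and it divides g exactly when i / d is at most the multiplicity
    of th in g. Hence the number of such i is that multiplicity. *)
Lemma orbit_count th : th \in rs ->
  (\sum_(1 <= i < (size rs).+1) ((th ^+ (q ^ i) == th) && (frob_prod i th %| map_poly io g)%R))%N
  = count_mem th rs.
Proof.
move=> thr; have exd : exists d, (0 < d)%N && (th ^+ (q ^ d) == th).
  by have [d d0 /eqP dth] := frob_period thr; exists d; rewrite d0.
case: (ex_minnP exd) => d /andP[d0 /eqP dth] dmin.
have dmul a : th ^+ (q ^ (a * d)) = th.
  by elim: a => [|a IH]; rewrite ?expn0 ?expr1 // mulSn expnD exprM dth IH.
have per i : (th ^+ (q ^ i) == th) = (d %| i)%N.
  apply/eqP/idP => [|/dvdnP[a ->]]; last exact: dmul.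
  rewrite {1}(divn_eq i d) expnD exprM dmul /dvdn => E.
  rewrite -leqn0 leqNgt; apply/negP => r0.
  have := dmin (i %% d)%N; rewrite r0 E eqxx => /(_ isT).
  by rewrite leqNgt ltn_mod d0.
have uorb : uniq (orbit_seq d th).
  rewrite map_inj_in_uniq ?iota_uniq // => l1 l2; rewrite !mem_iota !add0n /=.
  wlog l12 : l1 l2 / (l1 <= l2)%N.
    by move=> W; case: (leqP l1 l2) => [/W//|/ltnW /W H] h1 h2 /esym/H->.
  move=> _ l2d E; apply/eqP; rewrite eqn_leq l12 /= -subn_eq0 -leqn0 leqNgt.
  apply/negP => l0; have := dmin (l2 - l1)%N; rewrite l0 /= (_ : _ == th).
    by move=> /(_ isT); rewrite leqNgt (leq_ltn_trans _ l2d) // leq_subr.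
  by apply/eqP/(@frobenius_inj l1); rewrite /= -exprM -expnD subnK.
have cnt a x : count_mem x (orbit_seq (a * d) th) = (a * count_mem x (orbit_seq d th))%N.
  elim: a => [|a IH] //; rewrite mulSn addnC /orbit_seq iotaD map_cat count_cat.
  rewrite -/(orbit_seq (a * d) th) IH mulSnr; congr (_ + _)%N.
  rewrite add0n -[X in iota X _]addn0 iotaDl -map_comp; congr count; apply: eq_map => l /=.
  by rewrite expnD exprM dmul.
have gn0 : map_poly io g != 0 by rewrite gE monic_neq0 // monic_prod_XsubC.
have dvdE a : (frob_prod (a * d) th %| map_poly io g) = (a <= count_mem th rs)%N.
  rewrite frob_prodE; apply/idP/idP.
    move/(dvdp_prod_XsubC_mup _ gn0)/(_ th); rewrite gE mu_prod_XsubC cnt.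
    rewrite count_uniq_mem // (_ : th \in _) ?muln1 //.
    by apply/mapP; exists 0%N; rewrite ?mem_iota ?expn0 ?expr1.
  move=> ale; apply/(dvdp_prod_XsubC_mup _ gn0) => x; rewrite gE mu_prod_XsubC cnt.
  rewrite count_uniq_mem //; case: (boolP (x \in _)) => [/mapP[l _ ->]|_]; last by rewrite muln0.
  by rewrite muln1 count_frob.
set e := count_mem th rs in dvdE *.
have ed : (e * d <= size rs)%N.
  have : frob_prod (e * d) th %| map_poly io g by rewrite dvdE.
  by move/dvdp_leq => /(_ gn0); rewrite size_frob_prod gE size_prod_XsubC.
transitivity (\sum_(1 <= i < (e * d).+1) (d %| i))%N; last first.
  by rewrite -divn_count_dvd mulnK.
rewrite (@big_cat_nat _ _ _ (e * d).+1) //= [X in (_ + X)%N]big1_seq => [|i /andP[_]].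
  rewrite addn0; apply: eq_big_nat => i /andP[_]; rewrite ltnS per.
  case: (boolP (d %| i)%N) => //= /dvdnP[a ->]; rewrite dvdE leq_pmul2r // => ->.
  by [].
rewrite mem_index_iota => /andP[+ _]; rewrite per.
case: (boolP (d %| i)%N) => //= /dvdnP[a ->]; rewrite dvdE ltn_pmul2r // ltnNge.
by case: leqP.
Qed.

(** Summing [orbit_count] over the distinct roots gives the polynomial analogue of log n = sum over
    d | n of Lambda(d), with the degree in the role of the logarithm. *)
Lemma frob_prod_count :
  (\sum_(1 <= i < (size rs).+1) \sum_(th <- fixed_points i)
     (frob_prod i th %| map_poly io g)%R)%N = size rs.
Proof.
transitivity (\sum_(1 <= i < (size rs).+1) \sum_(th <- undup rs)
   ((th ^+ (q ^ i) == th) && (frob_prod i th %| map_poly io g)%R))%N.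
  apply: eq_big_nat => i /andP[i0 _]; have [ui _ mi] := fixed_pointsP i0.
  have cntE (s : seq Om) (b : pred Om) : (\sum_(x <- s) b x)%N = count b s.
    by rewrite -sumn_count sumnE big_map.
  rewrite (cntE _ (fun th => frob_prod i th %| map_poly io g)).
  rewrite (cntE _ (fun th => (th ^+ (q ^ i) == th) && (frob_prod i th %| map_poly io g))).
  rewrite -!size_filter; apply/perm_size/uniq_perm.
  - exact: filter_uniq.
  - exact/filter_uniq/undup_uniq.
  move=> th; rewrite !mem_filter mem_undup mi /=.
  case: (boolP (frob_prod i th %| _)) => dv; rewrite ?andbF //= andbT.
  case: eqP => //= _; apply/esym.
  rewrite -root_prod_XsubC -gE root_factor_theorem; apply: dvdp_trans dv.
  case: i i0 {ui mi} => // i _; rewrite /frob_prod big_ord_recl expn0 expr1.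
  exact: dvdp_mulr.
rewrite exchange_big /=.
rewrite -[RHS]sum1_size -[RHS]big_undup_iterop_count /=.
apply: eq_big_seq => th; rewrite mem_undup => /orbit_count ->.
by rewrite Monoid.iteropE iter_addn_0 mul1n.
Qed.
End Roots.
End Closure.

(** * The L-function of a multiplicative function on polynomials *)

Section MonicPoly.
Variable F : fieldType.

Definition monic_poly k (v : 'rV[F]_k) : {poly F} := 'X^k + rVpoly v.

Lemma size_rVpoly k (v : 'rV[F]_k) : (size (rVpoly v) <= k)%N.
Proof. exact: size_poly. Qed.

Lemma size_monic_poly k (v : 'rV[F]_k) : size (monic_poly v) = k.+1.
Proof. by rewrite size_polyDl size_polyXn // ltnS size_rVpoly. Qed.

Lemma monic_monic_poly k (v : 'rV[F]_k) : monic_poly v \is monic.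
Proof. by rewrite monicE lead_coefDl ?lead_coefXn // size_polyXn ltnS size_rVpoly. Qed.

Lemma monic_poly_inj k : injective (@monic_poly k).
Proof. by move=> v w /addrI /(can_inj rVpolyK). Qed.

Lemma monic_polyP (p : {poly F}) k : p \is monic -> size p = k.+1 ->
  exists v : 'rV_k, p = monic_poly v.
Proof.
move=> pm sp; exists (poly_rV (p - 'X^k)).
rewrite /monic_poly poly_rV_K; first by rewrite addrC subrK.
apply/leq_sizeP => j; rewrite leq_eqVlt coefB coefXn => /orP[/eqP <-|kj].
  by rewrite eqxx; move: pm; rewrite monicE lead_coefE sp => /eqP ->; rewrite subrr.
by rewrite nth_default ?sp // gtn_eqF // subr0.
Qed.
End MonicPoly.

Section LFunction.
Variables (F : finFieldType) (Om : closedFieldType) (io : {rmorphism F -> Om}).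
Local Notation q := #|F|.
Hypothesis qF : q \in [pchar F].
Variables (C : comNzRingType) (Lam : {poly F} -> C).
Hypothesis LamM : forall g h, Lam (g * h) = Lam g * Lam h.

(* lcoef are the coefficients of the L-function of the completely multiplicative
   Lam, and lpower i is the sum of Lam over the characteristic polynomials of
   the elements of the extension of degree i. *)
Definition lcoef k : C := \sum_(v : 'rV[F]_k) Lam (monic_poly v).
Definition lpower i : C := \sum_(th <- fixed_points F Om i) Lam (descend io (frob_prod F i th)).

Lemma sum_lcoef_dvd (c : {poly F}) i k : c \is monic -> size c = i.+1 -> (i <= k)%N ->
  \sum_(v : 'rV[F]_k | c %| monic_poly v) Lam (monic_poly v) = Lam c * lcoef (k - i).
Proof.
move=> cm sc ik; rewrite /lcoef mulr_sumr.
pose m (w : 'rV[F]_(k - i)) : 'rV[F]_k := poly_rV (c * monic_poly w - 'X^k).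
have mE w : monic_poly (m w) = c * monic_poly w.
  have [||v vE] := @monic_polyP F (c * monic_poly w) k.
  - by rewrite monicMl // monic_monic_poly.
  - by rewrite size_monicM ?monic_neq0 ?monic_monic_poly // sc size_monic_poly addnS addSn /= subnKC.
  by rewrite /m vE; congr monic_poly; rewrite /monic_poly addrC addKr rVpolyK.
have m_inj : injective m.
  move=> w w' /(congr1 (@monic_poly F k)); rewrite !mE.
  by move/(mulfI (monic_neq0 cm))/monic_poly_inj.
transitivity (\sum_(v in [set m w | w in [set: 'rV[F]_(k - i)]]) Lam (monic_poly v)).
  apply: eq_bigl => v; apply/idP/imsetP => [/dvdpP[h hE]|[w _ ->]]; last first.
    by rewrite mE dvdp_mulr.
  have hm : h \is monic.
    by have := monic_monic_poly v; rewrite hE monicMr.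
  have [|w wE] := @monic_polyP F h (k - i) hm.
    have := size_monic_poly v; rewrite hE size_Mmonic ?monic_neq0 // sc addnS /=.
    by move=> E; rewrite -subSn // -E addnK.
  by exists w => //; apply: monic_poly_inj; rewrite mE hE wE mulrC.
rewrite big_imset => [|w w' _ _ /m_inj //].
by apply: eq_big => [w|w _]; rewrite ?inE // mE LamM.
Qed.

(** Weighting each monic g by its degree and expanding the degree by [frob_prod_count] gives the
    logarithmic derivative of the L-function coefficientwise, without an Euler product. *)
Lemma lfunction_logderiv k :
  lcoef k *+ k = \sum_(1 <= i < k.+1) lpower i * lcoef (k - i).
Proof.
rewrite /lcoef -sumrMnl.
transitivity (\sum_(v : 'rV[F]_k) \sum_(1 <= i < k.+1) \sum_(th <- fixed_points F Om i)
   Lam (monic_poly v) *+ (frob_prod F i th %| map_poly io (monic_poly v))%R).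
  apply: eq_bigr => v _.
  have [rs rsE] := closed_field_poly_normal (map_poly io (monic_poly v)).
  have m1 : map_poly io (monic_poly v) \is monic by rewrite map_monic monic_monic_poly.
  rewrite (eqP m1) scale1r in rsE.
  have srs : size rs = k.
    by apply/eq_add_S; rewrite -(size_prod_XsubC _ id) -rsE size_map_poly size_monic_poly.
  have E := frob_prod_count qF rsE; rewrite srs in E; rewrite -[X in _ *+ X]E.
  rewrite -sumrMnr; apply: eq_bigr => i _; by rewrite -sumrMnr.
rewrite exchange_big /=; apply: eq_big_nat => i /andP[i0 ik].
rewrite exchange_big mulr_suml /=; apply: eq_big_seq => th.
have [_ _ ->] := fixed_pointsP io qF i0; move/eqP => thi.
have dE := frob_prod_descend io qF thi.
rewrite -sum_lcoef_dvd //.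
- rewrite [RHS]big_mkcond; apply: eq_bigr => v _.
  by rewrite -{1}dE dvdp_map; case: ifP.
- by rewrite -(map_monic io) dE monic_frob_prod.
by rewrite -(size_map_poly io) dE size_frob_prod.
Qed.
End LFunction.

(** * Weil's bound *)

Section Weil.
Variables (F : finFieldType) (Om : closedFieldType) (io : {rmorphism F -> Om}).
Local Notation q := #|F|.
Hypothesis qF : q \in [pchar F].
Variable (C : numClosedFieldType).
Hypothesis archi : forall x : C, 0 <= x -> exists n : nat, x < n%:R.
Variable chi : F -> C.
Hypotheses (chiM : {morph chi : x y / x * y}) (chi1 : chi 1 = 1) (chi0 : chi 0 = 0).
Variable b : F.
Hypotheses (b0 : b != 0) (chib : chi b != 1).
Variables (I : finType) (c : I -> F) (ex : I -> nat) (i0 : I).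
Hypotheses (ci0 : c i0 = 0) (exi0 : ex i0 = 1%N) (ci : forall i, i != i0 -> c i != 0).

Let Lam (g : {poly F}) := \prod_i chi g.[c i] ^+ ex i.
Local Notation n := #|I|.
Let qOm : q \in [pchar Om]. Proof. by rewrite (fmorph_pchar io). Qed.

Lemma sum_char0 : \sum_u chi u = 0.
Proof.
have E : \sum_u chi u = chi b * \sum_u chi u.
  rewrite {1}(reindex_inj (mulfI b0)) mulr_sumr; apply: eq_bigr => u _; exact: chiM.
move/eqP: E; rewrite -subr_eq0 -{1}[\sum_u _]mul1r -mulrBl mulf_eq0 subr_eq0 eq_sym (negPf chib).
by move/eqP.
Qed.

Lemma norm_char_le1 u : `|chi u| <= 1.
Proof.
have [->|u0] := eqVneq u 0; first by rewrite chi0 normr0 ler01.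
have chiX k : chi (u ^+ k) = chi u ^+ k.
  by elim: k => [|k IH]; rewrite ?expr0 // !exprS chiM IH.
have q1 : (0 < q.-1)%N by rewrite -subn1 subn_gt0 finNzRing_gt1.
have uq : u ^+ q.-1 = 1.
  by apply: (mulfI u0); rewrite -exprS prednK ?expf_card ?mulr1 // ltnW ?finNzRing_gt1.
have : `|chi u| ^+ q.-1 = 1 by rewrite -normrX -chiX uq chi1 normr1.
by move/eqP; rewrite pexpr_eq1 // => [/eqP ->].
Qed.

Let LamM g h : Lam (g * h) = Lam g * Lam h.
Proof. by rewrite /Lam -big_split; apply: eq_bigr => i _; rewrite hornerM chiM exprMn. Qed.

Let n0 : (0 < n)%N. Proof. by apply/card_gt0P; exists i0. Qed.

(** Adding u W, where W vanishes at every c i except c i0, changes only the value at c i0, and this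
    value runs over F with u: the sum over u is a full sum of chi and vanishes. As W has degree n -
    1 < k, the polynomial stays monic of degree k. *)
Lemma lcoef_eq0 k : (n <= k)%N -> lcoef Lam k = 0.
Proof.
move=> nk; pose W := \prod_(i | i != i0) ('X - (c i)%:P).
have sW : size W = n.
  rewrite /W -big_filter size_prod_XsubC size_filter -sum1_count sum1_card.
  by rewrite cardC1 prednK.
pose w : 'rV[F]_k := poly_rV W.
have mE v u : monic_poly (v + u *: w) = monic_poly v + u *: W.
  by rewrite /monic_poly linearD linearZ /= poly_rV_K ?sW // addrA.
have W0 : W.[c i0] != 0.
  rewrite horner_prod; apply/prodf_neq0 => i ii0.
  by rewrite hornerXsubC ci0 sub0r oppr_eq0 ci.
have E u : lcoef Lam k = \sum_(v : 'rV[F]_k) Lam (monic_poly v + u *: W).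
  rewrite /lcoef (reindex_inj (addIr (u *: w))).
  by apply: eq_bigr => v _; rewrite mE.
have : lcoef Lam k *+ q = 0.
  rewrite -sumr_const (eq_bigr _ (fun u _ => E u)) exchange_big /= big1 // => v _.
  under eq_bigr => u _.
    rewrite /Lam (bigD1 i0) //= exi0 expr1.
    rewrite (eq_bigr (fun i => chi (monic_poly v).[c i] ^+ ex i)) => [|i ii0]; last first.
      rewrite hornerD hornerZ [W.[_]](_ : _ = 0) ?mulr0 ?addr0 //.
      by rewrite horner_prod (bigD1 i) //= hornerXsubC subrr mul0r.
    over.
  have inj : injective (fun u => (monic_poly v + u *: W).[c i0]).
    by move=> u u'; rewrite !hornerD !hornerZ => /addrI /(mulIf W0).
  rewrite -mulr_suml.
  have -> : \sum_u chi (monic_poly v + u *: W).[c i0] = \sum_u chi u.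
    by rewrite [RHS](reindex_inj inj).
  by rewrite sum_char0 mul0r.
move/eqP; rewrite mulrn_eq0 => /orP[|/eqP //].
by have := finNzRing_gt1 F; case: (q).
Qed.

Lemma lcoef0 : lcoef Lam 0 = 1.
Proof.
rewrite /lcoef (big_pred1 0) => [|v]; last by rewrite /= [v]thinmx0 eqxx.
rewrite /monic_poly linear0 addr0 expr0 /Lam big1 // => i _.
by rewrite hornerC chi1 expr1n.
Qed.

(** The L-function is a polynomial of degree below n with constant term 1. Newton's identities for
    its inverse roots and [lfunction_logderiv] are the same recursion up to sign, so induction
    identifies the two sequences. *)
Lemma lpower_roots : exists s : seq C, (size s < n)%N /\
  forall k, (0 < k)%N -> lpower io Lam k = - \sum_(w <- s) w ^+ k.
Proof.
pose L := \poly_(k < n) lcoef Lam k.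
have LE k : L`_k = lcoef Lam k.
  by rewrite coef_poly; case: ltnP => // /lcoef_eq0.
have [|s [ss sE]] := @factor_1subZX C L; first by rewrite LE lcoef0.
exists s; split.
  rewrite ss; apply: leq_ltn_trans (_ : n.-1 < n)%N; last by rewrite prednK.
  by rewrite -!subn1 leq_sub2r // size_poly.
elim/ltn_ind => k IH k0.
have H1 := lfunction_logderiv io qF LamM k.
have := newton_identity s k; rewrite -sE /= LE H1 => /eqP.
rewrite -addr_eq0 -big_split /= big_nat_recr //= subnn !LE lcoef0 !mulr1.
rewrite big1_seq ?add0r => [|i /andP[_]]; first by rewrite addr_eq0 => /eqP.
rewrite mem_index_iota => /andP[i1 ik]; rewrite LE (IH i) //.
by rewrite mulNr addNr.
Qed.

Lemma lpower1 : lpower io Lam 1 = \sum_(th : F) \prod_i chi (c i - th) ^+ ex i.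
Proof.
have [us ss ms] := fixed_pointsP io qF (ltn0Sn 0).
rewrite /lpower.
have pe : perm_eq (fixed_points F Om 1) [seq io a | a <- enum F].
  apply: uniq_perm => //; first by rewrite map_inj_uniq ?enum_uniq //; exact: fmorph_inj.
  move=> x; rewrite ms expn1; apply/eqP/mapP => [/(closure_fixedP io)[a ->]|[a _ ->]].
    by exists a; rewrite // mem_enum.
  by rewrite -rmorphXn /= expf_card.
rewrite (perm_big _ pe) big_map big_enum /=; apply: eq_bigr => a _.
rewrite /Lam; apply: eq_bigr => i _; congr (_ _ ^+ _); apply: (fmorph_inj io).
rewrite -horner_map frob_prod_descend //.
  by rewrite /frob_prod big_ord1 expn0 expr1 hornerXsubC rmorphB.
by rewrite expn1 -rmorphXn /= expf_card.
Qed.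

Let G : {poly Om} := \prod_i ((io (c i))%:P - 'X) ^+ ex i.

(* The exponent \sum_(l < i) q ^ l is (q ^ i - 1) / (q - 1): its power map is the
   norm to F. *)
Lemma norm_descend i th : th ^+ (q ^ i) = th ->
  io (\prod_j (descend io (frob_prod F i th)).[c j] ^+ ex j) = G.[th] ^+ (\sum_(l < i) q ^ l).
Proof.
move=> thi; rewrite rmorph_prod /= /G horner_prod -prodrXl; apply: eq_bigr => j _.
rewrite rmorphXn /= -horner_map frob_prod_descend // horner_exp !hornerE exprAC; congr (_ ^+ _).
rewrite /frob_prod horner_prod (big_morph _ (exprD _) (expr0 _)).
apply: eq_bigr => l _; rewrite hornerXsubC -{1}(closure_fixed io (c j) l).
elim: (nat_of_ord l) => [|k IH]; first by rewrite expn0 !expr1.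
by rewrite expnSr !exprM -IH -!(pFrobenius_autE qOm) rmorphB.
Qed.

Lemma lpower_chi i : (0 < i)%N ->
  lpower io Lam i = \sum_(a : F) chi a *+
    count (fun th => G.[th] ^+ (\sum_(l < i) q ^ l) == io a) (fixed_points F Om i).
Proof.
move=> i_gt0; have [us ss ms] := fixed_pointsP io qF i_gt0.
transitivity (\sum_(th <- fixed_points F Om i) \sum_(a : F)
   chi a *+ (G.[th] ^+ (\sum_(l < i) q ^ l) == io a)); last first.
  rewrite exchange_big /=; apply: eq_bigr => a _.
  by rewrite sumrMnr -sumn_count sumnE big_map.
apply: eq_big_seq => th; rewrite ms => /eqP thi.
pose u := \prod_j (descend io (frob_prod F i th)).[c j] ^+ ex j.
have -> : Lam (descend io (frob_prod F i th)) = chi u.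
  rewrite /Lam /u (big_morph chi chiM chi1); apply: eq_bigr => j _.
  by elim: (ex j) => [|k IH]; rewrite ?expr0 // !exprS chiM IH.
have uE : io u = G.[th] ^+ (\sum_(l < i) q ^ l) by apply: norm_descend.
rewrite (bigD1 u) //= uE eqxx mulr1n big1 ?addr0 // => a au.
by rewrite -uE (inj_eq (fmorph_inj io)) eq_sym (negPf au) mulr0n.
Qed.

(** Because c i0 = 0 and ex i0 = 1, the factor of index i0 is -X. Its sign is absorbed here, so that
    G = X G1 has the shape required by [stepanov], with G1 nonzero at 0. *)
Let G1 : {poly Om} := - \prod_(i | i != i0) ((io (c i))%:P - 'X) ^+ ex i.

Let GE : G = 'X * G1.
Proof.
rewrite /G (bigD1 i0) //= ci0 exi0 expr1 rmorph0 sub0r /G1.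
by rewrite mulrN mulNr.
Qed.

Let G1_0 : G1`_0 != 0.
Proof.
rewrite /G1 coefN oppr_eq0 -horner_coef0 horner_prod; apply/prodf_neq0 => i ii0.
by rewrite horner_exp !hornerE /= ?subr0 expf_neq0 // fmorph_eq0 ci.
Qed.

Let expq k : (q ^ k = (q.-1 * \sum_(l < k) q ^ l).+1)%N.
Proof. by rewrite -predn_exp prednK // expn_gt0 ltnW // finNzRing_gt1. Qed.

Let D := size G1.
Let fiber t a := count (fun th => G.[th] ^+ (\sum_(l < t.*2) q ^ l) == io a) (fixed_points F Om t.*2).

(** This is [stepanov] with Q = q^(2t), P = q^t, m = q - 1; kap is then the exponent of the norm to
    F, and u = (q^t - 1) / (q - 1). *)
Lemma fiber_leq t a : (D + 5 <= q ^ t)%N -> (0 < t)%N ->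
  (fiber t a <= \sum_(l < t.*2) q ^ l + (3 * D + 4) * q ^ t)%N.
Proof.
move=> Dq t0; have t20 : (0 < t.*2)%N by rewrite double_gt0.
have [us ss ms] := fixed_pointsP io qF t20.
rewrite /fiber -size_filter.
apply: (stepanov qOm (erefl _) _ (expq t.*2) (expq t) G1_0 Dq).
- by rewrite -expnD addnn.
- exact: filter_uniq.
by move=> x; rewrite mem_filter ms => /andP[/eqP xa /eqP ->]; rewrite -GE xa.
Qed.

Lemma sum_fiber t : (0 < t)%N -> (\sum_a fiber t a = q ^ t.*2)%N.
Proof.
move=> t0; have t20 : (0 < t.*2)%N by rewrite double_gt0.
have [us ss ms] := fixed_pointsP io qF t20.
rewrite -ss -sum1_size /fiber.
under eq_bigr do rewrite -sumn_count sumnE big_map.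
rewrite exchange_big /=; apply: eq_big_seq => th; rewrite ms => /eqP thi.
have aE := esym (norm_descend thi); set a := (\prod_j _) in aE.
rewrite (bigD1 a) //= aE eqxx big1 // => a' ne.
by rewrite (inj_eq (fmorph_inj io)) eq_sym (negPf ne).
Qed.

Lemma fiber0_leq t : (0 < t)%N -> (fiber t 0 <= D)%N.
Proof.
move=> t0; have t20 : (0 < t.*2)%N by rewrite double_gt0.
have [us ss ms] := fixed_pointsP io qF t20.
have G10 : G1 != 0 by apply: contraNneq G1_0 => ->; rewrite coef0.
have G0 : G != 0 by rewrite GE mulf_neq0 // polyX_eq0.
rewrite /fiber -size_filter -ltnS.
have -> : D.+1 = size G by rewrite GE mulrC size_mulX.
apply: max_poly_roots => //; last exact: filter_uniq.
apply/allP => x; rewrite mem_filter rmorph0 expf_eq0 => /andP[/andP[_ Gx] _].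
exact: Gx.
Qed.

(** Stepanov bounds every fibre only from above, by kap + B. From below it is controlled on average:
    the fibres add up to q^(2t) = (q - 1) kap + 1 and the one over 0 is at most D, so the total
    deficit from kap + B is O(q B). Subtracting kap from each fibre is free because chi sums to
    0. *)
Lemma lpower_leq t : (D + 5 <= q ^ t)%N -> (0 < t)%N ->
  `|lpower io Lam t.*2| <= (2 * q * (3 * D + 4) + D)%:R * q%:R ^+ t.
Proof.
move=> Dq t0; have t20 : (0 < t.*2)%N by rewrite double_gt0.
set kap := (\sum_(l < t.*2) q ^ l)%N; set B := ((3 * D + 4) * q ^ t)%N.
have -> : lpower io Lam t.*2 = \sum_(a | a != 0) chi a * ((fiber t a)%:R - kap%:R).
  rewrite lpower_chi // -/kap (bigD1 0) //= chi0 mul0rn add0r.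
  have : \sum_(a | a != 0) chi a * kap%:R = 0.
    rewrite -mulr_suml; have := sum_char0; rewrite (bigD1 0) //= chi0 add0r => ->.
    by rewrite mul0r.
  move=> E; under [RHS]eq_bigr do rewrite mulrBr.
  rewrite sumrB E subr0; apply: eq_bigr => a _; by rewrite mulr_natr.
apply: le_trans (ler_norm_sum _ _ _) _.
apply: le_trans (_ : \sum_(a : F | a != 0) ((kap + B)%:R - (fiber t a)%:R + B%:R) <= _).
  apply: ler_sum => a _; rewrite normrM.
  apply: le_trans (_ : `|(fiber t a)%:R - kap%:R| <= _).
    by rewrite ler_piMl // norm_char_le1.
  have := fiber_leq a Dq t0; rewrite -/kap -/B => H.
  rewrite -[X in _ <= X + _]natrB // -natrD.
  case: (leqP kap (fiber t a)) => [le|/ltnW le].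
    by rewrite -natrB // normr_nat ler_nat; lia.
  by rewrite distrC -natrB // normr_nat ler_nat; lia.
have := sum_fiber t0; rewrite (bigD1 0) //= => E.
rewrite big_split sumrB /= !sumr_const -natr_sum.
have -> : #|[pred a : F | a != 0]| = q.-1 by rewrite -(cardC1 (0 : F)).
rewrite -!mulrnA -natrX.
have H : (\sum_(a : F | a != 0%R) fiber t a <= (kap + B) * q.-1)%N.
  rewrite mulnC -(cardC1 (0 : F)) -sum_nat_const; apply: leq_sum => a _; exact: fiber_leq.
rewrite -natrB // -natrD -natrM ler_nat.
have := fiber0_leq t0; have := expq t.*2; rewrite -/kap.
have : (D <= D * q ^ t)%N by rewrite leq_pmulr // expn_gt0 ltnW // finNzRing_gt1.
have qq : (q = q.-1.+1)%N by rewrite prednK // ltnW // finNzRing_gt1.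
have : (B * q.-1 <= B * q)%N by rewrite leq_mul2l leq_pred orbT.
rewrite mulnDl -E [(q.-1 * kap)%N]mulnC.
have : (B * q = (3 * D + 4) * q ^ t * q)%N by [].
move: (kap * q.-1)%N (B * q.-1)%N (B * q)%N (q ^ t)%N (fiber t 0) (\sum_(a | _) _)%N => K1 B1 B2 P f0 Sf; move: D (#|F|) => D0 q0; clear.
lia.
Qed.

Lemma weil_translated :
  `|\sum_(th : F) \prod_i chi (c i - th) ^+ ex i| <= n.-1%:R * sqrtC q%:R.
Proof.
have [s [sn sE]] := lpower_roots.
rewrite -lpower1 sE // normrN.
have q0 : 0 < q%:R :> C by rewrite ltr0n ltnW // finNzRing_gt1.
have bd w : w \in s -> `|w| <= sqrtC q%:R.
  move=> ws.
  have : `|w ^+ 2| <= q%:R.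
    (* Only even power sums are under control, so the squares of the inverse roots are bounded, by
       q; t >= D + 5 ensures D + 5 <= q^t. *)
    apply: (@power_sums_bound C archi [seq w ^+ 2 | w <- s] q%:R
       (2 * q * (3 * D + 4) + D)%:R (D + 5)) => //; last by apply/mapP; exists w.
    move=> t Dt.
    rewrite big_map.
    under eq_bigr do rewrite -exprM mul2n.
    have t0 : (0 < t)%N by apply: leq_trans Dt; rewrite addn_gt0 orbT.
    rewrite -normrN -sE ?double_gt0 //; apply: lpower_leq => //.
    by apply: leq_trans Dt (ltnW (ltn_expl _ _)); rewrite finNzRing_gt1.
  by rewrite normrX -{1}(sqrtCK q%:R) ler_sqr // nnegrE // sqrtC_ge0 ltW.
apply: le_trans (ler_norm_sum _ _ _) _.
apply: le_trans (_ : \sum_(w <- s) sqrtC q%:R <= _).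
  by rewrite !big_seq; apply: ler_sum => w ws; rewrite expr1 bd.
rewrite big_const_seq count_predT iter_addr_0 -[_ *+ size s]mulr_natl.
rewrite ler_wpM2r ?sqrtC_ge0 ?(ltW q0) // ler_nat.
by rewrite -ltnS prednK.
Qed.
End Weil.

Lemma weil_bound (F : finFieldType) (C : numClosedFieldType) (chi : F -> C) (b : F)
    (I : finType) (c : I -> F) (ex : I -> nat) (i0 : I) :
  #|F| \in [pchar F] ->
  (forall x : C, 0 <= x -> exists n : nat, x < n%:R) ->
  {morph chi : x y / x * y} -> chi 1 = 1 -> chi 0 = 0 -> b != 0 -> chi b != 1 ->
  ex i0 = 1%N -> (forall i, i != i0 -> c i != c i0) ->
  `|\sum_(x : F) \prod_i chi (c i - x) ^+ ex i| <= #|I|.-1%:R * sqrtC #|F|%:R.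
Proof.
move=> qF archi chiM chi1 chi0 b0 chib exi0 ci.
have [Om [io _]] := countable_algebraic_closure F.
have := @weil_translated F Om io qF C archi chi chiM chi1 chi0 b b0 chib I
   (fun i => c i - c i0) ex i0 (subrr _) exi0.
rewrite (reindex_inj (addIr (- c i0))) /=.
under eq_bigr => x _ do under eq_bigr do rewrite opprB addrA subrK.
by apply=> i /ci; rewrite subr_eq0.
Qed.

(** * Complex exponentials *)

Section ComplexAbs.
Variable R : realType.
Implicit Types (x y : R) (z : R[i]).

(** A real-valued modulus: the norm of R[i] takes its values in R[i], whose order is only
    partial. *)
Definition cabs z : R := complex.Re `|z|.

Lemma cabsE z : (cabs z)%:C = `|z|.
Proof. by rewrite RRe_real // normr_real. Qed.

Lemma cabs_ge0 z : 0 <= cabs z.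
Proof. by rewrite -lecR cabsE normr_ge0. Qed.

Lemma cabsM z1 z2 : cabs (z1 * z2) = cabs z1 * cabs z2.
Proof. by apply: complexI; rewrite rmorphM /= !cabsE normrM. Qed.

Lemma cabs0 : cabs (0 : R[i]) = 0.
Proof. by apply: complexI; rewrite cabsE normr0. Qed.

Lemma cabs1 : cabs (1 : R[i]) = 1.
Proof. by apply: complexI; rewrite cabsE normr1. Qed.

Lemma cabsX z n : cabs (z ^+ n) = cabs z ^+ n.
Proof. by apply: complexI; rewrite rmorphXn /= !cabsE normrX. Qed.

Lemma cabsN z : cabs (- z) = cabs z.
Proof. by apply: complexI; rewrite !cabsE normrN. Qed.

Lemma cabsB z1 z2 : cabs (z1 - z2) = cabs (z2 - z1).
Proof. by rewrite -cabsN opprB. Qed.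

Lemma ler_cabsD z1 z2 : cabs (z1 + z2) <= cabs z1 + cabs z2.
Proof. by rewrite -lecR rmorphD /= !cabsE ler_normD. Qed.

Lemma cabs_real x : cabs x%:C = `|x|.
Proof. by rewrite /cabs normc_def /= expr0n addr0 sqrtr_sqr. Qed.

Lemma cabs_conj z : cabs z^* = cabs z.
Proof. by rewrite /cabs normcJ. Qed.

Lemma ler_cabs_sum (I : Type) (s : seq I) (P : pred I) (f : I -> R[i]) :
  cabs (\sum_(i <- s | P i) f i) <= \sum_(i <- s | P i) cabs (f i).
Proof.
have E : (\sum_(i <- s | P i) cabs (f i))%:C = \sum_(i <- s | P i) `|f i|.
  by rewrite rmorph_sum; apply: eq_bigr => i _; rewrite -cabsE.
by rewrite -lecR E cabsE ler_norm_sum.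
Qed.

Lemma cabs_sqr z : (cabs z ^+ 2)%:C = z * z^*.
Proof. by rewrite rmorphXn /= cabsE sqr_normc. Qed.

Lemma ger_cabs_Re z : `|complex.Re z| <= cabs z.
Proof. by rewrite -lecR cabsE normc_ge_Re. Qed.

Lemma ler_cabs_ReIm z : cabs z <= `|complex.Re z| + `|complex.Im z|.
Proof.
rewrite {1}[z]complexE; apply: le_trans (ler_cabsD _ _) _.
rewrite cabsM !cabs_real.
have -> : cabs 'i%C = 1 :> R.
  by rewrite /cabs normc_def /= expr0n expr1n add0r sqrtr1.
by rewrite mul1r.
Qed.

Lemma eD x y : e (x + y) = e x * e y.
Proof. by rewrite /e mulrDr cosD sinD; apply/eqP; rewrite eq_complex /= eqxx /= addrC. Qed.

Lemma e0 : e (0 : R) = 1.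
Proof. by rewrite /e mulr0 cos0 sin0. Qed.

Lemma e1 : e (1 : R) = 1.
Proof. by rewrite /e mulr1 mulr_natl cos2pi sin2pi. Qed.

Lemma eMn x n : e (x *+ n) = e x ^+ n.
Proof. by elim: n => [|n IH]; rewrite ?mulr0n ?e0 // mulrSr exprSr eD IH. Qed.

Lemma e_conj x : (e x)^* = e (- x).
Proof. by rewrite /e mulrN cosN sinN. Qed.

Lemma conj_one_sub_e x : (1 - e x)^* = 1 - e (- x).
Proof. by rewrite -e_conj rmorphB rmorph1. Qed.

Lemma cabs_e x : cabs (e x) = 1.
Proof. by rewrite /cabs normc_def /= cos2Dsin2 sqrtr1. Qed.

Lemma eN x : e x * e (- x) = 1.
Proof. by rewrite -eD subrr e0. Qed.

Lemma e_int (n : int) : e (n%:~R : R) = 1.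
Proof.
have H (k : nat) : e (k%:R : R) = 1 by rewrite eMn e1 expr1n.
case: n => n; first exact: H.
rewrite NegzE mulrNz; have := eN (- n.+1%:R); rewrite opprK H mulr1.
by [].
Qed.

Lemma eDint x (n : int) : e (x + n%:~R) = e x.
Proof. by rewrite eD e_int mulr1. Qed.

(** Take n with 1/4 <= n x <= 3/4. The real part of e(n x) is then at most 0, so 1 <= |1 - e(n x)|
    <= n |1 - e(x)|, and n x <= 1 concludes. *)
Lemma one_sub_e_ge x : 0 < x -> x <= 1 / 2 -> x <= cabs (1 - e x).
Proof.
move=> x0 x1.
pose n := (Num.truncn ((4 * x)^-1)).+1.
have x40 : 0 < 4 * x by lra.
have i0 : 0 <= (4 * x)^-1 by rewrite invr_ge0 ltW.
have n1 : (4 * x)^-1 < n%:R by apply: truncnS_gt.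
have n2 : n%:R <= (4 * x)^-1 + 1 by rewrite -[n%:R]natr1 lerD2r truncn_le.
have E : (4 * x)^-1 * x = 1 / 4 by field; rewrite gt_eqF.
have n1' : 1 / 4 <= n%:R * x by rewrite -E ler_wpM2r // ltW.
have n2' : n%:R * x <= 1 / 4 + x.
  by have := ler_wpM2r (ltW x0) n2; rewrite mulrDl E [1 * x]mul1r.
have c0 : cos (2 * pi * (n%:R * x)) <= 0.
  set t := _ * x in n1' n2' *.
  have -> : 2 * pi * t = (2 * pi * t - pi) + pi by ring.
  rewrite cosDpi oppr_le0 cos_ge0_pihalf //.
  have := pi_gt0 R; move: (pi : R) => p p0; apply/andP; split.
    by have := ler_wpM2l (ltW p0) n1'; lra.
  have : t <= 3 / 4 by lra.
  by move/(ler_wpM2l (ltW p0)); lra.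
have le1 : 1 <= cabs (1 - e (x *+ n)).
  apply: le_trans (ger_cabs_Re _); rewrite -mulr_natl /=.
  by apply: le_trans (ler_norm _); lra.
have len : cabs (1 - e (x *+ n)) <= n%:R * cabs (1 - e x).
  rewrite eMn; elim: (n) => [|k IH].
    by rewrite expr0 subrr cabs0 mul0r.
  have -> : 1 - e x ^+ k.+1 = (1 - e x ^+ k) + e x ^+ k * (1 - e x) by rewrite exprSr; ring.
  apply: le_trans (ler_cabsD _ _) _; rewrite cabsM cabsX cabs_e expr1n mul1r.
  by rewrite -natr1 mulrDl mul1r lerD2r.
have := le_trans le1 len.
have n0 : 0 < n%:R :> R by rewrite ltr0n.
move/(ler_wpM2l (ltW x0)); rewrite mulr1 mulrCA mulrA mulrC => H.
apply: le_trans H _; rewrite ler_piMr ?cabs_ge0 //; lra.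
Qed.

Lemma one_sub_e_lower x : 0 < x < 1 -> Num.min x (1 - x) <= cabs (1 - e x).
Proof.
move=> /andP[x0 x1]; case: (lerP x (1 / 2)) => h.
  by apply: le_trans (one_sub_e_ge x0 h); rewrite ge_min lexx.
have H := @one_sub_e_ge (1 - x) _ _.
rewrite ge_min; apply/orP; right; apply: le_trans (H _ _) _; try lra.
have -> : e (1 - x) = e (- x) by rewrite eD e1 mul1r.
by rewrite -conj_one_sub_e cabs_conj.
Qed.

Lemma sum_e_eq0 (Q : nat) (n : int) : (0 < Q)%N -> n != 0 -> (`|n| < Q)%N ->
  \sum_(b < Q) e (b%:R * n%:~R / Q%:R : R) = 0.
Proof.
move=> Q0 n0 nQ.
have Q0' : Q%:R != 0 :> R by rewrite pnatr_eq0 -lt0n.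
have Qp : 0 < Q%:R :> R by rewrite ltr0n.
set z := e (n%:~R / Q%:R : R).
have E (b : nat) : e (b%:R * n%:~R / Q%:R : R) = z ^+ b.
  by rewrite -mulrA mulr_natl eMn.
have zQ : z ^+ Q = 1 by rewrite -E mulrAC mulfV // mul1r e_int.
have z1 : 1 - z != 0.
  have zE : cabs (1 - z) = cabs (1 - e (`|n|%N%:R / Q%:R)).
    rewrite /z; case: (intP n) => [||k] //.
    rewrite -[RHS]cabs_conj conj_one_sub_e -mulNr.
    by rewrite mulrNz.
  have p0 : 0 < `|n|%N%:R / Q%:R :> R by rewrite divr_gt0 // ltr0n absz_gt0.
  have p1 : `|n|%N%:R / Q%:R < 1 :> R by rewrite ltr_pdivrMr // mul1r ltr_nat.
  apply: contraTneq (one_sub_e_lower (_ : 0 < `|n|%N%:R / Q%:R < 1)) => [z0|].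
    by rewrite -zE z0 cabs0 -ltNge lt_min p0 subr_gt0.
  by rewrite p0.
under eq_bigr do rewrite E.
have := subrX1 z Q; rewrite zQ subrr => /esym/eqP.
rewrite mulf_eq0 => /orP[|/eqP //].
by rewrite -oppr_eq0 opprB (negPf z1).
Qed.
End ComplexAbs.

(** * Completion of incomplete sums *)

Section Completion.
Import numFieldNormedType.Exports.
Variable R : realType.
Implicit Types (x y : R).

Lemma ler_norm_MVT (f df : R -> R) x y : (forall z : R, is_derive z 1 f (df z)) ->
  (forall z, `|df z| <= 1) -> `|f x - f y| <= `|x - y|.
Proof.
move=> fD fB; wlog xy : x y / x < y.
  move=> W; case: (ltgtP x y) => [/W //|/W|->]; last by rewrite !subrr.
  by rewrite distrC [`|y - x|]distrC.
have [|c _ E] := @MVT R f df x y xy (fun z _ => fD z).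
  by apply: derivable_within_continuous => z _; exact: ex_derive.
by rewrite distrC E normrM [`|x - y|]distrC ler_piMl.
Qed.

Lemma e_lipschitz x y : cabs (e x - e y) <= 16 * `|x - y|.
Proof.
apply: le_trans (ler_cabs_ReIm _) _ => /=.
have pi8 : `|2 * pi * x - 2 * pi * y| <= 8 * `|x - y|.
  rewrite -mulrBr normrM ler_wpM2r // ger0_norm ?mulr_ge0 ?pi_ge0 //.
  by have := pihalf_lt2 R; lra.
have c1 : `|cos (2 * pi * x) - cos (2 * pi * y)| <= 8 * `|x - y|.
  apply: le_trans pi8; apply: (ler_norm_MVT (df := fun z => - sin z)) => z.
  by rewrite normrN sin_max.
have s1 : `|sin (2 * pi * x) - sin (2 * pi * y)| <= 8 * `|x - y|.
  apply: le_trans pi8; apply: (ler_norm_MVT (df := cos)) => z; exact: cos_max.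
by apply: le_trans (lerD c1 s1) _; lra.
Qed.

Lemma abel_summation (A : comPzRingType) (w x : nat -> A) u v : (u <= v)%N ->
  \sum_(u <= k < v) w k * x k = w v * (\sum_(u <= j < v) x j) -
    \sum_(u <= k < v) (w k.+1 - w k) * \sum_(u <= j < k.+1) x j.
Proof.
elim: v => [|v IH]; first by rewrite leqn0 => /eqP->; rewrite !big_geq // mulr0 subr0.
rewrite leq_eqVlt => /orP[/eqP->|]; first by rewrite !big_geq // mulr0 subr0.
rewrite ltnS => uv; rewrite !big_nat_recr //= IH //.
by ring.
Qed.

Lemma ler_abel (w x : nat -> R[i]) (u v : nat) (M V : R) : (u <= v)%N ->
  cabs (w v) <= 1 -> \sum_(u <= k < v) cabs (w k.+1 - w k) <= V ->
  (forall k, (u <= k <= v)%N -> cabs (\sum_(u <= j < k) x j) <= M) ->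
  cabs (\sum_(u <= k < v) w k * x k) <= (1 + V) * M.
Proof.
move=> uv wv wV xM; rewrite abel_summation // mulrDl mul1r.
have M0 : 0 <= M by apply: le_trans (xM u _); rewrite ?cabs_ge0 ?leqnn.
apply: le_trans (ler_cabsD _ _) _; rewrite cabsN; apply: lerD.
  rewrite cabsM -[M]mul1r ler_pM ?cabs_ge0 //; apply: xM; by rewrite uv leqnn.
apply: le_trans (ler_cabs_sum _ _ _) _.
apply: le_trans (_ : (\sum_(u <= k < v) cabs (w k.+1 - w k)) * M <= _); last by rewrite ler_wpM2r.
rewrite mulr_suml; apply: ler_sum_nat => k /andP[uk kv].
by rewrite cabsM ler_wpM2l ?cabs_ge0 // xM // (leqW uk).
Qed.

Definition harmonic_sum n : R := \sum_(1 <= k < n) k%:R^-1.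

Lemma geometric_e_bound Q b u v : (0 < b < Q)%N -> (u <= v)%N ->
  cabs (\sum_(u <= k < v) e (- (b%:R * k%:R / Q%:R : R))) <=
  2 * (Q%:R / b%:R + Q%:R / (Q - b)%:R).
Proof.
move=> /andP[b0 bQ] uv.
have Q0 : 0 < Q%:R :> R by rewrite ltr0n (ltn_trans b0).
have b0' : 0 < b%:R :> R by rewrite ltr0n.
have Qb0 : 0 < (Q - b)%:R :> R by rewrite ltr0n subn_gt0.
pose z := e (- (b%:R / Q%:R : R)).
have zE k : e (- (b%:R * k%:R / Q%:R : R)) = z ^+ k.
  by rewrite -eMn -mulr_natr; congr e; ring.
under eq_bigr do rewrite zE.
have tel : (z - 1) * \sum_(u <= k < v) z ^+ k = z ^+ v - z ^+ u.
  rewrite mulr_sumr -[RHS]telescope_sumr //.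
  by apply: eq_bigr => k _; rewrite mulrBl mul1r exprS.
have cz : cabs (z - 1) = cabs (1 - e (b%:R / Q%:R : R)).
  by rewrite cabsB /z -conj_one_sub_e cabs_conj.
have lo : 0 < (b%:R / Q%:R : R) < 1.
  by rewrite divr_gt0 //= ltr_pdivrMr // mul1r ltr_nat.
have := one_sub_e_lower lo; rewrite -cz.
set S := \sum_(_ <= _ < _) _ in tel *; set m := Num.min _ _ => mz.
have m0 : 0 < m by rewrite lt_min subr_gt0 andbC andbC; move: lo => /andP[-> ->].
have le2 : m * cabs S <= 2.
  apply: le_trans (_ : cabs (z - 1) * cabs S <= _); first by rewrite ler_wpM2r ?cabs_ge0.
  rewrite -cabsM tel; apply: le_trans (ler_cabsD _ _) _.
  by rewrite cabsN !cabsX cabs_e !expr1n; lra.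
have : cabs S <= 2 * m^-1 by rewrite ler_pdivlMr // mulrC.
move=> H; apply: le_trans H _; rewrite ler_pM2l //.
rewrite /m; case: (leP (b%:R / Q%:R) (1 - b%:R / Q%:R)) => _.
  by rewrite invf_div lerDl divr_ge0 // ltW.
have -> : 1 - b%:R / Q%:R = (Q - b)%:R / Q%:R :> R.
  by rewrite natrB 1?ltnW // mulrBl mulfV // gt_eqF.
by rewrite invf_div lerDr divr_ge0 // ltW.
Qed.

(** The weight w restricted to [u, v) is expanded in additive characters modulo Q; L <= Q keeps the
    points of [1, L] distinct modulo Q. Partial summation bounds the Fourier coefficients [wh] by (1
    + W) / Q times a geometric sum, and adding these up produces the harmonic sum. Truncation and
    varying weight are thus removed at once. *)
Lemma completion (L Q u v : nat) (w c : nat -> R[i]) (W V : R) :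
  (0 < L <= Q)%N -> (1 <= u <= v)%N -> (v <= L.+1)%N ->
  (forall k, cabs (w k) <= 1) ->
  \sum_(u <= k < v) cabs (w k.+1 - w k) <= W -> 0 <= W ->
  (forall b : nat, cabs (\sum_(1 <= h < L.+1) e (b%:R * h%:R / Q%:R : R) * c h) <= V) ->
  cabs (\sum_(u <= h < v) w h * c h) <= (1 + W) * (1 + 4 * harmonic_sum Q) * V.
Proof.
move=> /andP[L0 LQ] /andP[u1 uv] vL w1 wW W0 HV.
have Q0n : (0 < Q)%N := leq_trans L0 LQ.
have Q0 : 0 < Q%:R :> R by rewrite ltr0n.
pose wh (b : nat) : R[i] := (Q%:R^-1)%:C * \sum_(u <= k < v) w k * e (- (b%:R * k%:R / Q%:R : R)).
have E : \sum_(u <= h < v) w h * c h =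
  \sum_(b < Q) wh b * \sum_(1 <= h < L.+1) e (b%:R * h%:R / Q%:R : R) * c h.
  transitivity (\sum_(u <= k < v) \sum_(1 <= h < L.+1) w k * c h *
      ((Q%:R^-1)%:C * \sum_(b < Q) e (b%:R * (h%:Z - k%:Z)%:~R / Q%:R : R))).
    apply: eq_big_nat => k /andP[uk kv].
    rewrite (bigD1_seq k) ?iota_uniq ?mem_index_iota ?(leq_trans u1 uk) ?(leq_trans kv) //=.
    rewrite [X in _ + X]big1_seq => [|h /andP[hk]]; last first.
      rewrite mem_index_iota => /andP[h1 hL].
      rewrite sum_e_eq0 ?mulr0 //; first by rewrite subr_eq0 eqz_nat.
      by lia.
    under eq_bigr do rewrite subrr mulr0 mul0r e0.
    have QC : Q%:R = (Q%:R)%:C :> R[i] by rewrite rmorph_nat.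
    rewrite addr0 sumr_const card_ord QC -rmorphM /=.
    by rewrite mulVf ?gt_eqF // rmorph1 mulr1.
  transitivity (\sum_(b < Q) \sum_(u <= k < v) \sum_(1 <= h < L.+1)
      (w k * c h * ((Q%:R^-1)%:C * e (b%:R * (h%:Z - k%:Z)%:~R / Q%:R : R)))).
    rewrite [RHS]exchange_big /=; apply: eq_bigr => k _.
    rewrite [RHS]exchange_big /=; apply: eq_bigr => h _.
    by rewrite mulr_sumr mulr_sumr.
  apply: eq_bigr => b _; rewrite /wh -mulrA mulr_suml mulr_sumr.
  apply: eq_bigr => k _; rewrite mulr_sumr mulr_sumr; apply: eq_bigr => h _.
  have -> : b%:R * (h%:Z - k%:Z)%:~R / Q%:R = b%:R * h%:R / Q%:R - b%:R * k%:R / Q%:R :> R.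
    by rewrite rmorphB /= -!pmulrn mulrBr mulrBl.
  by rewrite eD; ring.
have V0 : 0 <= V by apply: le_trans (HV 0%N); rewrite cabs_ge0.
rewrite E; apply: le_trans (ler_cabs_sum _ _ _) _.
apply: le_trans (_ : (\sum_(b < Q) cabs (wh b)) * V <= _).
  by rewrite mulr_suml; apply: ler_sum => b _; rewrite cabsM ler_wpM2l ?cabs_ge0.
rewrite ler_wpM2r //.
have wh_le (b : nat) M :
    (forall k, (u <= k <= v)%N -> cabs (\sum_(u <= j < k) e (- (b%:R * j%:R / Q%:R : R))) <= M) ->
    cabs (wh b) <= (1 + W) * (Q%:R^-1 * M).
  move=> HM; rewrite /wh cabsM cabs_real ger0_norm ?invr_ge0 ?ler0n // mulrCA.
  by rewrite ler_wpM2l ?invr_ge0 ?ler0n //; apply: ler_abel.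
rewrite -(big_mkord xpredT (fun b => cabs (wh b))) big_ltn // mulrDr mulr1.
apply: lerD.
  have := wh_le 0%N Q%:R; rewrite mulVf ?gt_eqF // mulr1; apply => k /andP[uk kv].
  apply: le_trans (ler_cabs_sum _ _ _) _.
  under eq_bigr do rewrite cabs_e.
  rewrite big_const_nat iter_addr_0 ler_nat.
  by apply: leq_trans LQ; rewrite leq_subLR; lia.
apply: le_trans (_ : \sum_(1 <= b < Q) (1 + W) * (2 * (b%:R^-1 + (Q - b)%:R^-1)) <= _).
  apply: ler_sum_nat => b bQ.
  have := wh_le b (2 * (Q%:R / b%:R + Q%:R / (Q - b)%:R)).
  have -> : Q%:R^-1 * (2 * (Q%:R / b%:R + Q%:R / (Q - b)%:R)) = 2 * (b%:R^-1 + (Q - b)%:R^-1) :> R.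
    rewrite mulrCA mulrDr !mulrA mulVf ?gt_eqF // !mul1r //.
  apply=> k /andP[uk kv]; apply: geometric_e_bound => //.
rewrite -mulr_sumr ler_wpM2l //; first by lra.
rewrite -mulr_sumr big_split /=.
have -> : \sum_(1 <= b < Q) (Q - b)%:R^-1 = harmonic_sum Q.
  by rewrite /harmonic_sum [RHS]big_nat_rev /=; apply: eq_big_nat => b /andP[b1 bQ]; rewrite add1n subSS.
rewrite -/(harmonic_sum Q); lra.
Qed.
End Completion.

(** * Weil's bound for products of a character and its conjugate *)

Section WeilComplex.
Variable R : realType.

Lemma sqrtC_nat (n : nat) : sqrtC (n%:R : R[i]) = (Num.sqrt (n%:R : R))%:C.
Proof.
apply/eqP; rewrite -(@eqrXn2 _ 2) ?sqrtC_ge0 ?ler0n //; last by rewrite ler0c sqrtr_ge0.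
by rewrite sqrtCK -rmorphXn /= sqr_sqrtr ?ler0n // rmorph_nat.
Qed.

Lemma complex_archi (x : R[i]) : 0 <= x -> exists n : nat, x < n%:R.
Proof.
move=> x0; have xr := ger0_real x0.
exists (Num.truncn (complex.Re x)).+1.
rewrite -(RRe_real xr) -(rmorph_nat (real_complex R)) ltcR /=.
exact: truncnS_gt.
Qed.

Variable F : finFieldType.
Hypothesis qF : #|F| \in [pchar F].
Variable chi : F -> R[i].
Hypotheses (chiM : {morph chi : x y / x * y}) (chi1 : chi 1 = 1) (chi0 : chi 0 = 0).
Variable b : F.
Hypotheses (b0 : b != 0) (chib : chi b != 1).
Local Notation q := #|F|.

Lemma card_gt2 : (2 < q)%N.
Proof.
rewrite ltn_neqAle eq_sym finNzRing_gt1 andbT; apply: contra_neq chib => q2.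
have /eqP : b ^+ q.-1 = 1.
  apply: (mulfI b0); rewrite -exprS prednK ?expf_card ?mulr1 //.
  by rewrite ltnW // finNzRing_gt1.
by rewrite q2 expr1 => /eqP ->.
Qed.

Lemma cabs_char_le1 u : cabs (chi u) <= 1.
Proof. by rewrite -lecR cabsE; apply: (norm_char_le1 chiM chi1 chi0). Qed.

(** On units conjugation is inversion, hence the power q - 2. At 0 both sides vanish because q > 2
    makes this exponent positive. *)
Lemma conj_char u : (chi u)^* = chi u ^+ (q - 2).
Proof.
have q2 := card_gt2.
have [->|u0] := eqVneq u 0.
  by rewrite chi0 conjc0 expr0n subn_eq0 leqNgt q2.
have chiX k : chi (u ^+ k) = chi u ^+ k.
  by elim: k => [|k IH]; rewrite ?expr0 // !exprS chiM IH.
have uq : chi u ^+ (q - 1) = 1.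
  rewrite -chiX -[RHS]chi1; congr chi.
  by apply: (mulfI u0); rewrite -exprS subn1 prednK ?expf_card ?mulr1 // ltnW // ltnW.
have n1 : chi u * (chi u)^* = 1.
  rewrite -cabs_sqr; have : cabs (chi u) ^+ (q - 1) = 1 by rewrite -cabsX uq cabs1.
  by move/eqP; rewrite pexpr_eq1 ?cabs_ge0 ?subn_gt0 1?ltnW // => /eqP->; rewrite expr1n.
have c0 : chi u != 0 by apply: contra_eq_neq n1 => ->; rewrite mul0r eq_sym oner_eq0.
apply: (mulfI c0); rewrite n1 -exprS -uq; congr (_ ^+ _).
by rewrite -subSn // ltnW.
Qed.

(** Conjugated factors become powers with exponent q - 2, while [weil_bound] wants exponent 1 at the
    isolated point. Conjugating the whole sum exchanges the two kinds of factors, so [s i0] may be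
    assumed. *)
Lemma weil_bound_conj (I : finType) (c : I -> F) (s : I -> bool) (i0 : I) :
  (forall i, i != i0 -> c i != c i0) ->
  cabs (\sum_x \prod_i (if s i then chi (x + c i) else (chi (x + c i))^*)) <=
  #|I|%:R * Num.sqrt q%:R.
Proof.
move=> ci; wlog si : s / s i0 => [W|].
  case: (boolP (s i0)) => [/W //|nsi]; have := W (fun i => ~~ s i) nsi.
  rewrite -cabs_conj rmorph_sum /=.
  under eq_bigr => x _.
    rewrite rmorph_prod /=.
    under eq_bigr => i _.
      rewrite (_ : (if ~~ s i then chi (x + c i) else (chi (x + c i))^*)^* =
        if s i then chi (x + c i) else (chi (x + c i))^*); last first.
        by case: (s i); rewrite /= ?conjcK.
      over.
    over.
  by [].
pose ex i := if s i then 1%N else (q - 2)%N.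
have exi0 : ex i0 = 1%N by rewrite /ex si.
have := weil_bound qF complex_archi chiM chi1 chi0 b0 chib exi0 ci.
rewrite (reindex_inj oppr_inj) /= sqrtC_nat -cabsE.
under eq_bigr => x _.
  under eq_bigr => i _.
    rewrite opprK addrC (_ : _ ^+ _ = if s i then chi (x + c i) else (chi (x + c i))^*); last first.
      by rewrite /ex; case: (s i); rewrite ?expr1 // conj_char.
    over.
  over.
move=> H; have {}H : cabs (\sum_x \prod_i (if s i then chi (x + c i) else (chi (x + c i))^*))
  <= #|I|.-1%:R * Num.sqrt q%:R.
  by rewrite -lecR rmorphM /= rmorph_nat.
apply: le_trans H _; rewrite ler_wpM2r ?sqrtr_ge0 // ler_nat; exact: leq_pred.
Qed.
End WeilComplex.

(** * Discretising the coefficients of the phase *)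

Section Grid.
Variables (R : realType) (r d L : nat).
Hypotheses (r0 : (0 < r)%N) (L0 : (0 < L)%N).
Implicit Types (a : nat -> R[i]).

(* Sums of r numbers h ^ j.+1 with 1 <= h <= L differ by less than modulus j. *)
Definition modulus (j : nat) : nat := (r * L ^ j.+1)%N.

Definition phase (b : 'I_d -> int) (h : nat) : R :=
  \sum_j (b j)%:~R * h%:R ^+ j.+1 / (modulus j)%:R.

Definition grid_sum a (b : 'I_d -> int) : R[i] :=
  \sum_(1 <= h < L.+1) e (phase b h) * a h.

(** All coordinates share an ordinal type large enough for the largest modulus; the predicate
    restores the individual ranges. *)
Definition in_grid (b : {ffun 'I_d -> 'I_(r * L ^ d)}) : bool :=
  [forall j : 'I_d, b j < modulus j]%N.

Definition grid_max a : R :=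
  \big[Num.max/0]_(b : {ffun 'I_d -> 'I_(r * L ^ d)} | in_grid b)
     cabs (grid_sum a (fun j => (b j : nat)%:Z)).

Lemma modulus_gt0 j : (0 < modulus j)%N.
Proof. by rewrite muln_gt0 r0 expn_gt0 L0. Qed.

Lemma modulus_neq0 j : (modulus j)%:R != 0 :> R.
Proof. by rewrite pnatr_eq0 -lt0n modulus_gt0. Qed.

Lemma e_phase_mod (b b' k : 'I_d -> int) h :
  (forall j, b j = b' j + k j * (modulus j)%:Z) -> e (phase b h) = e (phase b' h).
Proof.
move=> H; rewrite -(eDint (phase b' h) (\sum_j k j * (h ^ j.+1)%N%:Z)); congr e.
rewrite /phase rmorph_sum -big_split /=; apply: eq_bigr => j _.
have := modulus_neq0 j; rewrite H; move: (modulus j) => M M0.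
rewrite rmorphD !rmorphM /= -!pmulrn natrX; by field.
Qed.

Lemma grid_sum_le a (b : 'I_d -> int) : cabs (grid_sum a b) <= grid_max a.
Proof.
have lt j : (`|(b j %% (modulus j)%:Z)%Z| < modulus j)%N.
  by rewrite -ltz_nat gez0_abs ?modz_ge0 ?ltz_pmod // ?ltz_nat ?modulus_gt0 // eqz_nat -lt0n modulus_gt0.
have lt2 (j : 'I_d) : (`|(b j %% (modulus j)%:Z)%Z| < r * L ^ d)%N.
  by apply: leq_trans (lt j) _; rewrite leq_mul2l leq_pexp2l // orbT.
pose b' : {ffun 'I_d -> 'I_(r * L ^ d)} := [ffun j => Ordinal (lt2 j)].
have -> : grid_sum a b = grid_sum a (fun j => (b' j : nat)%:Z).
  apply: eq_bigr => h _; congr (_ * _).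
  apply: (@e_phase_mod _ _ (fun j => (b j %/ (modulus j)%:Z)%Z)) => j.
  rewrite ffunE /= gez0_abs ?modz_ge0 ?eqz_nat -?lt0n ?modulus_gt0 //.
  by rewrite addrC -divz_eq.
have b'grid : in_grid b' by apply/forallP => j; rewrite ffunE; apply: lt.
exact: (le_bigmax_cond 0 (fun b : {ffun 'I_d -> 'I_(r * L ^ d)} =>
  cabs (grid_sum a (fun j => (b j : nat)%:Z))) b'grid).
Qed.

Lemma grid_max_ge0 a : 0 <= grid_max a.
Proof. exact: bigmax_ge_id. Qed.

Hypothesis d0 : (0 < d)%N.

(** Each coefficient of degree j + 1 is rounded down to a multiple of 1 / modulus j. The remainder
    [ga] is nondecreasing and at most d 2^d up to L + 1, since (L + 1)^(j + 1) <= 2^(j + 1) L^(j +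
    1); its exponential has variation at most 16 d 2^d, and [completion] removes it. *)
Lemma poly_sum_le_grid_max (g : {poly R}) a u v :
  (size g <= d.+1)%N -> (1 <= u <= v)%N -> (v <= L.+1)%N ->
  cabs (\sum_(u <= h < v) e g.[h%:R] * a h) <=
  (1 + 16 * (d * 2 ^ d)%:R) * (1 + 4 * harmonic_sum R (modulus 0)) * grid_max a.
Proof.
move=> sg uv vL.
pose k (j : 'I_d) : int := Num.floor ((modulus j)%:R * g`_j.+1).
pose be (j : 'I_d) : R := g`_j.+1 - (k j)%:~R / (modulus j)%:R.
have be0 j : 0 <= be j.
  by rewrite subr_ge0 ler_pdivrMr ?ltr0n ?modulus_gt0 // mulrC floor_le.
have be1 j : be j <= (modulus j)%:R^-1.
  have := floorD1_gt ((modulus j)%:R * g`_j.+1); rewrite -/(k j) intrD => /ltW H.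
  rewrite lerBlDr -[X in X + _]mul1r -mulrDl ler_pdivlMr ?ltr0n ?modulus_gt0 //.
  by rewrite mulrC addrC.
pose ga h : R := \sum_j be j * h%:R ^+ j.+1.
pose w h : R[i] := e (ga h).
have gE h : g.[h%:R] = g`_0 + phase k h + ga h.
  rewrite (@horner_coef_wide _ d.+1) // big_ord_recl expr0 mulr1 -addrA; congr (_ + _).
  rewrite /phase /ga -big_split /=; apply: eq_bigr => j _.
  by rewrite /bump leq0n add1n /be mulrBl mulrAC addrC subrK.
have ga_mono h1 h2 : (h1 <= h2)%N -> ga h1 <= ga h2.
  move=> h12; apply: ler_sum => j _; rewrite ler_wpM2l //.
  by rewrite ler_pXn2r ?nnegrE ?ler0n // ler_nat.
have ga_bound : ga L.+1 <= (d * 2 ^ d)%:R.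
  have -> : (d * 2 ^ d)%:R = \sum_(j < d) (2 ^ d)%:R :> R.
    by rewrite sumr_const card_ord -mulrnA mulnC.
  apply: ler_sum => j _; apply: le_trans (_ : (modulus j)%:R^-1 * L.+1%:R ^+ j.+1 <= _).
    by rewrite ler_wpM2r ?exprn_ge0 // be1.
  rewrite mulrC ler_pdivrMr ?ltr0n ?modulus_gt0 // -natrX -natrM ler_nat.
  apply: (@leq_trans (2 ^ j.+1 * L ^ j.+1)).
    by rewrite -expnMn leq_exp2r // mul2n -addnn -addn1 leq_add2l.
  rewrite leq_mul ?leq_pexp2l // /modulus; exact: leq_pmull.
pose Qj := modulus 0.
have -> : \sum_(u <= h < v) e g.[h%:R] * a h =
    e g`_0 * \sum_(u <= h < v) w h * (e (phase k h) * a h).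
  rewrite mulr_sumr; apply: eq_bigr => h _; rewrite gE !eD /w; ring.
rewrite cabsM cabs_e mul1r.
apply: (@completion R L (modulus 0)) => //.
- by rewrite L0 /modulus expn1 leq_pmull.
- by move=> h; rewrite cabs_e.
- apply: le_trans (_ : \sum_(u <= h < v) 16 * (ga h.+1 - ga h) <= _).
    apply: ler_sum_nat => h _; apply: le_trans (e_lipschitz _ _) _.
    by rewrite ger0_norm // subr_ge0 ga_mono.
  rewrite -mulr_sumr telescope_sumr; last by case/andP: uv.
  rewrite ler_wpM2l // lerBlDr; apply: le_trans (ga_mono _ _ vL) _.
  apply: le_trans ga_bound _; rewrite lerDl sumr_ge0 // => j _.
  by rewrite mulr_ge0 // exprn_ge0.
(* The twist by b / modulus 0 is absorbed in the linear coefficient, so the twisted complete sum is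
   again bounded by [grid_max]. *)
move=> b; apply: le_trans (grid_sum_le a (fun j => k j + (j == 0%N :> nat)%:Z * b%:Z)).
rewrite le_eqVlt; apply/orP; left; apply/eqP; congr cabs.
apply: eq_bigr => h _; rewrite mulrA -eD; congr (e _ * _).
rewrite /phase.
pose j0 : 'I_d := Ordinal d0.
have jn0 (j : 'I_d) : j != j0 -> (j == 0%N :> nat) = false.
  by move=> jj0; apply/negbTE; apply: contraNneq jj0 => E; apply/eqP/val_inj.
rewrite [in LHS](bigD1 j0) // [in RHS](bigD1 j0) //=.
rewrite [X in _ = _ + X](eq_bigr (fun j : 'I_d => (k j)%:~R * h%:R ^+ j.+1 / (modulus j)%:R)); last first.
  by move=> j /jn0 ->; rewrite mul0r addr0.
by rewrite mul1r rmorphD /= -pmulrn; ring.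
Qed.
End Grid.

(** * The 2r-th moment *)

(** When every value is repeated, the 2r positions take at most r values, so the tuple factors
    through 'I_r: r^(2r) maps of positions and M^r lists of values. *)
Lemma card_all_values_repeated (r M : nat) : (0 < r)%N ->
  (#|[pred h : {ffun 'I_(r + r) -> 'I_M} |
      [forall i, exists j, (j != i) && (h j == h i)]]| <= r ^ (r + r) * M ^ r)%N.
Proof.
move=> r0.
case: M => [|M].
  rewrite eq_card0 // => h; have [] := h (lshift r (Ordinal r0)); by [].
pose f (p : {ffun 'I_(r + r) -> 'I_r} * {ffun 'I_r -> 'I_M.+1}) : {ffun 'I_(r + r) -> 'I_M.+1} :=
  [ffun i => p.2 (p.1 i)].
have -> : (r ^ (r + r) * M.+1 ^ r = #|[set: {ffun 'I_(r + r) -> 'I_r} * {ffun 'I_r -> 'I_M.+1}]|)%N.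
  by rewrite cardsT card_prod !card_ffun !card_ord.
apply: leq_trans (leq_imset_card f _); apply: subset_leq_card.
apply/fintype.subsetP => h; rewrite inE => /forallP H.
pose A := h @: [set: 'I_(r + r)].
have cA : (#|A| <= r)%N.
  have E : (\sum_(i in [set: 'I_(r + r)]) 1 = r + r)%N by rewrite sum1_card cardsT card_ord.
  rewrite -leq_double -[X in (_ <= X)%N]addnn -[X in (_ <= X)%N]E.
  rewrite (partition_big_imset h) /= -mul2n mulnC -sum_nat_const.
  apply: leq_sum => y /imsetP[i _ ->].
  have /existsP[j /andP[ji /eqP hj]] := H i.
  rewrite (bigD1 i) ?inE ?eqxx //= (bigD1 j) ?inE ?hj ?eqxx ?ji //.
have Ai i : h i \in A by apply: imset_f.
have A0 : (0 < #|A|)%N by apply/card_gt0P; exists (h (lshift r (Ordinal r0))).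
pose si (i : 'I_(r + r)) : 'I_r := widen_ord cA (enum_rank_in (Ai i) (h i)).
pose v (k : 'I_r) : 'I_M.+1 := nth ord0 (enum A) k.
apply/imsetP; exists ([ffun i => si i], [ffun k => v k]); first by rewrite inE.
apply/ffunP => i; rewrite !ffunE /= /v /=.
by have := enum_rankK_in (Ai i) (Ai i); rewrite /enum_val (set_nth_default ord0) // -cardE.
Qed.

Section Moment.
Variable R : realType.
Variable F : finFieldType.
Hypothesis qF : #|F| \in [pchar F].
Variable chi : F -> R[i].
Hypotheses (chiM : {morph chi : x y / x * y}) (chi1 : chi 1 = 1) (chi0 : chi 0 = 0).
Variable b0 : F.
Hypotheses (b0n0 : b0 != 0) (chib : chi b0 != 1).
Local Notation q := #|F|.
Variables (r d L : nat).
Hypotheses (r0 : (0 < r)%N) (L0 : (0 < L)%N) (Lq : (L < q)%N).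
Local Notation I := 'I_(r + r).
Local Notation ph := (@phase R r d L).

Lemma natr_inj_lt (m n : nat) : (m < q)%N -> (n < q)%N -> m%:R = n%:R :> F -> m = n.
Proof.
wlog mn : m n / (m <= n)%N.
  by move=> W mq nq E; case: (leqP m n) => [/W|/ltnW /W H]; [apply | apply/esym/H].
move=> _ nq /esym/eqP; rewrite -subr_eq0 -natrB // -(dvdn_pcharf qF) => /dvdn_leq H.
apply/eqP; rewrite eqn_leq mn /= -subn_eq0 -leqn0 leqNgt; apply/negP => /H.
by rewrite leqNgt (leq_ltn_trans _ nq) // leq_subr.
Qed.

Definition coef x (h : nat) : R[i] := chi (x + h%:R).
Definition fstI (i : I) : bool := (i < r)%N.
Definition chiprod x (h : {ffun I -> 'I_L.+1}) : R[i] :=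
  \prod_i (if fstI i then coef x (h i) else (coef x (h i))^*).
Definition diffpow (h : {ffun I -> 'I_L.+1}) (m : nat) : int :=
  (\sum_(i < r) h (lshift r i) ^ m)%N%:Z - (\sum_(i < r) h (rshift r i) ^ m)%N%:Z.
Definition positive_ffun (h : {ffun I -> 'I_L.+1}) : bool := [forall i, (0 < h i)%N].

Lemma grid_sum_pow x (b : 'I_d -> int) :
  (cabs (grid_sum r L (coef x) b) ^+ (2 * r))%:C =
  \sum_(h | positive_ffun h)
     e (\sum_j (b j)%:~R * (diffpow h j.+1)%:~R / (modulus r L j)%:R) * chiprod x h.
Proof.
pose t (i : I) (h : 'I_L.+1) : R[i] :=
  if fstI i then e (ph b h) * coef x h else (e (ph b h) * coef x h)^*.
have TE : grid_sum r L (coef x) b = \sum_(h < L.+1 | (0 < h)%N) e (ph b h) * coef x h.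
  by rewrite /grid_sum big_geq_mkord; apply: eq_bigl => h.
have PC (z : R[i]) : z ^+ r = \prod_(i < r) z by rewrite prodr_const card_ord.
transitivity (\prod_(i : I) \sum_(h < L.+1 | (0 < h)%N) t i h).
  rewrite exprM rmorphXn /= cabs_sqr exprMn big_split_ord /=; congr (_ * _).
    rewrite PC; apply: eq_bigr => i _.
    by rewrite TE; apply: eq_bigr => h _; rewrite /t /fstI /= ltn_ord.
  rewrite PC; apply: eq_bigr => i _.
  rewrite TE rmorph_sum; apply: eq_bigr => h _.
  by rewrite /t /fstI /= ltnNge leq_addr.
rewrite bigA_distr_big /=.
apply: eq_big => [h|h _]; first by apply/ffun_onP/forallP.
transitivity (\prod_(i : I) (e ((if fstI i then 1 else -1) * ph b (h i)) *
   (if fstI i then coef x (h i) else (coef x (h i))^*))).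
  apply: eq_bigr => i _; rewrite /t; case: (fstI i); first by rewrite mul1r.
  by rewrite rmorphM /= mulN1r; congr (_ * _); rewrite -e_conj.
rewrite big_split /=; congr (_ * _).
have -> : \prod_(i : I) e ((if fstI i then 1 else -1) * ph b (h i)) =
    e (\sum_(i : I) (if fstI i then 1 else -1) * ph b (h i)).
  by rewrite (big_morph (@e R) (@eD R) (@e0 R)).
congr e; transitivity (\sum_(i : I) \sum_(j < d) (if fstI i then 1 else -1) *
    ((b j)%:~R * (h i)%:R ^+ j.+1 / (modulus r L j)%:R) : R).
  by apply: eq_bigr => i _; rewrite /phase mulr_sumr.
rewrite exchange_big /=; apply: eq_bigr => j _.
rewrite /diffpow rmorphB /= -!pmulrn !natr_sum.
rewrite big_split_ord /= mulrBr mulrBl; congr (_ + _).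
  rewrite mulr_sumr mulr_suml; apply: eq_bigr => i _.
  by rewrite /fstI /= ltn_ord mul1r natrX.
rewrite mulr_sumr mulr_suml -sumrN; apply: eq_bigr => i _.
by rewrite /fstI /= ltnNge leq_addr /= mulN1r natrX.
Qed.

(** The sum factors over the coordinates, and each factor is orthogonality modulo [modulus j]; the
    size of n j turns a congruence to 0 into an equality. *)
Lemma sum_grid (n : 'I_d -> int) : (forall j, `|n j| < modulus r L j)%N ->
  \sum_(b : {ffun 'I_d -> 'I_(r * L ^ d)} | in_grid b)
    e (\sum_j (b j : nat)%:Z%:~R * (n j)%:~R / (modulus r L j)%:R : R) =
  (\prod_(j < d) modulus r L j)%:R *+ [forall j, n j == 0].
Proof.
move=> nlt.
transitivity (\prod_(j < d) \sum_(k < r * L ^ d | (k < modulus r L j)%N)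
   e (k%:R * (n j)%:~R / (modulus r L j)%:R : R)).
  rewrite bigA_distr_big_dep /=.
  apply: eq_big => [b|b _]; first by apply/forallP/familyP.
  by rewrite (big_morph (@e R) (@eD R) (@e0 R)).
have E (j : 'I_d) : \sum_(k < r * L ^ d | (k < modulus r L j)%N)
   e (k%:R * (n j)%:~R / (modulus r L j)%:R : R) = (modulus r L j)%:R *+ (n j == 0).
  have le : (modulus r L j <= r * L ^ d)%N by rewrite leq_mul2l leq_pexp2l // orbT.
  rewrite -(big_ord_widen _ (fun k : nat => e (k%:R * (n j)%:~R / (modulus r L j)%:R : R)) le).
  have [->|nj] := eqVneq (n j) 0; last by rewrite sum_e_eq0 // modulus_gt0.
  under eq_bigr do rewrite mulr0 mul0r e0.
  by rewrite sumr_const card_ord.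
rewrite (eq_bigr _ (fun j _ => E j)).
case: (boolP [forall j, n j == 0]) => [/forallP H|/forallPn[j nj]].
  by rewrite mulr1n natr_prod; apply: eq_bigr => j _; rewrite H.
by rewrite mulr0n (bigD1 j) //= (negPf nj) mulr0n mul0r.
Qed.

(** Both power sums lie between r and r L^(j+1); the positive lower end makes the inequality
    strict. *)
Lemma diffpow_lt h j : positive_ffun h -> (`|diffpow h j.+1| < modulus r L j)%N.
Proof.
move=> /forallP hp; rewrite /diffpow.
have lo (g : 'I_r -> I) : (r <= \sum_(i < r) h (g i) ^ j.+1)%N.
  rewrite -[X in (X <= _)%N]card_ord -sum1_card; apply: leq_sum => i _.
  by rewrite expn_gt0 hp.
have hi (g : 'I_r -> I) : (\sum_(i < r) h (g i) ^ j.+1 <= modulus r L j)%N.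
  rewrite /modulus -[X in (_ <= X * _)%N]card_ord -sum_nat_const; apply: leq_sum => i _.
  by rewrite leq_exp2r // -ltnS ltn_ord.
have := lo (lshift r); have := lo (@rshift r r); have := hi (lshift r); have := hi (@rshift r r).
lia.
Qed.

Definition vinogradov_ffun (h : {ffun I -> 'I_L.+1}) : bool :=
  positive_ffun h && [forall m : 'I_d,
        (\sum_(i < r) h (lshift r i) ^ m.+1 == \sum_(i < r) h (rshift r i) ^ m.+1)%N].

Lemma card_vinogradov : #|[pred h | vinogradov_ffun h]| = J r d (L%:R : R).
Proof. by rewrite /J natrK. Qed.

Lemma chiprod_le (h : {ffun I -> 'I_L.+1}) : [exists i, forall j, (j != i) ==> (h j != h i)] ->
  cabs (\sum_x chiprod x h) <= (2 * r)%:R * Num.sqrt q%:R.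
Proof.
move=> /existsP[i0 /forallP hi0].
have := weil_bound_conj qF chiM chi1 chi0 b0n0 chib (c := fun i => (h i : nat)%:R : F) fstI (i0 := i0).
have -> : #|I| = (2 * r)%N by rewrite card_ord addnn mul2n.
apply=> i ii0.
have := hi0 i; rewrite ii0 /=; apply: contra_neq => /natr_inj_lt E.
by apply: val_inj; apply: E; apply: leq_trans (ltn_ord _) _.
Qed.

Lemma chiprod_le_trivial h : cabs (\sum_x chiprod x h) <= q%:R.
Proof.
apply: le_trans (ler_cabs_sum _ _ _) _.
apply: le_trans (_ : \sum_(x : F) 1 <= _); last by rewrite sumr_const.
apply: ler_sum => x _; rewrite /chiprod.
elim/big_rec: _ => [|i z _ z1]; first by rewrite cabs1.
rewrite cabsM mulr_ile1 ?cabs_ge0 //.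
by case: (fstI i); rewrite ?cabs_conj (cabs_char_le1 chiM chi1 chi0).
Qed.

(** Replacing the maximum by a sum over the whole grid makes orthogonality available. Tuples with
    all values repeated get the trivial bound q and are counted without the Vinogradov condition;
    all others get Weil's bound, and at most J of them remain. *)
Lemma moment_bound :
  \sum_x grid_max r d L (coef x) ^+ (2 * r) <=
  (\prod_(j < d) modulus r L j)%:R *
    (q%:R * (r ^ (2 * r) * L.+1 ^ r)%:R + (2 * r)%:R * Num.sqrt q%:R * (J r d (L%:R : R))%:R).
Proof.
pose S x := \sum_(b : {ffun 'I_d -> 'I_(r * L ^ d)} | in_grid b)
   cabs (grid_sum r L (coef x) (fun j => (b j : nat)%:Z)) ^+ (2 * r).
have S0 x : 0 <= S x by apply: sumr_ge0 => b _; rewrite exprn_ge0 ?cabs_ge0.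
have le1 x : grid_max r d L (coef x) ^+ (2 * r) <= S x.
  rewrite /grid_max; elim/big_ind: _ => [|u v Hu Hv|b bg].
  - by rewrite expr0n muln_eq0 /= (negPf (lt0n_neq0 r0)).
  - by rewrite /Num.max; case: ifP.
  rewrite /S (bigD1 b) //= lerDl sumr_ge0 // => b' _.
  by rewrite exprn_ge0 ?cabs_ge0.
apply: le_trans (ler_sum _ (fun x _ => le1 x)) _.
have SE : (\sum_x S x)%:C = (\prod_(j < d) modulus r L j)%:R *
    \sum_(h | vinogradov_ffun h) \sum_x chiprod x h.
  rewrite rmorph_sum /=.
  under eq_bigr => x _.
    rewrite /S rmorph_sum /=.
    under eq_bigr => b _ do rewrite grid_sum_pow.
    rewrite exchange_big /=.
    under eq_bigr => h hp.
      rewrite -mulr_suml sum_grid; last by move=> j; apply: diffpow_lt.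
      over.
    over.
  rewrite exchange_big /= mulr_sumr big_mkcond [RHS]big_mkcond /=.
  apply: eq_bigr => h _; rewrite /vinogradov_ffun.
  case: (positive_ffun h) => //=; rewrite -mulr_sumr.
  have -> : [forall j : 'I_d, diffpow h j.+1 == 0] = [forall m : 'I_d,
        (\sum_(i < r) h (lshift r i) ^ m.+1 == \sum_(i < r) h (rshift r i) ^ m.+1)%N].
    by apply: eq_forallb => j; rewrite /diffpow subr_eq0 eqz_nat.
  by case: [forall m, _]; rewrite ?mulr1n ?mulr0n ?mul0r.
have -> : \sum_x S x = cabs (\sum_x S x)%:C by rewrite cabs_real ger0_norm // sumr_ge0.
rewrite SE cabsM -(rmorph_nat (real_complex R)) cabs_real normr_nat ler_wpM2l //.
apply: le_trans (ler_cabs_sum _ _ _) _.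
pose bad (h : {ffun I -> 'I_L.+1}) := [forall i, exists j, (j != i) && (h j == h i)].
rewrite (bigID bad) /=; apply: lerD.
  apply: le_trans (_ : \sum_(h | bad h) q%:R <= _).
    rewrite [leLHS]big_mkcond [leRHS]big_mkcond; apply: ler_sum => h _.
    case: (bad h); rewrite ?andbF // andbT; case: (vinogradov_ffun h) => //.
    exact: chiprod_le_trivial.
  rewrite sumr_const -[_ *+ #|_|]mulr_natr ler_wpM2l // ler_nat mul2n -addnn.
  exact: (card_all_values_repeated L.+1 r0).
apply: le_trans (_ : \sum_(h | vinogradov_ffun h) (2 * r)%:R * Num.sqrt q%:R <= _).
  rewrite [leLHS]big_mkcond [leRHS]big_mkcond; apply: ler_sum => h _.
  case: (vinogradov_ffun h) => //=; case: (boolP (bad h)) => /= hb.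
    by rewrite mulr_ge0 ?sqrtr_ge0.
  apply: chiprod_le; move: hb => /forallPn[i /existsPn H].
  apply/existsP; exists i; apply/forallP => j; apply/implyP => ji.
  by have := H j; rewrite ji.
by rewrite sumr_const -card_vinogradov [_ * _%:R]mulr_natr.
Qed.
End Moment.

(** * Collisions between short intervals *)

Section Inequalities.
Variable R : realFieldType.

Lemma cauchy_schwarz (T : finType) (a b : T -> R) :
  (\sum_x a x * b x) ^+ 2 <= (\sum_x a x ^+ 2) * (\sum_x b x ^+ 2).
Proof.
have : 0 <= \sum_x \sum_y (a x * b y - a y * b x) ^+ 2.
  by apply: sumr_ge0 => x _; apply: sumr_ge0 => y _; rewrite sqr_ge0.
have -> : \sum_x \sum_y (a x * b y - a y * b x) ^+ 2 =
   \sum_x \sum_y (a x ^+ 2 * b y ^+ 2) + \sum_x \sum_y (a y ^+ 2 * b x ^+ 2)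
   - 2 * \sum_x \sum_y (a x * b x) * (a y * b y).
  rewrite mulr_sumr -big_split -sumrB; apply: eq_bigr => x _ /=.
  rewrite mulr_sumr -big_split -sumrB; apply: eq_bigr => y _ /=; ring.
rewrite [X in _ + X - _]exchange_big /=.
have sep (u v : T -> R) : \sum_x \sum_y u x * v y = (\sum_x u x) * (\sum_y v y).
  by rewrite mulr_suml; apply: eq_bigr => x _; rewrite mulr_sumr.
rewrite !sep expr2; lra.
Qed.

(** The induction step is Chebyshev's inequality, from the nonnegative double sum of (v_y^r -
    v_z^r)(v_y - v_z). *)
Lemma power_mean (T : finType) (D : pred T) (v : T -> R) r : (0 < r)%N ->
  (forall y, 0 <= v y) ->
  (\sum_(y | D y) v y) ^+ r <= #|D|%:R ^+ r.-1 * \sum_(y | D y) v y ^+ r.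
Proof.
move=> r0 v0; case: r r0 => // r _; elim: r => [|r IH].
  by rewrite expr1 expr0 mul1r; under [leRHS]eq_bigr do rewrite expr1.
rewrite exprSr /=.
apply: le_trans (_ : (#|D|%:R ^+ r * \sum_(y | D y) v y ^+ r.+1) * \sum_(y | D y) v y <= _).
  by rewrite ler_wpM2r ?sumr_ge0.
rewrite [#|D|%:R ^+ r.+1]exprSr -!mulrA ler_wpM2l ?exprn_ge0 //.
have : 0 <= \sum_(y | D y) \sum_(z | D z) (v y ^+ r.+1 - v z ^+ r.+1) * (v y - v z).
  apply: sumr_ge0 => y _; apply: sumr_ge0 => z _.
  have [yz|/ltW zy] := lerP (v y) (v z).
    by rewrite mulr_le0 // subr_le0 // ler_pXn2r // nnegrE.
  by rewrite mulr_ge0 // subr_ge0 // ler_pXn2r // nnegrE.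
have sep (u w : T -> R) : \sum_(y | D y) \sum_(z | D z) u y * w z =
    (\sum_(y | D y) u y) * (\sum_(z | D z) w z).
  by rewrite mulr_suml; apply: eq_bigr => x _; rewrite mulr_sumr.
have -> : \sum_(y | D y) \sum_(z | D z) (v y ^+ r.+1 - v z ^+ r.+1) * (v y - v z) =
   \sum_(y | D y) \sum_(z | D z) (v y ^+ r.+2 * 1) + \sum_(y | D y) \sum_(z | D z) (1 * v z ^+ r.+2)
   - \sum_(y | D y) \sum_(z | D z) (v y ^+ r.+1 * v z) - \sum_(y | D y) \sum_(z | D z) (v y * v z ^+ r.+1).
  rewrite -big_split -!sumrB; apply: eq_bigr => x _ /=.
  rewrite -big_split -!sumrB; apply: eq_bigr => y _ /=; rewrite [v x ^+ r.+2]exprSr [v y ^+ r.+2]exprSr; ring.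
rewrite !sep sumr_const; lra.
Qed.

(** The power mean inequality with exponent r is followed by grouping along the values of f and
    Cauchy-Schwarz; the squared fibre sizes add up to the number of collisions. *)
Lemma holder_collisions (T F : finType) (D : pred T) (f : T -> F) (V : F -> R) r :
  (0 < r)%N -> (forall x, 0 <= V x) ->
  (\sum_(y | D y) V (f y)) ^+ (2 * r) <=
  #|D|%:R ^+ (2 * r.-1) *
  (#|[pred yz : T * T | [&& D yz.1, D yz.2 & f yz.1 == f yz.2]]|%:R * \sum_x V x ^+ (2 * r)).
Proof.
move=> r0 V0; rewrite mulnC [(2 * r.-1)%N]mulnC !exprM.
have pm := @power_mean T D (V \o f) r r0 (fun y => V0 _).
apply: le_trans (_ : (#|D|%:R ^+ r.-1 * \sum_(y | D y) V (f y) ^+ r) ^+ 2 <= _).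
  rewrite ler_pXn2r ?nnegrE ?exprn_ge0 ?mulr_ge0 ?exprn_ge0 ?sumr_ge0 //.
  by move=> y _; rewrite exprn_ge0.
rewrite exprMn ler_wpM2l ?exprn_ge0 //.
pose A x := #|[pred y | D y && (f y == x)]|.
have E : \sum_(y | D y) V (f y) ^+ r = \sum_x (A x)%:R * V x ^+ r.
  rewrite (partition_big f xpredT) //=; apply: eq_bigr => x _.
  rewrite (eq_bigr (fun=> V x ^+ r)) => [|y /andP[_ /eqP-> //]].
  by rewrite sumr_const mulr_natl.
rewrite E; apply: le_trans (cauchy_schwarz _ _) _.
under [X in _ <= _ * X]eq_bigr do rewrite exprM.
rewrite ler_wpM2r ?sumr_ge0 // => [x _|]; first by rewrite sqr_ge0.
under eq_bigr do rewrite -natrX.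
rewrite -natr_sum ler_nat -[X in (_ <= X)%N]sum1_card.
rewrite (partition_big (fun yz : T * T => f yz.1) xpredT) //=; apply: leq_sum => x _.
rewrite sum1_card expnS expn1 -cardX; apply: subset_leq_card.
apply/fintype.subsetP => -[y z]; rewrite !inE /= => /and3P[/andP[Dy /eqP fy] Dz /eqP fz].
by rewrite unfold_in /= inE /= Dy Dz fy fz !eqxx.
Qed.
End Inequalities.

Section Collisions.
Variables (F : finFieldType).
Local Notation q := #|F|.
Hypothesis qF : q \in [pchar F].
Variables (N0 P X K : nat).
Hypotheses (N0q : (N0 < q)%N) (P0 : (0 < P)%N) (P2q : (P.*2 <= q)%N).
Hypotheses (X0 : (0 < X)%N) (Xq : (X <= q)%N) (Kq : (8 * X * P ^ 2 <= K * q)%N).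

(** The m with p m just above N0 + a q start right after [floor_pt p a]. In [base_pt] an extra step
    back by j < X provides X base points for each interval, and so a longer average. *)
Definition floor_pt (p a : nat) : nat := ((N0 + a * q) %/ p)%N.
Definition base_pt (p a j : nat) : F := (floor_pt p a)%:R - j%:R.

Lemma natr_eq_pchar (m n : nat) : (m%:R == n%:R :> F) = (m == n %[mod q]).
Proof.
wlog mn : m n / (n <= m)%N.
  by move=> W; case: (leqP n m) => [/W//|/ltnW /W]; rewrite eq_sym => ->; rewrite eq_sym.
by rewrite -subr_eq0 -natrB // -(dvdn_pcharf qF) eqn_mod_dvd.
Qed.

Section Pair.
Variables (p p' : nat).
Hypotheses (pP : (P <= p < P.*2)%N) (pP' : (P <= p' < P.*2)%N).

Definition colliding (w : 'I_P.*2 * 'I_P.*2 * ('I_X * 'I_X)) : bool :=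
  [&& (w.1.1 < p)%N, (w.1.2 < p')%N & base_pt p w.1.1 w.2.1 == base_pt p' w.1.2 w.2.2].

(* In a collision floor_pt p a - j and floor_pt p' a' - j' differ by del * q;
   multiplying by p p' shows that tau lies in a short interval, and tau
   determines (a, a') up to gcd(p, p') choices. *)
Let del (w : 'I_P.*2 * 'I_P.*2 * ('I_X * 'I_X)) : int :=
  (((floor_pt p w.1.1)%:Z + w.2.2%:Z - (floor_pt p' w.1.2)%:Z - w.2.1%:Z) %/ q%:Z)%Z.

Let tau (w : 'I_P.*2 * 'I_P.*2 * ('I_X * 'I_X)) : int :=
  w.1.1%:Z * p'%:Z - w.1.2%:Z * p%:Z - del w * p%:Z * p'%:Z.

Let lo : int := ((- (X * p * p')%N%:Z - N0%:Z * (p'%:Z - p%:Z)) %/ q%:Z)%Z.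

Lemma delE w : colliding w ->
  (floor_pt p w.1.1)%:Z + w.2.2%:Z - (floor_pt p' w.1.2)%:Z - w.2.1%:Z = del w * q%:Z.
Proof.
case/and3P => _ _ H; rewrite /del.
set s := floor_pt p _ in H *; set s' := floor_pt p' _ in H *.
set j := (w.2.1 : nat) in H *; set j' := (w.2.2 : nat) in H *.
apply/esym/divzK.
have -> : s%:Z + j'%:Z - s'%:Z - j%:Z = (s + j')%N%:Z - (s' + j)%N%:Z by rewrite !PoszD; ring.
rewrite -eqz_mod_dvd !modz_nat eqz_nat -natr_eq_pchar !natrD.
by move: H; rewrite /base_pt subr_eq addrAC eq_sym subr_eq eq_sym.
Qed.

(** Writing p * floor_pt p a as N0 + a q minus a remainder below p, and likewise for p', puts N0 (p'
    - p) + q tau strictly between -X p p' and X p p'. The length 2 X p p' is at most 8 X P^2 <= K q,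
    whence K possible values. *)
Lemma tau_bound w : colliding w -> 0 <= tau w - lo - 1 < K%:Z.
Proof.
move=> cw; have dE := delE cw.
have q0 : (0 < q)%N by apply: leq_ltn_trans N0q.
case/and3P: cw => ap ap' _.
have p0 : (0 < p)%N by case/andP: pP => /(leq_trans P0).
have p'0 : (0 < p')%N by case/andP: pP' => /(leq_trans P0).
have e1 := divn_eq (N0 + w.1.1 * q) p; have e2 := divn_eq (N0 + w.1.2 * q) p'.
have m1 := ltn_pmod (N0 + w.1.1 * q) p0; have m2 := ltn_pmod (N0 + w.1.2 * q) p'0.
rewrite -/(floor_pt p w.1.1) in e1; rewrite -/(floor_pt p' w.1.2) in e2.
have j1 := ltn_ord w.2.1; have j2 := ltn_ord w.2.2.
have main : - (X * p * p')%N%:Z < N0%:Z * (p'%:Z - p%:Z) + q%:Z * tau w < (X * p * p')%N%:Z.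
  rewrite /tau; set a := w.1.1 : nat in e1 m1 *; set a' := w.1.2 : nat in e2 m2 *.
  have -> : N0%:Z * (p'%:Z - p%:Z) + q%:Z * (a%:Z * p'%:Z - a'%:Z * p%:Z - del w * p%:Z * p'%:Z) =
     (N0 + a * q)%N%:Z * p'%:Z - (N0 + a' * q)%N%:Z * p%:Z - (del w * q%:Z) * p%:Z * p'%:Z.
    by rewrite !PoszD !PoszM; ring.
  rewrite -dE e1 e2.
  set s := floor_pt p a; set s' := floor_pt p' a'; set r1 := (_ %% p)%N; set r2 := (_ %% p')%N.
  have h1 : (r1 * p' < p * p')%N by rewrite ltn_pmul2r.
  have h2 : (r2 * p < p' * p)%N by rewrite ltn_pmul2r.
  have h3 : (w.2.1.+1 * (p * p') <= X * (p * p'))%N by rewrite leq_mul2r j1 orbT.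
  have h4 : (w.2.2.+1 * (p * p') <= X * (p * p'))%N by rewrite leq_mul2r j2 orbT.
  move: (w.2.1 : nat) (w.2.2 : nat) h3 h4 => j j' h3 h4.
  have -> : (s * p + r1)%N%:Z * p'%:Z - (s' * p' + r2)%N%:Z * p%:Z -
     (s%:Z + j'%:Z - s'%:Z - j%:Z) * p%:Z * p'%:Z =
     (r1 * p' + j * (p * p'))%N%:Z - (r2 * p + j' * (p * p'))%N%:Z.
    by rewrite !(PoszD, PoszM); ring.
  rewrite -mulnA in h1 h2 h3 h4 *; lia.
have XK : (2 * (X * p * p') <= K * q)%N.
  apply: leq_trans Kq; have : (p * p' <= P.*2 * P.*2)%N.
    by apply: leq_mul; apply: ltnW; [case/andP: pP|case/andP: pP'].
  rewrite -muln2 => H; have := leq_mul (leqnn (2 * X)) H; lia.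
pose A := - (X * p * p')%N%:Z - N0%:Z * (p'%:Z - p%:Z).
have q0' : 0 < q%:Z by [].
have E : A = lo * q%:Z + (A %% q%:Z)%Z by exact: divz_eq.
have rhoq : (A %% q%:Z)%Z < q%:Z by exact: ltz_pmod.
have rho0 : 0 <= (A %% q%:Z)%Z by apply: modz_ge0; rewrite gt_eqF.
move: E rhoq rho0; rewrite {1}/A; move: (A %% q%:Z)%Z => rho E rhoq rho0.
move: main XK E; clear -q0' rhoq rho0.
move: (tau w) lo (N0%:Z * _) (X * p * p')%N => t l Y Z main XK E.
apply/andP; split.
  have : l < t by rewrite -(ltr_pM2l q0') [_ * l]mulrC; lia.
  lia.
rewrite -(ltr_pM2l q0') !mulrBr mulr1 [_ * l]mulrC; lia.
Qed.

(** With g = gcd(p, p'), tau determines a modulo p / g, and the quotient of a by p / g takes g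
    values. Once a and j are fixed, a' is known modulo p' and j' modulo q, and both are smaller than
    these moduli. *)
Lemma card_colliding : (#|colliding| <= K * X * gcdn p p')%N.
Proof.
have p0 : (0 < p)%N by case/andP: pP => /(leq_trans P0).
have p'0 : (0 < p')%N by case/andP: pP' => /(leq_trans P0).
set g := gcdn p p'; have g0 : (0 < g)%N by rewrite gcdn_gt0 p0.
pose m := (p %/ g)%N.
have pE : p = (m * g)%N by rewrite /m divnK // dvdn_gcdl.
have m0 : (0 < m)%N by move: p0; rewrite pE muln_gt0 => /andP[].
case: (pickP colliding) => [w0 cw0|e0]; last by rewrite eq_card0.
have K0 : (0 < K)%N by have := tau_bound cw0; case: (K) => //; lia.
pose f (w : 'I_P.*2 * 'I_P.*2 * ('I_X * 'I_X)) : 'I_K.-1.+1 * 'I_g.-1.+1 * 'I_X :=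
  (inord (absz (tau w - lo - 1)%R), inord (w.1.1 %/ m), w.2.1).
suff f_inj : {in colliding &, injective f}.
  rewrite -(card_in_imset f_inj); apply: leq_trans (max_card _) _.
  by rewrite !card_prod !card_ord !prednK // mulnAC.
move=> [[a1 a1'] [j1 j1']] [[a2 a2'] [j2 j2']]; rewrite !unfold_in => c1 c2.
have t1 := tau_bound c1; have t2 := tau_bound c2; have d1 := delE c1; have d2 := delE c2.
case/and3P: c1 => /= a1p a1p' _; case/and3P: c2 => /= a2p a2p' _.
case=> /(congr1 val) /= + /(congr1 val) /= + j12.
have dm (a : nat) : (a < p)%N -> (a %/ m < g.-1.+1)%N by move=> ap; rewrite prednK // ltn_divLR // mulnC -pE.
rewrite !inordK ?dm //; [|rewrite prednK //; lia|rewrite prednK //; lia].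
move=> E1 E2; have {E1} tE : tau (a1, a1', (j1, j1')) = tau (a2, a2', (j2, j2')).
  by move: (tau _) (tau _) t1 t2 E1 => t t' /andP[t1 _] /andP[t2 _]; lia.
subst j2; rewrite /tau /= in tE.
set D1 := del _ in tE d1; set D2 := del _ in tE d2.
pose n := (p' %/ g)%N.
have pE' : p' = (n * g)%N by rewrite /n divnK // dvdn_gcdr.
have cop : coprimez m n.
  rewrite /coprimez /gcdz !absz_nat; apply/eqP; congr Posz; apply/eqP.
  by rewrite -(eqn_pmul2r g0) mul1n muln_gcdl -pE -pE'.
have Ea : (a1%:Z - a2%:Z) * n%:Z = (a1'%:Z - a2'%:Z + (D1 - D2) * p'%:Z) * m%:Z.
  have gn0 : g%:Z != 0 by rewrite eqz_nat -lt0n.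
  apply: (mulIf gn0); move: tE; rewrite pE pE' !PoszM => tE.
  move/eqP: tE; rewrite -subr_eq0 => /eqP tE.
  by apply/eqP; rewrite -subr_eq0 -[X in _ == X]tE; apply/eqP; ring.
have : (m%:Z %| a1%:Z - a2%:Z)%Z.
  by rewrite -(Gauss_dvdzl _ cop) Ea dvdz_mull.
rewrite -eqz_mod_dvd !modz_nat eqz_nat => /eqP am.
have a12 : a1 = a2 :> nat by rewrite (divn_eq a1 m) (divn_eq a2 m) E2 am.
have {}Ea : a1'%:Z - a2'%:Z + (D1 - D2) * p'%:Z = 0.
  have mn0 : m%:Z != 0 by rewrite eqz_nat -lt0n.
  by apply: (mulIf mn0); rewrite -Ea a12 subrr !mul0r.
have a12' : a1' = a2' :> nat.
  have : (p'%:Z %| a1'%:Z - a2'%:Z)%Z.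
    by apply/dvdzP; exists (D2 - D1); apply/eqP; rewrite -subr_eq0 -[X in _ == X]Ea; apply/eqP; ring.
  by rewrite -eqz_mod_dvd !modz_nat eqz_nat !modn_small // => /eqP.
have j12' : j1' = j2' :> nat.
  have : (q%:Z %| j1'%:Z - j2'%:Z)%Z.
    by apply/dvdzP; exists (D1 - D2); rewrite mulrBl -d1 -d2 /= a12 a12'; ring.
  rewrite -eqz_mod_dvd !modz_nat eqz_nat !modn_small => [/eqP//||]; exact: leq_trans Xq.
by congr (_, _, (_, _)); apply: val_inj.
Qed.
End Pair.
End Collisions.

(** * Sums of gcds, and splitting a sum by residues *)

Lemma dvdn_pred_count g P : (0 < P)%N ->
  (\sum_(i < P) (g %| P + i) <= P.*2 %/ g)%N.
Proof.
move=> P0; rewrite divn_count_dvd.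
have -> : (\sum_(i < P) (g %| P + i) = \sum_(P <= k < P.*2) (g %| k))%N.
  rewrite -[X in (\sum_(X <= _ < _) _)%N]add0n big_addn -addnn addnK big_mkord.
  by apply: eq_bigr => i _; rewrite addnC.
rewrite (@big_cat_nat _ _ _ P 1 P.*2.+1) //= ?leq_addl; last by rewrite -addnn leqW // leq_addr.
rewrite (@big_cat_nat _ _ _ P.*2 P P.*2.+1) //=; last by rewrite -addnn leq_addr.
by rewrite addnCA leq_addr.
Qed.

(** The gcd is at most the sum of all common divisors g, and g divides at most 2 P / g elements of
    [P, 2 P); what remains is the sum of g (2 P / g)^2. *)
Lemma sum_gcdn_le (R : realType) P : (0 < P)%N ->
  (\sum_(i < P) \sum_(k < P) gcdn (P + i) (P + k))%N%:R <=
  4 * P%:R ^+ 2 * harmonic_sum R P.*2.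
Proof.
move=> P0.
have le (i k : 'I_P) : (gcdn (P + i) (P + k) <=
   \sum_(1 <= g < P.*2) g * ((g %| P + i) * (g %| P + k)))%N.
  have g0 : (0 < gcdn (P + i) (P + k))%N by rewrite gcdn_gt0 addn_gt0 P0.
  have gP : (gcdn (P + i) (P + k) < P.*2)%N.
    apply: (@leq_ltn_trans (P + i)); first by rewrite dvdn_leq ?dvdn_gcdl // addn_gt0 P0.
    by rewrite -addnn ltn_add2l.
  rewrite (bigD1_seq (gcdn (P + i) (P + k))) ?iota_uniq ?mem_index_iota ?g0 //=.
  by rewrite dvdn_gcdl dvdn_gcdr muln1 leq_addr.
apply: le_trans (_ : (\sum_(1 <= g < P.*2) g * ((P.*2 %/ g) * (P.*2 %/ g)))%N%:R <= _).
  rewrite ler_nat.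
  apply: (@leq_trans (\sum_(1 <= g < P.*2) \sum_(i < P) \sum_(k < P) g * ((g %| P + i) * (g %| P + k)))%N).
    rewrite [X in (_ <= X)%N]exchange_big /=; apply: leq_sum => i _.
    by rewrite [X in (_ <= X)%N]exchange_big /=; apply: leq_sum => k _.
  apply: leq_sum => g _.
  have -> : (\sum_(i < P) \sum_(k < P) g * ((g %| P + i) * (g %| P + k)) =
      g * ((\sum_(i < P) (g %| P + i)) * (\sum_(k < P) (g %| P + k))))%N.
    by rewrite big_distrlr big_distrr; apply: eq_bigr => i _; rewrite big_distrr.
  by rewrite leq_mul2l leq_mul ?orbT // dvdn_pred_count.
rewrite natr_sum /harmonic_sum mulr_sumr; apply: ler_sum_nat => g /andP[g1 gP].
have g0 : 0 < g%:R :> R by rewrite ltr0n.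
rewrite ler_pdivlMr // -natrX -!natrM ler_nat.
have := leq_trunc_div P.*2 g; move: (P.*2 %/ g)%N => t.
rewrite -muln2 => H; have := leq_mul H H; nia.
Qed.

Lemma dvdn_sum_unique (p q M : nat) : (0 < p)%N -> coprime p q ->
  (\sum_(a < p) (p %| M + a * q) = 1)%N.
Proof.
move=> p0 cpq.
pose f (a : 'I_p) : 'I_p := Ordinal (ltn_pmod (M + a * q) p0).
have f_inj : injective f.
  move=> a a' /(congr1 val) /= /eqP; rewrite eqn_modDl => E; apply: val_inj.
  wlog le : a a' E / (a <= a')%N.
    by move=> W; case: (leqP a a') => [/W|/ltnW /W H]; [apply | apply/esym/H; rewrite eq_sym].
  move: E; rewrite eq_sym eqn_mod_dvd ?leq_mul2r ?le ?orbT // -mulnBl Gauss_dvdl // => /dvdn_leq H.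
  apply/eqP; rewrite eqn_leq le /= -subn_eq0 -leqn0 leqNgt; apply/negP => /H.
  by rewrite leqNgt (leq_ltn_trans _ (ltn_ord a')) // leq_subr.
have -> : (\sum_(a < p) (p %| M + a * q) = \sum_(a < p) (f a == Ordinal p0))%N by [].
have <- : (\sum_(b < p) (b == Ordinal p0) = \sum_(a < p) (f a == Ordinal p0))%N.
  by rewrite (reindex_inj f_inj).
rewrite (bigD1 (Ordinal p0)) //= big1 // => b.
by rewrite -val_eqE /= => /negPf ->.
Qed.

Lemma sum_progression (A : nmodType) (G : nat -> A) (p B H : nat) : (0 < p)%N ->
  \sum_(1 <= n < H.+1) G n *+ (p %| B + n) =
  \sum_((B %/ p).+1 <= m < ((B + H) %/ p).+1) G (p * m - B)%N.
Proof.
move=> p0; elim: H => [|H IH]; first by rewrite addn0 !big_geq.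
rewrite big_nat_recr //= IH addnS divnS //.
case: (boolP (p %| (B + H).+1)%N) => [/dvdnP[c cE]|_]; last by rewrite mulr0n addr0 add0n.
have E : (1 + (B + H) %/ p = c)%N by rewrite -(mulnK c p0) -cE divnS // cE dvdn_mull.
rewrite mulr1n [in RHS]big_nat_recr /=; last by rewrite add1n ltnS leq_div2r // leq_addr.
rewrite E mulnC -cE -addnS addKn; congr (_ + _).
by rewrite -E.
Qed.

Lemma sum_split_residue (A : nmodType) (G : nat -> A) (p q N0 H : nat) :
  (0 < p)%N -> coprime p q ->
  \sum_(1 <= n < H.+1) G n = \sum_(a < p)
    \sum_(((N0 + a * q) %/ p).+1 <= m < ((N0 + a * q + H) %/ p).+1) G (p * m - (N0 + a * q))%N.
Proof.
move=> p0 cpq; under [RHS]eq_bigr do rewrite -sum_progression //.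
rewrite exchange_big /=; apply: eq_bigr => n _.
rewrite sumrMnr; under eq_bigr do rewrite addnAC.
by rewrite dvdn_sum_unique.
Qed.

(** * Burgess's inequality *)

Section Burgess.
Variable R : realType.
Variable F : finFieldType.
Hypothesis qF : #|F| \in [pchar F].
Variable chi : F -> R[i].
Hypotheses (chiM : {morph chi : x y / x * y}) (chi1 : chi 1 = 1) (chi0 : chi 0 = 0).
Variable b0 : F.
Hypotheses (b0n0 : b0 != 0) (chib : chi b0 != 1).
Local Notation q := #|F|.
Variables (r d N0 P X K H : nat) (g : {poly R}).
Hypotheses (r0 : (0 < r)%N) (d0 : (0 < d)%N).
Hypotheses (N0q : (N0 < q)%N) (P0 : (0 < P)%N) (P2q : (P.*2 <= q)%N).
Hypotheses (X0 : (0 < X)%N) (Lq : (X.*2 < q)%N) (Kq : (8 * X * P ^ 2 <= K * q)%N).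
Hypotheses (HPX : (H <= P * X)%N) (sg : (size g <= d.+1)%N).

Local Notation L := X.*2.
Local Notation coefF := (coef chi).

Definition mixed_sum : R[i] := \sum_(1 <= n < H.+1) e g.[n%:R] * chi (N0 + n)%:R.
Local Notation B := ((1 + 16 * (d * 2 ^ d)%:R) * (1 + 4 * harmonic_sum R (modulus r L 0))).
Local Notation V := (fun x => grid_max r d L (coefF x)).
Local Notation Y := ('I_P * 'I_P.*2 * 'I_X)%type.
Definition admissible (y : Y) : bool := (y.1.2 < P + y.1.1)%N.
Definition base (y : Y) : F := base_pt F N0 (P + y.1.1) y.1.2 y.2.

Let q_prime : prime q := pcharf_prime qF.

(** The factor chi(p) has modulus at most 1 and drops out. Since H <= P X <= p X, each inner sum has
    at most X terms; shifted by j < X they lie in [1, 2 X], which is why L is [X.*2]. *)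
Lemma mixed_sum_le (i : 'I_P) (j : 'I_X) :
  cabs mixed_sum <= \sum_(a < P + i) B * V (base_pt F N0 (P + i) a j).
Proof.
set p := (P + i)%N.
have p0 : (0 < p)%N by rewrite addn_gt0 P0.
have pq : (p < q)%N by apply: leq_trans P2q; rewrite -addnn ltn_add2l.
have cpq : coprime p q.
  by rewrite coprime_sym prime_coprime // gtnNdvd.
rewrite /mixed_sum (sum_split_residue _ N0 _ p0 cpq).
apply: le_trans (ler_cabs_sum _ _ _) _; apply: ler_sum => a _.
set Bs := (N0 + a * q)%N; set s := (Bs %/ p)%N; set s' := ((Bs + H) %/ p)%N.
have ss' : (s <= s')%N by rewrite leq_div2r // leq_addr.
have s'X : (s' <= s + X)%N.
  have HpX : (H <= X * p)%N by apply: leq_trans HPX _; rewrite mulnC leq_mul2l leq_addr orbT.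
  rewrite /s' (leq_trans (leq_div2r p (_ : _ <= Bs + X * p)%N)) ?leq_add2l //.
  by rewrite addnC divnMDl // addnC.
(* Chosen so that [lin] sends k + j + 1 to p m - Bs for m = s + k + 1. *)
pose c : R := p%:R * (s%:R - j%:R) - Bs%:R.
pose lin : {poly R} := p%:R *: 'X + c%:P.
pose gt := g \Po lin.
have sgt : (size gt <= d.+1)%N.
  have slin : (size lin <= 2)%N.
    apply: leq_trans (size_polyD _ _) _; rewrite geq_max (leq_trans (size_scale_leq _ _)) ?size_polyX //.
    exact: leq_trans (size_polyC_leq1 _) _.
  apply: leq_trans (size_comp_poly_leq _ _) _; rewrite ltnS.
  move: slin; case: (size lin) => [|[|[|//]]] _ /=; rewrite ?muln0 ?muln1 //.
  by case: (size g) sg.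
have E : \sum_(s.+1 <= m < s'.+1) e g.[(p * m - Bs)%:R] * chi (N0 + (p * m - Bs))%:R =
   chi p%:R * \sum_(j.+1 <= h < (s' - s + j).+1) e gt.[h%:R] * coefF (base_pt F N0 p a j) h.
  rewrite mulr_sumr.
  rewrite -[s.+1 in LHS]add0n big_addn -[j.+1]add0n big_addn !subSS addnK.
  apply: eq_bigr => k _; set m := (k + s.+1)%N.
  have pm : (Bs <= p * m)%N.
    rewrite ltnW // (leq_trans (ltn_ceil Bs p0)) // mulnC leq_mul2l /m; lia.
  have -> : gt.[(k + j.+1)%:R] = g.[(p * m - Bs)%:R].
    rewrite /gt horner_comp /lin !hornerE /c natrB // natrM /m !natrD; congr g.[_].
    by rewrite -!(natr1, natrD) /=; ring.
  rewrite mulrCA; congr (_ * _); rewrite /coef -chiM; congr chi.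
  have /(congr1 (fun n : nat => n%:R : F)) : (N0 + (p * m - Bs) + a * q = p * m)%N.
    by rewrite /Bs in pm *; lia.
  rewrite natrD natrM (pcharf0 qF) mulr0 addr0 => ->; rewrite natrM; congr (_ * _).
  rewrite /base_pt /floor_pt -/Bs -/s /m !natrD -!natr1; ring.
rewrite E cabsM; apply: le_trans (ler_piMl (cabs_ge0 _) (cabs_char_le1 chiM chi1 chi0 _)) _.
apply: poly_sum_le_grid_max => //; first by rewrite double_gt0.
  by rewrite /= ltnS leq_addl.
have jX := ltn_ord j; rewrite ltnS -addnn; apply: leq_add; last exact: ltnW.
by rewrite leq_subLR.
Qed.

Lemma sum_admissible (A : nmodType) (f : nat -> nat -> nat -> A) :
  \sum_(y | admissible y) f y.1.1 y.1.2 y.2 = \sum_(i < P) \sum_(j < X) \sum_(a < P + i) f i a j.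
Proof.
rewrite big_mkcond -(pair_bigA _ (fun (ia : 'I_P * 'I_P.*2) (j : 'I_X) =>
  if (ia.2 < P + ia.1)%N then f ia.1 ia.2 j else 0)) /=.
rewrite -(pair_bigA _ (fun (i : 'I_P) (a : 'I_P.*2) =>
  \sum_(j < X) if (a < P + i)%N then f i a j else 0)) /=.
apply: eq_bigr => i _; rewrite exchange_big /=; apply: eq_bigr => j _.
rewrite -big_mkcond /= -(big_ord_widen _ (fun a => f i a j)) //.
by rewrite -addnn leq_add2l ltnW.
Qed.

Lemma card_admissible : (#|admissible| <= 2 * P ^ 2 * X)%N.
Proof.
rewrite -sum1_card (sum_admissible (fun _ _ _ => 1%N)).
apply: (@leq_trans (\sum_(i < P) X * P.*2)).
  apply: leq_sum => i _; rewrite -[X in (_ <= X * _)%N]card_ord -sum_nat_const.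
  apply: leq_sum => j _; rewrite sum1_card card_ord -addnn leq_add2l; exact: ltnW.
by rewrite sum_nat_const card_ord -muln2; lia.
Qed.

Lemma card_base_collisions :
  (#|[pred yz : Y * Y | [&& admissible yz.1, admissible yz.2 & base yz.1 == base yz.2]]| <=
   K * X * \sum_(i < P) \sum_(k < P) gcdn (P + i) (P + k))%N.
Proof.
rewrite -sum1_card (partition_big (fun yz : Y * Y => (yz.1.1.1, yz.2.1.1)) xpredT) //=.
rewrite -(pair_bigA _ (fun (i k : 'I_P) => \sum_(yz : Y * Y |
   [&& admissible yz.1, admissible yz.2 & base yz.1 == base yz.2] &&
   ((yz.1.1.1, yz.2.1.1) == (i, k))) 1))%N /=.
rewrite big_distrr; apply: leq_sum => i _; rewrite big_distrr; apply: leq_sum => k _ /=.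
have bd (l : 'I_P) : (P <= P + l < P.*2)%N by rewrite leq_addr -addnn ltn_add2l /=.
have Xq : (X <= q)%N by apply: ltnW; apply: leq_ltn_trans Lq; rewrite -addnn leq_addr.
apply: leq_trans (card_colliding qF N0q P0 P2q X0 Xq Kq (bd i) (bd k)).
rewrite sum1_card.
pose phi (yz : Y * Y) := (yz.1.1.2, yz.2.1.2, (yz.1.2, yz.2.2)).
rewrite -(card_in_imset (f := phi)); last first.
  move=> [[[i1 a1] j1] [[k1 c1] l1]] [[[i2 a2] j2] [[k2 c2] l2]].
  rewrite !unfold_in /= => /andP[_ /eqP[-> ->]] /andP[_ /eqP[-> ->]].
  by move=> [-> -> -> ->].
apply: subset_leq_card; apply/fintype.subsetP => w /imsetP[[[[i1 a1] j1] [[k1 c1] l1]]].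
rewrite !unfold_in /= => /andP[/and3P[A1 A2 A3] /eqP[Ei Ek]] ->.
by rewrite /colliding /phi /=; rewrite /admissible /base /= Ei Ek in A1 A2 A3; rewrite A1 A2 A3.
Qed.

(** The left side arises by adding [mixed_sum_le] over all P X pairs (i, j), which makes room for
    [holder_collisions]. *)
Lemma burgess_inequality :
  ((P * X)%:R * cabs mixed_sum) ^+ (2 * r) <=
  B ^+ (2 * r) * ((2 * P ^ 2 * X)%:R ^+ (2 * r.-1) *
    ((K * X)%:R * (4 * P%:R ^+ 2 * harmonic_sum R P.*2) *
    ((\prod_(j < d) modulus r L j)%:R *
    (q%:R * (r ^ (2 * r) * L.+1 ^ r)%:R + (2 * r)%:R * Num.sqrt q%:R * (J r d (L%:R : R))%:R)))).
Proof.
have V0 x : 0 <= V x by apply: grid_max_ge0.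
have h0 n : 0 <= harmonic_sum R n by apply: sumr_ge0 => k _; rewrite invr_ge0.
have B0 : 0 <= B by rewrite mulr_ge0 // addr_ge0 // mulr_ge0.
have le1 : (P * X)%:R * cabs mixed_sum <= B * \sum_(y | admissible y) V (base y).
  rewrite (sum_admissible (fun i a j => V (base_pt F N0 (P + i) a j))) mulr_sumr.
  rewrite natrM -mulrA.
  apply: le_trans (_ : \sum_(i < P) X%:R * cabs mixed_sum <= _).
    by rewrite sumr_const card_ord mulr_natl.
  apply: ler_sum => i _; rewrite mulr_sumr.
  apply: le_trans (_ : \sum_(j < X) cabs mixed_sum <= _).
    by rewrite sumr_const card_ord mulr_natl.
  by apply: ler_sum => j _; rewrite mulr_sumr; apply: mixed_sum_le.
apply: le_trans (_ : (B * \sum_(y | admissible y) V (base y)) ^+ (2 * r) <= _).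
  by rewrite ler_pXn2r ?muln_gt0 ?r0 // nnegrE mulr_ge0 ?cabs_ge0 ?sumr_ge0.
rewrite exprMn ler_wpM2l ?exprn_ge0 //.
apply: le_trans (holder_collisions _ _ r0 V0) _.
have SV0 : 0 <= \sum_x V x ^+ (2 * r) by apply: sumr_ge0 => x _; rewrite exprn_ge0.
apply: ler_pM; [by rewrite exprn_ge0|by rewrite mulr_ge0|by rewrite lerXn2r ?nnegrE // ler_nat card_admissible|].
apply: ler_pM => //.
- apply: le_trans (_ : (K * X * \sum_(i < P) \sum_(k < P) gcdn (P + i) (P + k))%N%:R <= _).
    by rewrite ler_nat card_base_collisions.
  by rewrite natrM ler_wpM2l // sum_gcdn_le.
by apply: (moment_bound qF chiM chi1 chi0 b0n0 chib); rewrite // double_gt0.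
Qed.
End Burgess.

(** * Choice of parameters *)

Section ChoiceOfX.
Variable R : realType.

Lemma powR_ge1 (a x : R) : 1 <= a -> 0 <= x -> 1 <= a `^ x.
Proof. by move=> a1 x0; rewrite -[leLHS](powRr0 a) ler_powR. Qed.

Lemma harmonic_sum_ln n : (0 < n)%N -> harmonic_sum R n.+1 <= 1 + ln n%:R.
Proof.
case: n => // n _; elim: n => [|n IH].
  by rewrite /harmonic_sum big_nat1 invr1 ln1 addr0.
rewrite /harmonic_sum big_nat_recr //= -/(harmonic_sum R n.+2).
apply: le_trans (lerD IH (lexx _)) _; rewrite -addrA lerD2l.
have n1 : 0 < n.+1%:R :> R by rewrite ltr0n.
have n2 : 0 < n.+2%:R :> R by rewrite ltr0n.
have i1 : -1 < - n.+2%:R^-1 :> R by rewrite ltrN2 invf_lt1 // ltr1n.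
have := le_ln1Dx i1.
have -> : 1 + - n.+2%:R^-1 = n.+1%:R / n.+2%:R :> R.
  have E : n.+2%:R = n.+1%:R + 1 :> R by rewrite natr1.
  move: n2; rewrite E; move: (n.+1%:R) => y y0; field; exact: lt0r_neq0.
rewrite ln_div ?posrE // => H; move: H; by move: (n.+2%:R^-1) (ln _) (ln _) => a b c H; lra.
Qed.

Lemma harmonic_sum_mono m n : (m <= n)%N -> harmonic_sum R m <= harmonic_sum R n.
Proof.
move=> mn; rewrite /harmonic_sum; have [m1|m1] := leqP m 1.
  by rewrite big_geq // sumr_ge0 // => k _; rewrite invr_ge0.
rewrite (@big_cat_nat _ _ _ m 1 n) //=; last exact: ltnW.
by rewrite lerDl sumr_ge0 // => k _; rewrite invr_ge0.
Qed.

Lemma harmonic_sum_powR (eta : R) : 0 < eta ->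
  exists C : R, 1 <= C /\
    forall n, (0 < n)%N -> 1 + 4 * harmonic_sum R n <= C * n%:R `^ eta.
Proof.
move=> eta0; exists (5 + 4 / eta); split.
  have : 0 <= 4 / eta by rewrite divr_ge0 // ltW.
  lra.
move=> n n0; have n1 : 1 <= n%:R :> R by rewrite ler1n.
have n00 : 0 < n%:R :> R by rewrite ltr0n.
have h1 : harmonic_sum R n <= 1 + ln n%:R.
  by apply: le_trans (harmonic_sum_ln n0); apply: harmonic_sum_mono.
have l1 : ln (n%:R : R) <= n%:R `^ eta / eta.
  rewrite ler_pdivlMr // mulrC -ln_powR; apply/ltW/ln_sublinear; exact: powR_gt0.
have p1 : 1 <= n%:R `^ eta by rewrite powR_ge1 // ltW.
move: h1 l1 p1; move: (_ `^ _) (harmonic_sum _ _) (ln _) => z h l h1 l1 p1.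
have -> : (5 + 4 / eta) * z = 5 * z + 4 * (z / eta) by ring.
move: l1; move: (z / eta) => w l1; lra.
Qed.

(** Bookkeeping with r = k + 1: division by (p x)^(2r) leaves p^(2k) x^(D + k). *)
Lemma combine_powers (k D d : nat) (c1 Lam p x s Q U c2 rr : R) :
  0 < p -> 0 < x ->
  (p * x * s) ^+ (2 * k.+1) <=
   (c1 * Lam) ^+ (2 * k.+1) * ((2 * p ^+ 2 * x) ^+ (2 * k) *
     ((144 * x) * (4 * p ^+ 2 * Lam) * ((rr ^+ d * (2 * x) ^+ D) * (Q * ((2 * x) ^+ k.+1 * (c2 * U)))))) ->
  s ^+ (2 * k.+1) <= (c1 ^+ (2 * k.+1) * 4 ^+ k * 576 * rr ^+ d * 2 ^+ D * 2 ^+ k.+1 * c2) *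
     (Lam ^+ (2 * k.+1).+1 * U * Q) * (p ^+ (2 * k) * x ^+ (D + k)).
Proof.
move=> p0 x0 H.
have px0 : 0 < p ^+ (2 * k.+1) * x ^+ (2 * k.+1) by rewrite mulr_gt0 ?exprn_gt0.
rewrite -(ler_pM2l px0); apply: le_trans (le_trans H _).
  by rewrite !exprMn.
rewrite le_eqVlt; apply/orP; left; apply/eqP.
have e1 (z : R) : z ^+ (2 * k.+1) = (z ^+ k) ^+ 2 * z ^+ 2.
  by rewrite mulnS exprD mulrC mulnC exprM.
have e2 (z : R) : z ^+ (2 * k) = (z ^+ k) ^+ 2 by rewrite mulnC exprM.
have e4 : 4 ^+ k = (2 ^+ k) ^+ 2 :> R.
  by rewrite -exprM mulnC exprM; congr (_ ^+ _); rewrite expr2; lra.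
rewrite [Lam ^+ _.+1]exprSr !e1 !e2 e4 !exprMn ![_ ^+ k.+1]exprS exprD.
move: (p ^+ k) (x ^+ k) (2 ^+ k) (c1 ^+ k) (Lam ^+ k) (rr ^+ d) (2 ^+ D) (x ^+ D) => pk xk tk ck lk rd tD xD.
ring.
Qed.

Lemma expnS_leq_expn2 n m : (0 < n)%N -> (n.+1 ^ m <= 2 ^ m * n ^ m)%N.
Proof.
move=> n0; rewrite -expnMn; case: m => // m.
by rewrite leq_exp2r // mul2n -addnn -addn1 leq_add2l.
Qed.

Lemma triangularS d : triangular d.+1 = (triangular d + d.+1)%N.
Proof.
rewrite /triangular; have -> : (d.+1 * d.+2 = d.+1 * 2 + d * d.+1)%N by lia.
by rewrite divnMDl // addnC.
Qed.

Lemma prod_modulus r d L : (\prod_(j < d) modulus r L j = r ^ d * L ^ triangular d)%N.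
Proof.
elim: d => [|d IH]; first by rewrite big_ord0.
by rewrite big_ord_recr /= IH triangularS /modulus mulnACA expnD [(r ^ d.+1)%N]expnSr.
Qed.

Hypothesis HJ : vinogradov_mean_value_bound R.

(** With X0 = q^(1/(2(r - D))) one has X0^(r - D) = q^(1/2), so both parts of the moment have the
    same size. X is X0 rounded up and P about H1 / X, so P X0 <= 3 H because X0 <= H; smaller H are
    left to the trivial bound. *)
Lemma burgess_large (r d : nat) (eps : R) : (0 < d)%N -> (triangular d < r)%N -> 0 < eps ->
  exists C : R, 1 <= C /\
    forall (F : finFieldType) (qF : #|F| \in [pchar F]) (chi : F -> R[i])
      (chiM : {morph chi : x y / x * y}) (chi1 : chi 1 = 1) (chi0 : chi 0 = 0)
      (b : F) (b0 : b != 0) (chib : chi b != 1) (N0 H1 : nat) (g : {poly R}) (H : R),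
    (36 <= #|F|)%N -> (N0 < #|F|)%N -> (size g <= d.+1)%N ->
    H1%:R <= 2 * H -> #|F|%:R `^ (2 * (r%:R - (triangular d)%:R))^-1 <= H ->
    H < #|F|%:R `^ (1 / 2 + 1 / (4 * (r%:R - (triangular d)%:R))) ->
    cabs (mixed_sum chi N0 H1 g) <= C * H `^ (1 - 1 / r%:R) *
      #|F|%:R `^ ((r%:R + 1 - (triangular d)%:R) / (4 * r%:R * (r%:R - (triangular d)%:R)) + eps).
Proof.
case: r => // k d0 Dr eps0; set r := k.+1; set D := triangular d.
have r0 : (0 < r)%N by [].
have [CJ [CJ0 HCJ]] := HJ r0 d0 eps0.
have eta0 : 0 < eps / 4 by lra.
have [C1 [C11 HC1]] := harmonic_sum_powR eta0.
pose de := (r - D)%N.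
have de0 : (0 < de)%N by rewrite subn_gt0.
have deE : r%:R - D%:R = de%:R :> R by rewrite natrB // ltnW.
have deR : 0 < de%:R :> R by rewrite ltr0n.
pose c1 : R := 1 + 16 * (d * 2 ^ d)%:R.
pose c2 : R := (r ^ (2 * r) * 2 ^ r)%:R + 4 * r%:R * CJ * 4 ^+ de.
pose c3 : R := c1 ^+ (2 * r) * 4 ^+ k * 576 * r%:R ^+ d * 2 ^+ D * 2 ^+ r * c2.
pose cL : R := C1 * r%:R `^ (eps / 4).
pose c4 : R := c3 * cL ^+ (2 * r).+1 * (3 ^+ (2 * k) * 2 ^+ (D + k)).
have c10 : 0 <= c1 by rewrite addr_ge0 // mulr_ge0.
have c20 : 0 <= c2 by rewrite addr_ge0 // !mulr_ge0 // ?(ltW CJ0) // exprn_ge0.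
have c30 : 0 <= c3.
  apply: mulr_ge0; last exact: c20.
  do 3 (apply: mulr_ge0; last exact: exprn_ge0).
  apply: mulr_ge0; last exact: ler0n.
  by apply: mulr_ge0; apply: exprn_ge0.
have cL0 : 0 <= cL by rewrite mulr_ge0 ?powR_ge0 // (le_trans ler01).
have c40 : 0 <= c4.
  apply: mulr_ge0; first by apply: mulr_ge0 => //; apply: exprn_ge0.
  by apply: mulr_ge0; apply: exprn_ge0.
exists (1 + c4); split; first by lra.
move=> F qF chi chiM chi1 chi0 b b0 chib N0 H1 g H q36 N0q sg H1H; rewrite deE.
set q := #|F|; set Q : R := q%:R; set X0 := Q `^ _ => X0H HQ.
have Q1 : 1 <= Q by rewrite ler1n; apply: leq_trans q36.
have Q0 : 0 < Q by apply: lt_le_trans Q1.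
have X01 : 1 <= X0 by apply: powR_ge1 => //; rewrite invr_ge0 mulr_ge0 // ltW.
have X00 : 0 < X0 by apply: lt_le_trans X01.
have H0 : 0 < H by apply: lt_le_trans X0H.
have QD (x y : R) : Q `^ x * Q `^ y = Q `^ (x + y) by rewrite powRD // (lt0r_neq0 Q0) implybT.
pose sQ := Q `^ (1 / 2).
have sQ2 : sQ * sQ = Q by rewrite QD -splitr powRr1 // ltW.
have X0de : X0 ^+ de = sQ.
  rewrite -powR_mulrn ?(ltW X00) // /X0 -powRrM; congr (_ `^ _); field; exact: lt0r_neq0.
have X0sQ : X0 <= sQ.
  rewrite -X0de -(prednK de0) exprS ler_peMr ?(ltW X00) //; exact: exprn_ege1.
(* The form in which the upper limit on H is used: it bounds X P^2, of order H^2 / X0, by a multiple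
   of q. *)
have HX0 : H ^+ 2 < Q * X0.
  have -> : Q * X0 = (Q `^ (1 / 2 + 1 / (4 * de%:R))) ^+ 2.
    rewrite expr2 QD -{1}(powRr1 (ltW Q0)) QD; congr (_ `^ _); field; exact: lt0r_neq0.
  by rewrite ltr_pXn2r // nnegrE ltW ?powR_gt0.
have HsQ : H <= X0 * sQ.
  rewrite -(@ler_pXn2r _ 2) ?nnegrE ?mulr_ge0 ?(ltW H0) ?(ltW X00) ?powR_ge0 //.
  apply: le_trans (ltW HX0) _; rewrite exprMn [sQ ^+ 2]expr2 sQ2 mulrC ler_wpM2r ?(ltW Q0) //.
  by rewrite expr2 ler_peMr // ltW.
(* From q >= 36; it yields 2 P <= 6 q^(1/2) <= q and 2 X < q. *)
have sQ6 : 6 <= sQ.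
  rewrite -(@ler_pXn2r _ 2) ?nnegrE ?powR_ge0 // [sQ ^+ 2]expr2 sQ2.
  have : 36%:R <= Q by rewrite ler_nat.
  by rewrite expr2; lra.
pose X := (Num.truncn X0).+1; pose P := (H1 %/ X).+1.
have X0n : (0 < X)%N by [].
have P0n : (0 < P)%N by [].
have xR0 : 0 < X%:R :> R by rewrite ltr0n.
have pR0 : 0 < P%:R :> R by rewrite ltr0n.
have xlo : X0 <= X%:R by rewrite ltW // truncnS_gt.
have xhi : X%:R <= 2 * X0.
  have : (Num.truncn X0)%:R <= X0 by rewrite truncn_le // ltW.
  by rewrite /X -natr1; lra.
have phi : P%:R * X0 <= 3 * H.
  have : (H1 %/ X)%:R * X%:R <= H1%:R :> R by rewrite -natrM ler_nat leq_trunc_div.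
  have : (H1 %/ X)%:R * X0 <= (H1 %/ X)%:R * X%:R by rewrite ler_wpM2l.
  rewrite /P -natr1 mulrDl mul1r; lra.
have HPX : (H1 <= P * X)%N by rewrite ltnW // ltn_ceil.
have psQ : P%:R <= 3 * sQ.
  rewrite -(ler_pM2r X00); apply: le_trans phi _; rewrite -mulrA ler_wpM2l // mulrC //.
have sQ6Q : 6 * sQ <= Q by rewrite -sQ2 ler_wpM2r // powR_ge0.
have P2q : (P.*2 <= q)%N.
  by rewrite -(ler_nat R) -mul2n natrM; apply: le_trans sQ6Q; lra.
have Lq : (X.*2 < q)%N.
  rewrite -(ltr_nat R) -mul2n natrM; apply: lt_le_trans sQ6Q; lra.
(* 144 = 8 * 2 * 9, from X <= 2 X0 and (P X0)^2 <= 9 H^2 < 9 q X0. *)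
have Kq : (8 * X * P ^ 2 <= 144 * q)%N.
  have h1 : (P%:R * X0) ^+ 2 <= (3 * H) ^+ 2.
    by rewrite ler_pXn2r // nnegrE ?mulr_ge0 ?(ltW H0) ?(ltW X00).
  have h2 : X%:R * (P%:R ^+ 2 * X0) <= (2 * X0) * (P%:R ^+ 2 * X0).
    by rewrite ler_wpM2r // mulr_ge0 ?exprn_ge0 ?(ltW X00).
  have E1 : (2 * X0) * (P%:R ^+ 2 * X0) = 2 * (P%:R * X0) ^+ 2 by ring.
  have E2 : (3 * H) ^+ 2 = 9 * H ^+ 2 by ring.
  have E3 : (8 * X * P ^ 2)%N%:R * X0 = 8 * (X%:R * (P%:R ^+ 2 * X0)) by rewrite !natrM expr2; ring.
  have E4 : (144 * q)%N%:R * X0 = 144 * (Q * X0) by rewrite natrM mulrA.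
  rewrite -(ler_nat R) -(ler_pM2r X00) E3 E4.
  move: h1 h2 HX0; rewrite E1 E2; move: (X%:R * _) ((P%:R * X0) ^+ 2) (H ^+ 2) (Q * X0) => a1 a2 a3 a4.
  by clear; lra.
have L0 : (0 < X.*2)%N by rewrite double_gt0.
have := burgess_inequality qF chiM chi1 chi0 b0 chib r0 d0 N0q P0n P2q X0n Lq Kq HPX sg.
set s := cabs _; rewrite -/q => BI.
pose Lam := C1 * (r%:R * Q) `^ (eps / 4); pose U := Q `^ eps.
have U1 : 1 <= U by apply: powR_ge1 => //; exact: ltW.
have C10 : 0 <= C1 by apply: le_trans C11.
have Lam0 : 0 <= Lam by rewrite mulr_ge0 ?powR_ge0.
have harm_le n : (0 < n)%N -> (n <= r * q)%N -> 1 + 4 * harmonic_sum R n <= Lam.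
  move=> n0 nrq; apply: le_trans (HC1 _ n0) _; rewrite ler_wpM2l //.
  apply: ge0_ler_powR; [exact: ltW|by rewrite nnegrE|by rewrite nnegrE mulr_ge0 // ltW|].
  by rewrite /Q -natrM ler_nat.
have h0 n : 0 <= harmonic_sum R n by apply: sumr_ge0 => j _; rewrite invr_ge0.
have LamB : 1 + 4 * harmonic_sum R (modulus r X.*2 0) <= Lam.
  apply: harm_le; first exact: modulus_gt0.
  by rewrite /modulus expn1 leq_mul2l ltnW // orbT.
have LamP : harmonic_sum R P.*2 <= Lam.
  have := harm_le P.*2 _ _; rewrite double_gt0 => /(_ isT) H2.
  have := h0 P.*2; have := H2 (leq_trans P2q (leq_pmull _ r0)); clear; lra.
pose x : R := X%:R; pose p : R := P%:R.
have lE : X.*2%:R = 2 * x :> R by rewrite -mul2n natrM.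
have l1 : 1 <= X.*2%:R :> R by rewrite ler1n.
(* As (2 x)^(r - D) <= 4^(r - D) q^(1/2), the Weil term is of the size of the trivial term q (2
   x)^r, up to q^eps. *)
have last_le : q%:R * (r ^ (2 * r) * X.*2.+1 ^ r)%:R + (2 * r)%:R * Num.sqrt q%:R * (J r d (X.*2%:R : R))%:R
    <= Q * ((2 * x) ^+ r * (c2 * U)).
  have sqE : Num.sqrt q%:R = sQ :> R by rewrite -powR12_sqrt // /sQ div1r.
  have l0 : 0 <= 2 * x by rewrite -lE.
  have lQ : X.*2%:R <= Q by rewrite ler_nat ltnW.
  have l4 : 2 * x <= 4 * X0 by rewrite /x; move: xhi; clear; lra.
  have J1 := HCJ _ l1; rewrite -/D in J1.
  have E1 : X.*2%:R `^ (2 * r%:R - D%:R) = (2 * x) ^+ r * (2 * x) ^+ de :> R.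
    have -> : 2 * r%:R - D%:R = (r + de)%:R :> R by rewrite natrD -deE; ring.
    by rewrite powR_mulrn // lE exprD.
  have E2 : X.*2%:R `^ r%:R = (2 * x) ^+ r :> R by rewrite powR_mulrn // lE.
  have de1 : (2 * x) ^+ de <= 4 ^+ de * sQ.
    by rewrite -X0de -exprMn lerXn2r // nnegrE // mulr_ge0 // ltW.
  have de2 : 1 <= (2 * x) ^+ de by rewrite exprn_ege1 // -lE.
  have lU : X.*2%:R `^ eps <= U by rewrite ge0_ler_powR ?nnegrE ?(ltW Q0) // ltW.
  have lr0 : 0 <= (2 * x) ^+ r by rewrite exprn_ge0.
  have J2 : (J r d (X.*2%:R : R))%:R <= CJ * U * (2 * (2 * x) ^+ r * (4 ^+ de * sQ)).
    apply: le_trans J1 _; rewrite E1 E2; apply: ler_pM.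
    - by rewrite mulr_ge0 ?powR_ge0 // ltW.
    - by rewrite addr_ge0 // mulr_ge0 // (le_trans ler01).
    - by rewrite ler_wpM2l // ltW.
    apply: le_trans (_ : 2 * ((2 * x) ^+ r * (2 * x) ^+ de) <= _).
      by have := ler_peMr lr0 de2; clear; lra.
    by rewrite -mulrA ler_wpM2l // ler_wpM2l.
  have f1 : (r ^ (2 * r) * X.*2.+1 ^ r)%:R <= (r ^ (2 * r) * 2 ^ r)%:R * (2 * x) ^+ r * U.
    apply: le_trans (_ : (r ^ (2 * r) * 2 ^ r)%:R * (2 * x) ^+ r <= _); last first.
      by rewrite ler_peMr // mulr_ge0.
    rewrite -lE -natrX -natrM ler_nat -mulnA leq_mul2l; apply/orP; right; exact: expnS_leq_expn2.
  have f2 : (2 * r)%:R * sQ * (J r d (X.*2%:R : R))%:R <= (2 * r)%:R * sQ * (CJ * U * (2 * (2 * x) ^+ r * (4 ^+ de * sQ))).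
    by rewrite ler_wpM2l // mulr_ge0 ?powR_ge0.
  rewrite sqE; apply: le_trans (lerD (ler_wpM2l (ltW Q0) f1) f2) _.
  rewrite -sQ2 /c2 [(2 * r)%:R]natrM le_eqVlt; apply/orP; left; apply/eqP.
  move: (_ ^+ r) (4 ^+ de) ((r ^ (2 * r) * 2 ^ r)%:R) => a1 a2 a3; ring.
have combined : (p * x * s) ^+ (2 * k.+1) <=
   (c1 * Lam) ^+ (2 * k.+1) * ((2 * p ^+ 2 * x) ^+ (2 * k) *
     ((144 * x) * (4 * p ^+ 2 * Lam) * ((r%:R ^+ d * (2 * x) ^+ D) * (Q * ((2 * x) ^+ k.+1 * (c2 * U)))))).
  have pE : (2 * P ^ 2 * X)%:R = 2 * p ^+ 2 * x :> R by rewrite !natrM.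
  have mE : (\prod_(j < d) modulus r X.*2 j)%:R = r%:R ^+ d * (2 * x) ^+ D :> R.
    by rewrite prod_modulus natrM !natrX lE.
  move: BI; rewrite [(P * X)%:R]natrM pE mE [(144 * X)%:R]natrM => BI; apply: le_trans BI _.
  have p0 : 0 <= p by [].
  have x0 : 0 <= x by [].
  have pw0 : 0 <= (2 * p ^+ 2 * x) ^+ (2 * k) by rewrite exprn_ge0 // mulr_ge0 // mulr_ge0 // exprn_ge0.
  have pr0 : 0 <= r%:R ^+ d * (2 * x) ^+ D by rewrite mulr_ge0 // exprn_ge0 // mulr_ge0.
  have last0 : 0 <= q%:R * (r ^ (2 * r) * X.*2.+1 ^ r)%:R + (2 * r)%:R * Num.sqrt q%:R * (J r d (X.*2%:R : R))%:R :> R.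
    by rewrite addr_ge0 // mulr_ge0 // mulr_ge0 // sqrtr_ge0.
  have B0 : 0 <= (1 + 16 * (d * 2 ^ d)%:R) * (1 + 4 * harmonic_sum R (modulus r X.*2 0)).
    by rewrite mulr_ge0 // addr_ge0 // mulr_ge0.
  have g0 : 0 <= 144 * x * (4 * p ^+ 2 * harmonic_sum R P.*2).
    by rewrite mulr_ge0 ?mulr_ge0 // exprn_ge0.
  have m0 := mulr_ge0 pr0 last0.
  apply: ler_pM; [exact: (exprn_ge0 _ B0)| by rewrite mulr_ge0 // mulr_ge0| |].
    apply: lerXn2r; [by rewrite nnegrE|by rewrite nnegrE; exact: mulr_ge0|exact: ler_wpM2l].
  rewrite ler_wpM2l //; apply: ler_pM => //; last by rewrite ler_wpM2l.
  by rewrite ler_wpM2l ?mulr_ge0 // ler_wpM2l // mulr_ge0 // exprn_ge0.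
have fin := combine_powers pR0 xR0 combined.
have LamE : Lam = cL * Q `^ (eps / 4).
  by rewrite /Lam /cL powRM ?(ltW Q0) // mulrA.
have pH : p <= 3 * H / X0 by rewrite ler_pdivlMr.
have pp : p ^+ (2 * k) * x ^+ (D + k) <=
   3 ^+ (2 * k) * 2 ^+ (D + k) * (H ^+ (2 * k) * (X0 ^+ (D + k) / X0 ^+ (2 * k))).
  apply: le_trans (_ : (3 * H / X0) ^+ (2 * k) * (2 * X0) ^+ (D + k) <= _).
    by apply: ler_pM; rewrite ?exprn_ge0 // lerXn2r // nnegrE ?divr_ge0 ?mulr_ge0 ?(ltW H0) ?(ltW X00).
  by rewrite expr_div_n !exprMn le_eqVlt; apply/orP; left; apply/eqP; ring.
pose E := (r%:R + 1 - D%:R) / (4 * r%:R * de%:R) + eps.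
(* The main exponents agree exactly: with de = r - D, both are 1 + (1 - de) / (2 de). The losses add
   up to eps (r / 2 + 5 / 4), within the allowed 2 r eps. *)
have W_le : (Q `^ (eps / 4)) ^+ (2 * r).+1 * U * Q * (X0 ^+ (D + k) / X0 ^+ (2 * k)) <= (Q `^ E) ^+ (2 * r).
  have QX (y : R) n : (Q `^ y) ^+ n = Q `^ (y * n%:R).
    by rewrite -powR_mulrn ?powR_ge0 // -powRrM.
  rewrite /U /X0 !QX -powRN.
  have -> : forall u v w : R, u * v * Q * w = u * v * Q `^ 1 * w by move=> *; rewrite powRr1 // ltW.
  rewrite !QD ler_powR //.
  have kE : k%:R = r%:R - 1 :> R by rewrite /r -natr1 addrK.
  have rE : r%:R = D%:R + de%:R :> R by rewrite -deE addrC subrK.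
  have r1 : 1 <= r%:R :> R by rewrite ler1n.
  rewrite -[(2 * r).+1%:R]natr1 [(2 * r)%:R]natrM [(2 * k)%:R]natrM natrD kE.
  have -> : E * (2 * r%:R) = 1 + (D%:R - r%:R + 1) / (2 * de%:R) + eps * (2 * r%:R).
    rewrite /E rE; field; rewrite (lt0r_neq0 deR) /= -rE lt0r_neq0 // (lt_le_trans ltr01) //.
  have -> : eps / 4 * (2 * r%:R + 1) + eps + 1 + ((2 * de%:R)^-1 * (D%:R + (r%:R - 1)) - (2 * de%:R)^-1 * (2 * (r%:R - 1)))
     = 1 + (D%:R - r%:R + 1) / (2 * de%:R) + eps * (r%:R / 2 + 5 / 4) :> R.
    by field; exact: lt0r_neq0.
  by rewrite lerD2l ler_wpM2l ?(ltW eps0) //; move: r1; clear; lra.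
have s0 : 0 <= s by apply: cabs_ge0.
have T0 : 0 <= (1 + c4) * H `^ (1 - 1 / r%:R) * Q `^ E.
  by rewrite mulr_ge0 ?powR_ge0 // mulr_ge0 ?powR_ge0 // addr_ge0.
rewrite -(@ler_pXn2r _ (2 * r)) // ?nnegrE //.
apply: le_trans fin _; rewrite -/c3 LamE.
apply: le_trans (_ : c3 * ((cL * Q `^ (eps / 4)) ^+ (2 * r).+1 * U * Q) *
   (3 ^+ (2 * k) * 2 ^+ (D + k) * (H ^+ (2 * k) * (X0 ^+ (D + k) / X0 ^+ (2 * k)))) <= _).
  rewrite ler_wpM2l // mulr_ge0 // mulr_ge0 ?(ltW Q0) // mulr_ge0 ?(le_trans ler01 U1) // exprn_ge0 //.
  by rewrite mulr_ge0 // powR_ge0.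
apply: le_trans (_ : c4 * H ^+ (2 * k) * ((Q `^ (eps / 4)) ^+ (2 * r).+1 * U * Q * (X0 ^+ (D + k) / X0 ^+ (2 * k))) <= _).
  by rewrite exprMn /c4 le_eqVlt; apply/orP; left; apply/eqP; ring.
have HE : (H `^ (1 - 1 / r%:R)) ^+ (2 * r) = H ^+ (2 * k).
  rewrite -powR_mulrn ?powR_ge0 // -powRrM -powR_mulrn ?(ltW H0) //; congr (_ `^ _).
  rewrite !natrM mulrBl mul1r; have -> : k%:R = r%:R - 1 :> R by rewrite /r -natr1 addrK.
  by field; rewrite pnatr_eq0.
have Hk0 : 0 <= H ^+ (2 * k) by rewrite exprn_ge0 // ltW.
rewrite !exprMn HE -/E; apply: ler_pM; [exact: mulr_ge0| |apply: ler_wpM2r => //|exact: W_le].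
  apply: mulr_ge0; last by apply: divr_ge0; apply: exprn_ge0; exact: ltW.
  apply: mulr_ge0; last exact: ltW.
  by apply: mulr_ge0; [apply: exprn_ge0|]; exact: powR_ge0.
apply: le_trans (_ : 1 + c4 <= _); first by rewrite lerDr.
by rewrite ler_eXnr // lerDl.
Qed.
End ChoiceOfX.

(** * Characters on the integers *)

Section CharacterModQ.
Variables (R : realType) (q : nat) (chi : mult_character R q).
Hypothesis qp : prime q.

Definition char_Fp (x : 'F_q) : R[i] := chi (x : nat)%:Z.

Lemma character_add_mul n (k : int) : chi (n + k * q%:Z) = chi n.
Proof.
elim/int_rec: k => [|k IH|k IH]; first by rewrite mul0r addr0.
  by rewrite -[RHS]IH -[RHS]character_periodic -addn1 PoszD mulrDl mul1r addrA.
rewrite -[RHS]IH -[LHS]character_periodic; congr (chi _).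
by rewrite -addn1 PoszD; ring.
Qed.

Lemma character_nat (n : nat) : chi n%:Z = char_Fp n%:R.
Proof.
rewrite /char_Fp (val_Fp_nat qp) {1}(divn_eq n q) PoszD PoszM addrC.
exact: character_add_mul.
Qed.

Lemma char_FpM : {morph char_Fp : x y / x * y}.
Proof.
by move=> x y; rewrite -{1}(natr_Zp x) -{1}(natr_Zp y) -natrM -character_nat PoszM character_mul.
Qed.

Lemma char_Fp1 : char_Fp 1 = 1.
Proof. by rewrite -(character_one chi) -(character_nat 1). Qed.

Lemma char_Fp0 : char_Fp 0 = 0.
Proof.
rewrite -[char_Fp 0](character_nat 0); apply/eqP; rewrite (character_eq0 chi).
rewrite /coprimez gcd0z; have := prime_gt1 qp; case: (q) => [|[|n]] //.
Qed.

(** A difference between chi and the indicator of the units must occur at a unit, since both vanish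
    elsewhere. *)
Lemma nonprincipal_witness : nonprincipal chi -> exists2 b, b != 0 & char_Fp b != 1.
Proof.
move/existsNP => [n nE]; pose m := absz (n %% q%:Z)%Z.
have q0 : q%:Z != 0 by rewrite eqz_nat -lt0n prime_gt0.
have nm : chi n = char_Fp m%:R.
  rewrite -character_nat /m gez0_abs ?modz_ge0 // [in LHS](divz_eq n q%:Z) addrC.
  exact: character_add_mul.
have b1 : char_Fp m%:R != char_Fp 0.
  rewrite char_Fp0 -nm (character_eq0 chi) negbK; apply/negPn/negP => nc; apply: nE.
  by rewrite (negPf nc); apply/eqP; rewrite (character_eq0 chi).
exists m%:R; first by apply: contra_neq b1 => ->.
apply/eqP => E; apply: nE; rewrite nm E.
suff -> : coprimez n q by [].
by apply/negPn; rewrite -(character_eq0 chi) nm E oner_eq0.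
Qed.
End CharacterModQ.

(** Only the integer parts of N and N + H matter; the second alternative covers the empty range,
    which includes negative H. *)
Lemma mixed_character_sum_range (R : realType) (q : nat) (chi : mult_character R q)
    (f : {poly R}) (N H : R) (M : nat) :
  (Num.floor N + M%:Z = Num.floor (N + H)) \/ (Num.floor (N + H) <= Num.floor N /\ M = 0%N) ->
  mixed_character_sum chi f N H =
  \sum_(1 <= k < M.+1) e f.[(Num.floor N + k%:Z)%:~R] * chi (Num.floor N + k%:Z).
Proof.
move=> HM; pose s := [seq Num.floor N + k%:Z | k <- index_iota 1 M.+1].
have us : uniq s by rewrite map_inj_uniq ?iota_uniq // => a b /addrI [].
rewrite /mixed_character_sum.
have -> : [set n : int | N < n%:~R <= N + H]%classic = [set` s]%classic.
  apply/seteqP; split => n /=; rewrite -floor_lt_int -floor_ge_int.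
    move=> /andP[n1 n2]; apply/mapP; exists (absz (n - Num.floor N)).
      rewrite mem_index_iota; move: HM n1 n2 {us} @s.
      move: (Num.floor N) (Num.floor (N + H)) => u v HM n1 n2.
      by case: HM => [|[]]; lia.
    by rewrite gez0_abs ?subr_ge0 ?ltW // [RHS]addrC subrK.
  move=> /mapP[k]; rewrite mem_index_iota => /andP[k1 k2] ->.
  move: HM k1 k2; move: (Num.floor N) (Num.floor (N + H)) => u v HM k1 k2.
  by case: HM => [|[]]; lia.
by rewrite -(fsbig_seq _ _ us) big_map.
Qed.

(** * Removing the lower bounds on q and H, and uniformity in d *)

Section Main.
Variable R : realType.
Hypothesis HJ : vinogradov_mean_value_bound R.

Lemma cabs_mixed_sum_le (F : finFieldType) (chi : F -> R[i]) N0 M (g : {poly R}) :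
  {morph chi : x y / x * y} -> chi 1 = 1 -> chi 0 = 0 ->
  cabs (mixed_sum chi N0 M g) <= M%:R.
Proof.
move=> chiM chi1 chi0; apply: le_trans (ler_cabs_sum _ _ _) _.
apply: le_trans (_ : \sum_(1 <= n < M.+1) 1 <= _).
  by apply: ler_sum => n _; rewrite cabsM cabs_e mul1r cabs_char_le1.
by rewrite big_const_nat iter_addr_0 subn1.
Qed.

(** For q < 36 the sum is at most 2 H <= 2 q, whence the 72. For H below X0 = q^(1/(2(r - D))) the
    trivial bound suffices: H^(1/r) <= X0^(1/r), and the main exponent of the statement is that of
    X0^(1/r) times (r - D + 1) / 2 >= 1. *)
Lemma burgess_bound (r d : nat) (eps : R) : (0 < d)%N -> (triangular d < r)%N -> 0 < eps ->
  exists C : R, 1 <= C /\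
    forall (F : finFieldType) (qF : #|F| \in [pchar F]) (chi : F -> R[i])
      (chiM : {morph chi : x y / x * y}) (chi1 : chi 1 = 1) (chi0 : chi 0 = 0)
      (b : F) (b0 : b != 0) (chib : chi b != 1) (N0 M : nat) (g : {poly R}) (H : R),
    (N0 < #|F|)%N -> (size g <= d.+1)%N -> 1 <= H -> M%:R <= 2 * H ->
    H < #|F|%:R `^ (1 / 2 + 1 / (4 * (r%:R - (triangular d)%:R))) ->
    cabs (mixed_sum chi N0 M g) <= C * H `^ (1 - 1 / r%:R) *
      #|F|%:R `^ ((r%:R + 1 - (triangular d)%:R) / (4 * r%:R * (r%:R - (triangular d)%:R)) + eps).
Proof.
move=> d0 Dr eps0; have [C [C1 HC]] := burgess_large HJ d0 Dr eps0.
have r0 : (0 < r)%N by apply: leq_ltn_trans Dr.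
have rR : 0 < r%:R :> R by rewrite ltr0n.
have r1 : 1 <= r%:R :> R by rewrite ler1n.
exists (72 + C); split; first by lra.
move=> F qF chi chiM chi1 chi0 b b0 chib N0 M g H N0q sg H1 MH HQ.
have Q1 : 1 <= #|F|%:R :> R by rewrite ler1n ltnW // finNzRing_gt1.
set E := (_ + 1 - _) / _.
have deE : r%:R - (triangular d)%:R = (r - triangular d)%N%:R :> R by rewrite natrB // ltnW.
set de := (r - triangular d)%N in deE.
have de1 : 1 <= de%:R :> R by rewrite ler1n subn_gt0.
have EE : E = (de%:R + 1) / (4 * r%:R * de%:R) by rewrite /E -deE; congr (_ / _); ring.
have E0 : 0 <= E by rewrite EE divr_ge0 // ?mulr_ge0 // ?addr_ge0 // ltW.
have h1 : 1 <= H `^ (1 - 1 / r%:R).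
  by apply: powR_ge1 => //; rewrite subr_ge0 ler_pdivrMr // mul1r.
have h2 : 1 <= #|F|%:R `^ (E + eps) :> R by apply: powR_ge1 => //; rewrite addr_ge0 // ltW.
have h0 : 0 <= H `^ (1 - 1 / r%:R) * #|F|%:R `^ (E + eps) by rewrite mulr_ge0 ?powR_ge0.
have triv := le_trans (cabs_mixed_sum_le N0 M g chiM chi1 chi0) MH.
rewrite -mulrA.
have [q36|q36] := leqP 36 #|F|; last first.
  apply: le_trans triv _; apply: le_trans (_ : 72 * 1 <= _); last first.
    by apply: ler_pM => //; [rewrite lerDl (le_trans ler01)|exact: mulr_ege1].
  have : H <= #|F|%:R.
    apply: le_trans (ltW HQ) _; rewrite -[leRHS]powRr1 ?(le_trans ler01) // ler_powR // deE.
    have : 1 / (4 * de%:R) <= 1 / 4 :> R by rewrite !div1r lef_pV2 ?posrE; move: de1; clear; lra.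
    by lra.
  have : #|F|%:R <= 36%:R :> R by rewrite ler_nat ltnW.
  by lra.
have [X0H|HX0] := leP (#|F|%:R `^ (2 * (r%:R - (triangular d)%:R))^-1) H.
  apply: le_trans (HC F qF chi chiM chi1 chi0 b b0 chib N0 M g H q36 N0q sg MH X0H HQ) _.
  by rewrite -/E -mulrA ler_wpM2r //; lra.
apply: le_trans triv _; apply: le_trans (_ : 2 * (H `^ (1 - 1 / r%:R) * #|F|%:R `^ (E + eps)) <= _); last first.
  by rewrite ler_wpM2r //; lra.
rewrite ler_wpM2l //.
have H0 : 0 <= H by apply: le_trans H1.
have HE : H = H `^ (1 - 1 / r%:R) * H `^ (1 / r%:R).
  rewrite -powRD ?subrK ?powRr1 //; apply/implyP => _.
  by rewrite gt_eqF // (lt_le_trans ltr01).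
rewrite {1}HE ler_wpM2l ?powR_ge0 //.
apply: le_trans (_ : (#|F|%:R `^ (2 * (r%:R - (triangular d)%:R))^-1) `^ (1 / r%:R) <= _).
  by apply: ge0_ler_powR; rewrite ?nnegrE ?powR_ge0 ?divr_ge0 // ltW.
rewrite -powRrM ler_powR // deE EE.
have -> : (de%:R + 1) / (4 * r%:R * de%:R) = (2 * de%:R)^-1 * (1 / r%:R) * ((de%:R + 1) / 2) :> R.
  by field; rewrite !gt_eqF // (lt_le_trans ltr01).
apply: le_trans (_ : (2 * de%:R)^-1 * (1 / r%:R) * ((de%:R + 1) / 2) <= _); last by rewrite lerDl ltW.
rewrite ler_peMr // ?ler_pdivlMr //; lra.
Qed.
End Main.

(* For H < 1 and N not an integer the sum can be a single term of modulus 1,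
   while the bound tends to 0 with H; hence the last hypothesis, which covers
   every real H when N is an integer, and every real N when H >= 1. *)
Theorem theorem1p3 (R : realType) (HJ : vinogradov_mean_value_bound R)
    (r : nat) (eps : R) (eps_gt0 : 0 < eps) :
  exists C : R, 0 < C /\
    forall (d q : nat) (chi : mult_character R q) (f : {poly R}) (N H : R),
      (1 <= d)%N -> prime q -> nonprincipal chi -> size f = d.+1 ->
      (triangular d < r)%N ->
      H < q%:R `^ (1 / 2 + 1 / (4 * (r%:R - (triangular d)%:R))) ->
      N \is a Num.int \/ 1 <= H ->
      `|mixed_character_sum chi f N H| <=
        (C * H `^ (1 - 1 / r%:R) *
         q%:R `^ ((r%:R + 1 - (triangular d)%:R) /
                  (4 * r%:R * (r%:R - (triangular d)%:R)) + eps))%:C.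
Proof.
have /boolp.choice[Cf HCf] : forall d : nat, exists C : R, 1 <= C /\
  ((0 < d)%N -> (triangular d < r)%N ->
    forall (F : finFieldType) (qF : #|F| \in [pchar F]) (chi : F -> R[i])
      (chiM : {morph chi : x y / x * y}) (chi1 : chi 1 = 1) (chi0 : chi 0 = 0)
      (b : F) (b0 : b != 0) (chib : chi b != 1) (N0 M : nat) (g : {poly R}) (H : R),
    (N0 < #|F|)%N -> (size g <= d.+1)%N -> 1 <= H -> M%:R <= 2 * H ->
    H < #|F|%:R `^ (1 / 2 + 1 / (4 * (r%:R - (triangular d)%:R))) ->
    cabs (mixed_sum chi N0 M g) <= C * H `^ (1 - 1 / r%:R) *
      #|F|%:R `^ ((r%:R + 1 - (triangular d)%:R) / (4 * r%:R * (r%:R - (triangular d)%:R)) + eps)).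
  move=> d; have [d0|d0] := ltnP 0 d; last by exists 1; split => // /leq_ltn_trans -/(_ _ d0); rewrite ltnn.
  have [Dr|Dr] := ltnP (triangular d) r; last by exists 1; split.
  by have [C [C1 HC]] := burgess_bound HJ d0 Dr eps_gt0; exists C; split.
have Cf0 d : 0 <= Cf d by apply: le_trans (HCf d).1.
(* Since d <= triangular d < r, only finitely many d occur, and adding their constants gives one
   that does not depend on d. *)
exists (1 + \sum_(d < r) Cf d); split; first by rewrite ltr_pwDl // sumr_ge0.
move=> d q chi f N H d0 qp chin sf Dr HQ NH.
rewrite -cabsE lecR.
have C0 : 0 <= 1 + \sum_(d < r) Cf d by rewrite addr_ge0 // sumr_ge0.
(* For H < 1, N is an integer and no integer lies in (N, N + H]. *)
have [H1|H1] := leP 1 H; last first.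
  have Nint : N \is a Num.int by case: NH => // /le_lt_trans -/(_ _ H1); rewrite ltxx.
  have -> : mixed_character_sum chi f N H = 0.
    rewrite (@mixed_character_sum_range _ _ _ _ _ _ 0) ?big_geq //; right; split => //.
    rewrite -ltzD1 floor_lt_int intrD mulr1z.
    have -> : (Num.floor N)%:~R = N by apply/eqP; rewrite -intrEfloor.
    by rewrite ltrD2l.
  by rewrite cabs0 mulr_ge0 ?powR_ge0 // mulr_ge0 ?powR_ge0.
have flo : Num.floor N <= Num.floor (N + H) by apply: le_floor; lra.
pose M := absz (Num.floor (N + H) - Num.floor N).
have ME : Num.floor N + M%:Z = Num.floor (N + H) by rewrite /M gez0_abs ?subr_ge0 // [LHS]addrC subrK.
rewrite (mixed_character_sum_range _ _ (or_introl ME)).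
(* There are at most H + 1 integers in the range, hence at most 2 H since H >= 1. *)
have MH : M%:R <= 2 * H.
  have a1 := floor_le (N + H); have a2 := floorD1_gt N.
  move: a1 a2; rewrite -ME !intrD mulr1z -pmulrn; lra.
have q0 : q%:Z != 0 by rewrite eqz_nat -lt0n prime_gt0.
pose N0 := absz (Num.floor N %% q%:Z)%Z; pose t := (Num.floor N %/ q%:Z)%Z.
have NE : Num.floor N = N0%:Z + t * q%:Z.
  by rewrite /N0 gez0_abs ?modz_ge0 // addrC -divz_eq.
have N0q : (N0 < q)%N by rewrite -ltz_nat gez0_abs ?modz_ge0 // ltz_pmod // ltz_nat prime_gt0.
(* The whole shift by floor N goes into the phase, without raising its degree; the character only
   sees the residue N0 modulo q. *)
pose g := f \Po ('X + (Num.floor N)%:~R%:P).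
have sg : (size g <= d.+1)%N.
  by rewrite /g -[(_)%:~R]opprK polyCN size_comp_poly2 ?sf // size_XsubC.
have -> : \sum_(1 <= k < M.+1) e f.[(Num.floor N + k%:Z)%:~R] * chi (Num.floor N + k%:Z) =
    mixed_sum (char_Fp chi) N0 M g.
  apply: eq_bigr => k _; congr (e _ * _).
    by rewrite horner_comp !hornerE intrD -pmulrn addrC.
  rewrite -(character_nat chi qp) NE -[RHS](character_add_mul chi _ t); congr (chi _).
  by rewrite PoszD; ring.
have [b b0 chib] := nonprincipal_witness qp chin.
have cF : #|'F_q| = q by apply: card_Fp.
have dr : (d < r)%N.
  apply: leq_ltn_trans Dr; by rewrite /triangular leq_divRL // leq_mul.
have := (HCf d).2 d0 Dr 'F_q _ (char_Fp chi) (char_FpM chi qp) (char_Fp1 chi qp) (char_Fp0 chi qp)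
  b b0 chib N0 M g H.
rewrite cF => /(_ (pchar_Fp qp) N0q sg H1 MH HQ) /le_trans; apply.
rewrite ler_wpM2r ?powR_ge0 // ler_wpM2r ?powR_ge0 //.
by rewrite (bigD1 (Ordinal dr)) //= addrCA lerDl addr_ge0 // sumr_ge0.
Qed.
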